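(* Let $X$ be a Cantor group and let $f:X\to X$ be a minimal translation. Then for generic $v\in C^0(X,\mathbb{R})$ (that is, for all $v$ in some residual subset of $C^0(X,\mathbb{R})$ with the topology of uniform convergence) and for every real $\lambda\neq 0$: the spectrum $\Sigma(f,\lambda v)$ has zero Lebesgue measure, and the Lyapunov exponent $E\mapsto L(E,f,\lambda v)$, $E\in\mathbb{R}$, is a continuous function of the energy which vanishes on $\Sigma(f,\lambda v)$.
   Context: A Cantor group is a topological group $X$ whose underlying space is homeomorphic to the Cantor set. A translation is a map $f:X\to X$, $f(x)=t\cdot x$ for some fixed $t\in X$; it is minimal if $\{f^n(y): n\in\mathbb{Z}\}$ is dense in $X$ for every $y\in X$ (this forces $X$ to be Abelian, and $f$ is then uniquely ergodic with respect to Haar measure). A subset of $C^0(X,\mathbb{R})$ is residual if it contains a countable intersection of dense open sets. For $v\in C^0(X,\mathbb{R})$ and $x\in X$, the Schrödinger operator $H_{f,v,x}$ is the bounded self-adjoint operator on $\ell^2(\mathbb{Z})$ given by $(Hu)_n=u_{n+1}+u_{n-1}+v(f^n(x))u_n$. Its spectrum does not depend on $x$ when $f$ is minimal and is denoted $\Sigma(f,v)$. The transfer matrices are $A^{(E,f,v)}_n(x)=S_{n-1}\cdots S_0$, with $S_i=\begin{pmatrix}E-v(f^i(x)) & -1\\ 1 & 0\end{pmatrix}$, and the Lyapunov exponent is $L(E,f,v)=\lim_{n\to\infty}\frac1n\int_X\ln\|A^{(E,f,v)}_n(x)\|\,d\mu(x)$, where $\mu$ is the Haar probability measure on $X$. 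*)

(* Defs.v *)
From HB Require Import structures.
From mathcomp Require Import all_boot all_order all_algebra complex.
From mathcomp Require Import all_classical all_reals all_analysis.

Set Implicit Arguments.
Unset Strict Implicit.
Unset Printing Implicit Defensive.

Import Order.TTheory GRing.Theory Num.Theory.
Import numFieldTopology.Exports numFieldNormedType.Exports.
Local Open Scope classical_set_scope.
Local Open Scope ring_scope.

HB.mixin Record Topological_isTopologicalGroup G
    & Topological G & Group G := {
  mulg_continuous : continuous (fun x : G * G => (x.1 * x.2)%g) ;
  invg_continuous : continuous (fun x : G => (x^-1)%g) ;
}.

#[short(type="topologicalGroupType")]
HB.structure Definition TopologicalGroup :=
  {G of Topological G & Group G & Topological_isTopologicalGroup G}.

Definition cantor_group (X : topologicalGroupType) : Prop :=
  exists (phi : X -> cantor_space) (psi : cantor_space -> X),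
    [/\ cancel phi psi, cancel psi phi, continuous phi & continuous psi].

(* [measurableType]s are required to be pointed; 1 serves as the point. *)
Definition pointed_group (X : topologicalGroupType) : Type := X.
HB.instance Definition _ (X : topologicalGroupType) :=
  Topological.on (pointed_group X).
HB.instance Definition _ (X : topologicalGroupType) :=
  isPointed.Build (pointed_group X) (1%g : X).

Definition borel (X : topologicalGroupType) :=
  g_sigma_algebraType (@open (pointed_group X)).

Section translations.
Variable X : topologicalGroupType.
Implicit Types t x : X.

Definition translation t : X -> X := fun x => (t * x)%g.

(* The inverse of [translation t] is [translation t^-1]; recall that [Negz m]
   is the integer - m.+1. *)
Definition translation_iter t (n : int) : X -> X :=
  match n with
  | Posz m => iter m (translation t)
  | Negz m => iter m.+1 (translation (t^-1)%g)
  end.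

Definition minimal_translation t : Prop :=
  forall y : X, dense [set translation_iter t n y | n in [set: int]].

Definition haar (R : realType) (mu : probability (borel X) R) : Prop :=
  forall (s : X) (A : set (borel X)), measurable A ->
    mu (translation s @` A) = mu A.

End translations.

Definition residual (T : topologicalType) (A : set T) : Prop :=
  exists U : nat -> set T,
    (forall n, open (U n) /\ dense (U n)) /\ \bigcap_n U n `<=` A.

(* Continuous real functions with the topology of uniform convergence. *)
Definition C0 (X : topologicalType) (R : realType) : topologicalType :=
  initial_topology (id : continuousType X R -> {uniform X -> R}).

Section ell2.
Variable R : realType.
Local Notation C := R[i].
Implicit Types (u w : int -> C) (T S : (int -> C) -> (int -> C)).

Definition l2sum u : \bar R :=
  (\esum_(n in [set: int]) (ComplexField.Normc.normc (u n) ^+ 2)%:E)%E.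

Definition l2 : set (int -> C) := [set u | (l2sum u < +oo)%E].

Definition l2norm u : R := Num.sqrt (fine (l2sum u)).

(* Operators are represented by maps on all sequences, of which only the
   restriction to l2 matters. *)
Definition bounded_op T : Prop :=
  [/\ forall u, l2 u -> l2 (T u),
      forall (a : C) u w, l2 u -> l2 w ->
        T (fun n => a * u n + w n) = (fun n => a * T u n + T w n) &
      exists M : R, forall u, l2 u -> l2norm (T u) <= M * l2norm u].

Definition sub_scalar T (z : C) : (int -> C) -> (int -> C) :=
  fun u n => T u n - z * u n.

Definition spectrum T : set C :=
  [set z | ~ exists S, bounded_op S /\ forall u, l2 u ->
             S (sub_scalar T z u) = u /\ sub_scalar T z (S u) = u].

End ell2.

Section schrodinger.
Variables (R : realType) (X : topologicalGroupType) (t : X).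
Implicit Types (v : X -> R) (E : R).

Definition schrodinger v (x : X) : (int -> R[i]) -> (int -> R[i]) :=
  fun u n => u (n + 1) + u (n - 1) + (v (translation_iter t n x))%:C%C * u n.

(* The operator is self-adjoint, so its spectrum consists of real numbers. *)
Definition Sigma v (x : X) : set R :=
  [set E | spectrum (schrodinger v x) E%:C%C].

Definition transfer_step v E (x : X) (i : nat) : 'M[R]_2 :=
  \matrix_(j < 2, k < 2)
    (nth [::] [:: [:: E - v (translation_iter t i%:Z x); -1];
                  [:: 1;                                  0]] j)`_k.

Fixpoint transfer v E (n : nat) (x : X) : 'M[R]_2 :=
  if n is m.+1 then transfer_step v E x m *m transfer v E m x else 1%:M.

Definition vnorm (w : 'cV[R]_2) : R := Num.sqrt (\sum_i w i ord0 ^+ 2).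

(* Euclidean operator norm *)
Definition opnorm (A : 'M[R]_2) : R :=
  sup [set vnorm (A *m w) | w in [set w | vnorm w <= 1]].

Definition lyapunov (mu : probability (borel X) R) v E : R :=
  lim ((fun n : nat => n%:R^-1 *
    \int[mu]_(x in [set: borel X]) ln (opnorm (transfer v E n x))) @ \oo).

End schrodinger.

(* Main.v *)
(* Every continuous function on X is uniformly close to P o c for a clock c,
   that is, a locally constant map c : X -> Z/q with c (t x) = c x + 1; the
   operator with potential P o c is q-periodic. It suffices to find, near every
   continuous function, such a P for which, uniformly over couplings in a
   compact set, the spectrum is covered by intervals of small total length and
   the Lyapunov exponent is small on it, both properties being stable under
   small perturbations of the potential.

   A single energy and coupling are moved out of the spectrum of a periodic
   potential by a small perturbation making the trace of its monodromy matrix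
   exceed 2 in modulus. By compactness, finitely many periodic perturbations
   Q_j of a given potential are such that each relevant energy and coupling is
   in a gap of some Q_j. One period of P is made of long blocks, the j-th one
   repeating Q_j. An approximate eigenvector at an energy in a gap of Q_j
   decays exponentially in the j-th blocks; cutting it at their centres shows
   that the energy is exponentially close to one of the q - 1 eigenvalues of a
   finite symmetric matrix. Since there are only k (q - 1) such eigenvalues, k
   being the number of the Q_j, the spectrum is short.

   An approximate eigenvector also bounds the trace of the monodromy matrix by
   2 plus a small error, so that its powers grow slowly, even after a small
   perturbation. Finally, L is an infimum of continuous functions, hence upper
   semicontinuous, and it vanishes on the spectrum; off the spectrum the bound
   on the inverse makes log ||A_n|| superadditive up to a locally bounded
   error, so that the convergence to L is locally uniform. *)

From HB Require Import structures.
Require Import Defs.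
From mathcomp Require Import all_boot all_order all_algebra complex.
From mathcomp Require Import all_classical all_reals all_analysis.
From mathcomp Require Import ring lra zify.
Import Order.TTheory GRing.Theory Num.Theory.
Import numFieldTopology.Exports numFieldNormedType.Exports.
Local Open Scope classical_set_scope.
Local Open Scope ring_scope.

Set Implicit Arguments.
Unset Strict Implicit.
Unset Printing Implicit Defensive.

(** * Square-summable sequences and Jacobi operators *)

(** Three constraints shape the argument. Level [N] of the residual set asks for covers and
    exponents of size [N^-1] for all couplings with [N^-1 <= |lam| <= N] at once, so that a
    countable intersection reaches every nonzero coupling; hence gaps are opened on a compact set of
    pairs of an energy and a coupling. Next, the period [q] cannot be prescribed, as the group only
    supplies clocks of some arbitrarily large period. The [Q_j] and their periods, hence the decay
    rate, are fixed before [q], and the number [Z] of repetitions is then fitted to [q]. Since [q]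
    is at most linear in [Z], the total length of the cover is of order [Z s^Z] with [s < 1].
    Finally, an energy in the spectrum of a nearby potential is used only through an approximate
    eigenvector of the periodic operator, with an error fixed in advance. All periodic estimates
    start from such a vector, so stability under perturbation is built in and no Floquet theory is
    required. *)

Section sum_le.
Variables (R : realType) (T : choiceType).
Implicit Types (f g : T -> R) (y z : R).

(* For [f >= 0]: the sum of [f] over [T] is at most [y]. *)
Definition sum_le f y := forall s : seq T, uniq s -> \sum_(i <- s) f i <= y.

Lemma sum_le_mono f g y z : (forall i, f i <= g i) -> y <= z ->
  sum_le g y -> sum_le f z.
Proof.
move=> fg yz gy s us; apply: (le_trans _ yz); apply: le_trans (gy s us).
exact: ler_sum.
Qed.

Lemma sum_leD f g y z : sum_le f y -> sum_le g z ->
  sum_le (fun i => f i + g i) (y + z).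
Proof. by move=> fy gz s us; rewrite big_split lerD ?fy ?gz. Qed.

Lemma sum_leZ c f y : 0 <= c -> sum_le f y -> sum_le (fun i => c * f i) (c * y).
Proof. by move=> c0 fy s us; rewrite -mulr_sumr ler_wpM2l ?fy. Qed.

Lemma sum_le_sum n (f : nat -> T -> R) (y : nat -> R) :
  (forall k, (k < n)%N -> sum_le (f k) (y k)) ->
  sum_le (fun i => \sum_(k < n) f k i) (\sum_(k < n) y k).
Proof. by move=> fy s us; rewrite exchange_big ler_sum// => k _; apply: fy. Qed.

Lemma sum_le_at f y i : sum_le f y -> f i <= y.
Proof. by move=> /(_ [:: i] isT); rewrite big_seq1. Qed.

Lemma sum_le_at2 f y i j : i != j -> sum_le f y -> f i + f j <= y.
Proof.
move=> ij /(_ [:: i; j]) /=; rewrite inE ij => /(_ isT).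
by rewrite big_cons big_seq1.
Qed.

Lemma sum_le_ge0 f y : sum_le f y -> 0 <= y.
Proof. by move=> /(_ [::] isT); rewrite big_nil. Qed.

Lemma sum_le_inj (T' : choiceType) (h : T' -> T) f y : injective h ->
  sum_le f y -> forall s : seq T', uniq s -> \sum_(i <- s) f (h i) <= y.
Proof.
by move=> hi fy s us; rewrite -(big_map h xpredT) fy// map_inj_uniq.
Qed.

(** Fatou's lemma for the counting measure: each finite sum passes to the limit. *)
Lemma sum_le_cvg (f : nat -> T -> R) g y :
  (forall i, f n i @[n --> \oo] --> g i) -> (forall n, sum_le (f n) y) ->
  sum_le g y.
Proof.
move=> fg fy s us.
have cv : (\sum_(i <- s) f n i) @[n --> \oo] --> \sum_(i <- s) g i.
  elim: s {us} => [|a s IH].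
    rewrite big_nil (_ : (fun n => _) = fun=> 0); first exact: cvg_cst.
    by apply/funext => n; rewrite big_nil.
  rewrite big_cons (_ : (fun n => _) =
    (fun n => f n a + \sum_(i <- s) f n i)).
    exact: cvgD.
  by apply/funext => n; rewrite big_cons.
rewrite -(cvg_lim _ cv)//; apply: limr_le; first by apply/cvg_ex; eexists; exact: cv.
by near=> n; exact: fy.
Unshelve. all: by end_near. Qed.

Lemma sum_le_esum f y : (forall i, 0 <= f i) ->
  (\esum_(i in [set: T]) (f i)%:E <= y%:E)%E <-> sum_le f y.
Proof.
move=> f0; split=> [fy s us|fy].
  rewrite -lee_fin (le_trans _ fy)//.
  apply: esum_ge; exists [set` s].
    by split => //; exact: finite_seq.
  by rewrite -sumEFin fsbig_seq.
apply: ge_ereal_sup => _ [A [Af _] <-].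
by rewrite fsbig_finite//= sumEFin lee_fin fy.
Qed.

End sum_le.

Section jacobi.
Variable R : realType.
Implicit Types (V u g w : int -> R).

Definition Hop V u : int -> R := fun n => u (n + 1) + u (n - 1) + V n * u n.

Definition sq u : int -> R := fun n => u n ^+ 2.

Lemma sum_le_shift (f : int -> R) y (k : int) : sum_le f y ->
  sum_le (fun n => f (n + k)) y.
Proof. by move=> fy s us; apply: sum_le_inj us => //; apply: addIr. Qed.

Lemma HopD V u w n : Hop V (fun n => u n + w n) n = Hop V u n + Hop V w n.
Proof. rewrite /Hop; ring. Qed.

Lemma HopB V u w n : Hop V (fun n => u n - w n) n = Hop V u n - Hop V w n.
Proof. rewrite /Hop; ring. Qed.

Lemma HopZ V c u n : Hop V (fun n => c * u n) n = c * Hop V u n.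
Proof. rewrite /Hop; ring. Qed.

Lemma sqrD2 (a b : R) : (a + b) ^+ 2 <= 2 * a ^+ 2 + 2 * b ^+ 2.
Proof. have := sqr_ge0 (a - b); nra. Qed.

Lemma sqrD3 (a b c : R) : (a + b + c) ^+ 2 <= 3 * (a ^+ 2 + b ^+ 2 + c ^+ 2).
Proof.
have := sqr_ge0 (a - b); have := sqr_ge0 (a - c); have := sqr_ge0 (b - c); nra.
Qed.

(** The coefficient of [a ^+ 2] can be taken close to 1. With 2 in its place, neither the bound on
    the iterates in [Hop_surj] nor the gain at each step of [block_decay] would survive. *)
Lemma sqrD_weighted (d a b : R) : 0 < d ->
  (a + b) ^+ 2 <= (1 + d) * a ^+ 2 + (1 + d^-1) * b ^+ 2.
Proof.
move=> d0; have h : 0 <= d * (a - d^-1 * b) ^+ 2.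
  by rewrite mulr_ge0// ?sqr_ge0// ltW.
have e : d * (a - d^-1 * b) ^+ 2 = d * a ^+ 2 - 2 * a * b + d^-1 * b ^+ 2.
  by field; rewrite gt_eqF.
nra.
Qed.

Lemma sq_abs_le (a b : R) : `|a| <= b -> a ^+ 2 <= b ^+ 2.
Proof. by move=> ab; rewrite -real_normK ?num_real// ler_sqr// nnegrE ?(le_trans _ ab). Qed.

Lemma Hop_bounded V u K y : (forall n, `|V n| <= K) -> sum_le (sq u) y ->
  sum_le (sq (Hop V u)) (3 * (2 + K ^+ 2) * y).
Proof.
move=> VK uy.
have h1 := sum_le_shift 1 uy.
have h2 := sum_le_shift (- 1) uy.
have h3 : sum_le (fun n => K ^+ 2 * sq u n) (K ^+ 2 * y) by apply: sum_leZ; rewrite ?sqr_ge0.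
have := sum_leZ (ler0n R 3) (sum_leD (sum_leD h1 h2) h3).
apply: sum_le_mono => [n|]; last lra.
apply: le_trans (sqrD3 _ _ _) _.
rewrite ler_pM2l// lerD2l exprMn ler_wpM2r ?sqr_ge0//.
exact: sq_abs_le.
Qed.

End jacobi.

Section sum_le_total.
Variables (R : realType) (T : choiceType).
Implicit Types (f : T -> R) (y : R).

(* The exact sum, as opposed to the upper bounds recorded by [sum_le]. *)
Lemma sum_le_total f y : sum_le f y -> exists2 N, sum_le f N &
  forall e, 0 < e -> exists2 s : seq T, uniq s & N - e < \sum_(i <- s) f i.
Proof.
move=> fy; pose A := [set \sum_(i <- s) f i | s in [set s : seq T | uniq s]].
have sA : has_sup A.
  split; first by exists (\sum_(i <- [::]) f i), [::].
  by exists y => _ [s us <-]; exact: fy.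
exists (sup A) => [s us|e e0].
  by apply: sup_upper_bound => //; exists s.
by have [_ [s us <-] h] := sup_adherent e0 sA; exists s.
Qed.

Lemma sum_le_small f y e : sum_le f y -> (forall i, 0 <= f i) -> 0 < e ->
  exists s : seq T, forall i, i \notin s -> f i < e.
Proof.
move=> /sum_le_total[N fN app] f0 e0; have [s us h] := app _ e0.
exists s => i is_; have := fN (i :: s); rewrite /= is_ us big_cons => /(_ isT).
lra.
Qed.

End sum_le_total.

Definition window (M : nat) : seq int := [seq k%:Z - M%:Z | k <- iota 0 (M + M).+1].

Lemma window_uniq M : uniq (window M).
Proof. by rewrite map_inj_uniq ?iota_uniq// => a b; lia. Qed.

Lemma mem_window M (i : int) : (i \in window M) = (absz i <= M)%N.
Proof.
apply/mapP/idP => [[k]|iM].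
  by rewrite mem_iota => kM ->; lia.
by exists (absz (i + M%:Z)); [rewrite mem_iota|]; lia.
Qed.

Lemma window_outside M :
  (M.+1%:Z \notin window M) && (- M.+1%:Z - 1 \notin window M).
Proof. by rewrite !mem_window; lia. Qed.

Lemma sub_windowS M : {subset window M <= window M.+1}.
Proof. by move=> i; rewrite !mem_window => /leqW. Qed.

Lemma window_absorbs (s : seq int) : exists M, {subset s <= window M}.
Proof.
elim: s => [|a s [M IH]]; first by exists 0%N.
exists (maxn M (absz a)) => i; rewrite inE mem_window => /orP[/eqP->|/IH].
  exact: leq_maxr.
by rewrite mem_window => h; rewrite leq_max h.
Qed.

Lemma ler_sum_subset (R : numDomainType) (T : eqType) (f : T -> R) (s s' : seq T) :
  (forall i, 0 <= f i) -> uniq s -> {subset s <= s'} ->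
  \sum_(i <- s) f i <= \sum_(i <- s') f i.
Proof.
move=> f0; elim: s s' => [|a s IH] s' /=; first by rewrite big_nil sumr_ge0.
move=> /andP[as_ us] ss'; rewrite big_cons.
have as' : a \in s' by apply: ss'; rewrite inE eqxx.
rewrite (perm_big _ (perm_to_rem as')) big_cons lerD2l IH// => i is_.
have ia : i != a by apply: contraNN as_ => /eqP <-.
have : i \in s' by apply: ss'; rewrite inE is_ orbT.
by rewrite (perm_mem (perm_to_rem as')) inE (negPf ia).
Qed.

Section inversion.
Variable R : realType.
Implicit Types (V u g w : int -> R).

(* [||u||^2 <= C ||Hop V u||^2] on l2 *)
Definition lower V C := forall u, (exists z, sum_le (sq u) z) ->
  forall y, sum_le (sq (Hop V u)) y -> sum_le (sq u) (C * y).

Lemma window_telescope (W : int -> R) M :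
  \sum_(i <- window M) (W i - W (i - 1)) = W M%:Z - W (- M%:Z - 1).
Proof.
rewrite big_map.
have -> : iota 0 (M + M).+1 = index_iota 0 (M + M).+1 by rewrite /index_iota subn0.
rewrite (telescope_sumr_eq (fun k => W (k%:Z - M%:Z - 1)))//.
  by congr (W _ - W _); lia.
by move=> k _; congr (W _ - W _); lia.
Qed.

Lemma Hop_bound_const (K : R) : 1 <= 3 * (2 + K ^+ 2).
Proof. have := sqr_ge0 K; lra. Qed.

(* With [A := Hop V], [a >= ||A||^2], [c := 1 / a]: A is symmetric, so
   ||u - c A^2 u||^2 = ||u||^2 - 2 c ||A u||^2 + c^2 ||A (A u)||^2
                    <= ||u||^2 - c ||A u||^2 <= (1 - c / C) ||u||^2. *)
Lemma Hop_sq_contraction V K C u y : (forall n, `|V n| <= K) -> 1 <= C ->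
  lower V C -> sum_le (sq u) y ->
  let c := (3 * (2 + K ^+ 2))^-1 in
  sum_le (sq (fun n => u n - c * Hop V (Hop V u) n)) ((1 - c / C) * y).
Proof.
move=> VK C1 lo uy c.
have a1 := Hop_bound_const K.
set a := 3 * (2 + K ^+ 2) in a1 c *.
have a0 : 0 < a by apply: lt_le_trans a1.
have c0 : 0 < c by rewrite invr_gt0.
have c1 : c <= 1 by rewrite invf_le1.
have C0 : 0 < C by apply: lt_le_trans C1.
have [N uN appu] := sum_le_total uy.
have Ny : N <= y.
  rewrite leNgt; apply/negP => yN.
  have [s us h] := appu (N - y) ltac:(lra).
  have := uy _ us; lra.
have [G gG appg] := sum_le_total (Hop_bounded VK uy).
have AgG := Hop_bounded VK gG.
set g := Hop V u in gG appg AgG *.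
have G0 := sum_le_ge0 gG; have N0 := sum_le_ge0 uN.
have NG : N <= C * G.
  rewrite leNgt; apply/negP => yN.
  have [s us h] := appu (N - C * G) ltac:(lra).
  have := lo u (ex_intro _ N uN) G gG s us; lra.
(* Symmetry in finite form: [u n * Hop V g n - g n * Hop V u n = W n - W (n - 1)]. Over a window,
   symmetry fails only by the two boundary values of [W]. *)
pose W n := u n * g (n + 1) - g n * u (n + 1).
have key n : sq (fun n => u n - c * Hop V g n) n =
   sq u n - 2 * c * sq g n + c ^+ 2 * sq (Hop V g) n - 2 * c * (W n - W (n - 1)).
  by rewrite /sq /W /g /Hop !subrK; ring.
move=> s us; apply/ler_addgt0Pl => e e0.
(* Four parts pay for the two boundary values of [W], taken with the factor [2 * c <= 2], and two
   for replacing the window sum of [sq g] by [G]. *)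
pose e' := e / 6.
have e'0 : 0 < e' by rewrite /e'; lra.
have [sg usg hg] := appg _ e'0.
have [s1 hs1] : exists s1 : seq int, forall i, i \notin s1 ->
    sq u i + sq g i + sq u (i + 1) + sq g (i + 1) < e'.
  have h := sum_leD uN gG.
  have h' := sum_leD h (sum_le_shift 1 h).
  have [i|s1 h1] := sum_le_small h' _ e'0; first by rewrite !addr_ge0 ?sqr_ge0.
  by exists s1 => i is1; have := h1 i is1; rewrite !addrA.
have [M hM] := window_absorbs (s ++ sg ++ s1).
have WM (i : int) : i \notin s1 -> `|W i| <= e'.
  move=> /hs1; rewrite /sq /W => h; rewrite ler_norml.
  have := sqr_ge0 (u i + g (i + 1)); have := sqr_ge0 (u i - g (i + 1)).
  have := sqr_ge0 (g i + u (i + 1)); have := sqr_ge0 (g i - u (i + 1)).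
  have := sqr_ge0 (u i); have := sqr_ge0 (g i);
  have := sqr_ge0 (u (i+1)); have := sqr_ge0 (g (i+1)).
  by move=> *; apply/andP; split; nra.
have W1 : `|W M.+1%:Z| <= e'.
  apply: WM; have /andP[+ _] := window_outside M; apply: contraNN => h.
  by apply: hM; rewrite !mem_cat h !orbT.
have W2 : `|W (- M.+1%:Z - 1)| <= e'.
  apply: WM; have /andP[_] := window_outside M; apply: contraNN => h.
  by apply: hM; rewrite !mem_cat h !orbT.
have sub (r : seq int) : {subset r <= s ++ sg ++ s1} -> {subset r <= window M.+1}.
  by move=> h i /h /hM /sub_windowS.
apply: (@le_trans _ _ (\sum_(i <- window M.+1) sq (fun n => u n - c * Hop V g n) i)).
  by apply: ler_sum_subset => // [i|]; [exact: sqr_ge0|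
    apply: sub => i is_; rewrite mem_cat is_].
have gw : G - e' <= \sum_(i <- window M.+1) sq g i.
  apply: le_trans (ltW hg) _; apply: ler_sum_subset => // [i|]; first exact: sqr_ge0.
  by apply: sub => i is_; rewrite !mem_cat is_ orbT.
under eq_bigr do rewrite key.
rewrite !sumrB !big_split /= sumrN -!mulr_sumr.
rewrite window_telescope.
have h1 := uN _ (window_uniq M.+1).
have h2 := AgG _ (window_uniq M.+1).
have h3 : c ^+ 2 * \sum_(i <- window M.+1) sq (Hop V g) i <= c * G.
  have -> : c * G = c ^+ 2 * (a * G) by rewrite /c; field; rewrite gt_eqF.
  by rewrite ler_wpM2l ?sqr_ge0.
have h4 : 2 * c * (G - e') <= 2 * c * \sum_(i <- window M.+1) sq g i.
  by rewrite ler_wpM2l// mulr_ge0// ltW.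
have h5 : - (2 * c * (W M.+1%:Z - W (- M.+1%:Z - 1))) <= 4 * e'.
  move: W1 W2; rewrite !ler_norml => /andP[? ?] /andP[? ?]; nra.
have h6 : c / C * N <= c * G.
  by rewrite -mulrA ler_wpM2l ?(ltW c0)// mulrC ler_pdivrMr// mulrC.
have h7 : (1 - c / C) * N <= (1 - c / C) * y.
  by rewrite ler_wpM2l// subr_ge0 ler_pdivrMr// mul1r (le_trans c1).
have h8 : c * e' <= e' by rewrite ler_piMl// ltW.
have ee : e = 6 * e' by rewrite /e'; field.
rewrite ee; lra.
Qed.

End inversion.

Section surjectivity.
Variable R : realType.
Implicit Types (V u g w : int -> R).

(** With [A := Hop V], the iteration [x - c * A (A x) + c * w] converges to a solution of
    [A (A u) = w], because [Hop_sq_contraction] contracts its increments; [A u] is the preimage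
    sought. Passing to the square makes the operator positive, as the contraction demands. *)
Lemma Hop_surj V K C w y : (forall n, `|V n| <= K) -> 1 <= C ->
  lower V C -> sum_le (sq w) y ->
  exists2 u, (exists z, sum_le (sq u) z) & forall n, Hop V u n = w n.
Proof.
move=> VK C1 lo wy.
pose c := (3 * (2 + K ^+ 2))^-1.
have contr u z := Hop_sq_contraction VK C1 lo (u := u) (y := z).
rewrite /= -/c in contr.
have a1 := Hop_bound_const K.
have c0 : 0 < c by rewrite invr_gt0 (lt_le_trans _ a1).
have c1 : c <= 1 by rewrite invf_le1// (lt_le_trans _ a1).
have C0 : 0 < C by apply: lt_le_trans C1.
have r0 : 0 <= 1 - c / C by rewrite subr_ge0 ler_pdivrMr// mul1r (le_trans c1).
have r1 : 1 - c / C < 1 by rewrite ltrBlDr ltrDl divr_gt0.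
set r := 1 - c / C in contr r0 r1.
pose B u := Hop V (Hop V u).
have BB u u' n : B (fun n => u n - u' n) n = B u n - B u' n.
  by rewrite /B /Hop; ring.
pose x k := iter k (fun u n => u n - c * B u n + c * w n) (fun=> 0).
have xS k n : x k.+1 n = x k n - c * B (x k) n + c * w n by [].
pose d k n := x k.+1 n - x k n.
have dE k n : d k n = c * (w n - B (x k) n) by rewrite /d xS; ring.
have dS k : d k.+1 = fun n => d k n - c * B (d k) n.
  apply/funext => n; have dk : B (d k) n = B (x k.+1) n - B (x k) n by rewrite -BB.
  by rewrite dk !dE; ring.
have d_le k : sum_le (sq (d k)) (r ^+ k * (c ^+ 2 * y)).
  elim: k => [|k IH]; last first.
    by rewrite dS exprS -mulrA; apply: contr.
  rewrite expr0 mul1r; apply: (sum_le_mono _ (lexx _) (sum_leZ (sqr_ge0 c) wy)).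
  move=> n; rewrite /sq dE (_ : B (x 0%N) n = 0) ?subr0 ?exprMn//.
  by rewrite /B /Hop /=; ring.
(* Here [(1 + e) * r + (1 - r) / 2 <= 1], and [Y] is such that the source term [c * w] contributes
   [(1 - r) / 2 * Y]; so the bound [Y] reproduces itself. *)
pose e := (1 - r) / 2.
have e0 : 0 < e by rewrite /e; lra.
pose Y := 2 * ((1 + e^-1) * (c ^+ 2 * y)) / (1 - r).
have y0 := sum_le_ge0 wy.
have f0 : 0 <= (1 + e^-1) * (c ^+ 2 * y).
  apply: mulr_ge0; last by rewrite mulr_ge0// sqr_ge0.
  by apply: addr_ge0 => //; rewrite invr_ge0 ltW.
have Y0 : 0 <= Y.
  apply: divr_ge0; first exact: mulr_ge0.
  by rewrite subr_ge0 ltW.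
have x_le k : sum_le (sq (x k)) Y.
  elim: k => [|k IH].
    move=> s us; rewrite big1// => n _.
    by rewrite /sq expr0n.
  have h1 := sum_leZ (_ : 0 <= 1 + e) (contr _ _ IH).
  have h2 := sum_leZ (_ : 0 <= 1 + e^-1) (sum_leZ (sqr_ge0 c) wy).
  apply: (sum_le_mono _ _ (sum_leD (h1 _) (h2 _))).
  - move=> n; rewrite [sq (x k.+1)]/sq xS; apply: le_trans (sqrD_weighted _ _ e0) _.
    by rewrite lerD2l /sq exprMn.
  - have YE : (1 + e^-1) * (c ^+ 2 * y) = (1 - r) / 2 * Y.
      have r1' : 1 - r != 0 by rewrite subr_eq0 gt_eqF.
      have half (f t : R) : t != 0 -> f = t / 2 * (2 * f / t) by move=> t0; field.
      exact: half.
    rewrite YE mulrA -mulrDl ler_piMl// /e.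
    have := sqr_ge0 (1 - r); nra.
  - by rewrite addr_ge0// ltW.
  - by rewrite addr_ge0// invr_ge0 ltW.
have sr1 : `|Num.sqrt r| < 1.
  by rewrite ger0_norm ?sqrtr_ge0// -sqrtr1 ltr_sqrt.
have d_abs k n : `|d k n| <= Num.sqrt (c ^+ 2 * y) * Num.sqrt r ^+ k.
  have cy0 : 0 <= c ^+ 2 * y by rewrite mulr_ge0 ?sqr_ge0.
  rewrite -(@ler_pXn2r _ 2)// ?nnegrE ?mulr_ge0 ?exprn_ge0 ?sqrtr_ge0//.
  rewrite real_normK ?num_real// exprMn exprAC (sqr_sqrtr cy0) (sqr_sqrtr r0).
  by rewrite mulrC; exact: (sum_le_at n (d_le k)).
have xE n : (fun k => x k n) = series (fun k => d k n).
  apply/funext => k; rewrite seriesEnat /= telescope_sumr//.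
  by rewrite subr0.
have xcv n : cvgn ((fun k => x k n)).
  rewrite xE; apply: normed_cvg.
  apply: (series_le_cvg _ _ (fun k => d_abs k n)) => //.
  exact: is_cvg_geometric_series.
pose u n := limn ((fun k => x k n)).
have xu n : x k n @[k --> \oo] --> u n by exact: xcv.
have Hcv z z' : (forall n, (z : nat -> int -> R) k n @[k --> \oo] --> (z' n : R)) ->
    forall n, Hop V (z k) n @[k --> \oo] --> Hop V z' n.
  move=> zz n; apply: cvgD; first by apply: cvgD.
  by apply: cvgM => //; exact: cvg_cst.
exists (Hop V u).
  eexists; apply: Hop_bounded VK _.
  apply: (sum_le_cvg (f := fun k => sq (x k))) (x_le) => n.
  exact: (cvgM (xu n) (xu n)).
move=> n.
have Bx : B (x k) n @[k --> \oo] --> B u n by apply: (Hcv); apply: (Hcv).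
have d0 : d k n @[k --> \oo] --> 0.
  apply/norm_cvg0P; apply: (@squeeze_cvgr _ _ _ _ (fun=> 0)
    (fun k => Num.sqrt (c ^+ 2 * y) * Num.sqrt r ^+ k)).
  - by apply: nearW => k; rewrite normr_ge0 d_abs.
  - exact: cvg_cst.
  - rewrite -[X in _ --> X](mulr0 (Num.sqrt (c ^+ 2 * y))).
    by apply: cvgM; [exact: cvg_cst|exact: cvg_expr].
have d1 : d k n @[k --> \oo] --> c * (w n - B u n).
  rewrite (_ : (fun k => d k n) = (fun k => c * (w n - B (x k) n))); last first.
    by apply/funext => k; rewrite dE.
  by apply: cvgM; [exact: cvg_cst|apply: cvgB => //; exact: cvg_cst].
have /eqP : c * (w n - B u n) = 0 by exact: (cvg_unique _ d1 d0).
by rewrite mulf_eq0 gt_eqF//= subr_eq0 => /eqP ->.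
Qed.

End surjectivity.

(** * The spectrum and approximate eigenvectors *)

Local Notation Re := (@complex.Re _).
Local Notation Im := (@complex.Im _).

Section complex_l2.
Variable R : realType.
Implicit Types (V : int -> R) (u w : int -> R[i]).

Definition csq u : int -> R := fun n => Re (u n) ^+ 2 + Im (u n) ^+ 2.

Lemma csq_ge0 u n : 0 <= csq u n.
Proof. by rewrite addr_ge0 ?sqr_ge0. Qed.

Lemma l2sumE u : l2sum u = (\esum_(n in [set: int]) (csq u n)%:E)%E.
Proof.
apply: eq_esum => n _; congr (_%:E); rewrite /csq; case: (u n) => a b /=.
by rewrite sqr_sqrtr// addr_ge0 ?sqr_ge0.
Qed.

Lemma l2sum_ge0 u : (0 <= l2sum u)%E.
Proof. by rewrite l2sumE esum_ge0// => n _; rewrite lee_fin csq_ge0. Qed.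

Lemma l2sum_fin u : l2 u -> l2sum u = (fine (l2sum u))%:E.
Proof. by move=> lu; rewrite fineK// fin_numE gt_eqF ?lt_eqF// (lt_le_trans _ (l2sum_ge0 u)). Qed.

Lemma l2_sum_le u : l2 u -> sum_le (csq u) (fine (l2sum u)).
Proof.
move=> /l2sum_fin ue; apply/sum_le_esum; first exact: csq_ge0.
by rewrite -ue l2sumE.
Qed.

Lemma sum_le_l2 u y : sum_le (csq u) y -> l2 u /\ fine (l2sum u) <= y.
Proof.
move=> /(sum_le_esum _ (csq_ge0 u)); rewrite -l2sumE => h.
have lu : l2 u by apply: le_lt_trans h _; rewrite ltry.
by split => //; rewrite -lee_fin -l2sum_fin.
Qed.

Lemma l2norm_sqr u : l2norm u ^+ 2 = fine (l2sum u).
Proof. by rewrite sqr_sqrtr// fine_ge0// l2sum_ge0. Qed.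

Lemma sum_le_csq u a b : sum_le (sq (Re \o u)) a ->
  sum_le (sq (Im \o u)) b -> sum_le (csq u) (a + b).
Proof. exact: sum_leD. Qed.

Lemma sum_le_Re u y : sum_le (csq u) y -> sum_le (sq (Re \o u)) y.
Proof. by apply: sum_le_mono => // n; rewrite lerDl sqr_ge0. Qed.

Lemma sum_le_Im u y : sum_le (csq u) y -> sum_le (sq (Im \o u)) y.
Proof. by apply: sum_le_mono => // n; rewrite lerDr sqr_ge0. Qed.

End complex_l2.

Section spectrum_criterion.
Variables (R : realType) (X : topologicalGroupType) (t : X).
Implicit Types (v : X -> R) (x : X) (E : R).

Definition pot v x E : int -> R := fun n => v (translation_iter t n x) - E.

(** The potential and the energy are real, so the complex operator is two copies of the real one;
    from here on only real sequences matter. *)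
Lemma sub_scalarE v x E (u : int -> R[i]) :
  sub_scalar (schrodinger t v x) E%:C%C u =
  fun n => Complex (Hop (pot v x E) (Re \o u) n)
                   (Hop (pot v x E) (Im \o u) n).
Proof.
apply/funext => n; rewrite /sub_scalar /schrodinger /Hop /pot /=.
case: (u (n + 1)) => a b; case: (u (n - 1)) => c d; case: (u n) => e f.
by apply/eqP; rewrite eq_complex /=; apply/andP; split; apply/eqP; ring.
Qed.

Lemma lower_inj V C (u : int -> R) : lower V C -> (exists z, sum_le (sq u) z) ->
  (forall n, Hop V u n = 0) -> forall n, u n = 0.
Proof.
move=> lo lu Hu n; have h0 : sum_le (sq (Hop V u)) 0.
  by move=> s us; rewrite big1// => i _; rewrite /sq Hu expr0n.
have := sum_le_at n (lo _ lu _ h0); rewrite mulr0 => h.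
by apply/eqP; rewrite -sqrf_eq0 eq_le h sqr_ge0.
Qed.

(** A symmetric operator bounded below is invertible. Preimages come from [Hop_surj] and are picked
    by choice, the lower bound controls their norm, and uniqueness yields linearity and the left
    inverse. *)
Lemma notin_Sigma v x E K C : (forall n, `|pot v x E n| <= K) -> 1 <= C ->
  lower (pot v x E) C -> ~ Sigma t v x E.
Proof.
move=> VK C1 lo; apply; set V := pot v x E in VK lo *.
have ex (w : int -> R[i]) : exists u, l2 w ->
    [/\ l2 u, fine (l2sum u) <= C * fine (l2sum w) &
      sub_scalar (schrodinger t v x) E%:C%C u = w].
  have [lw|nlw] := pselect (l2 w); last by exists w => /nlw.
  have yw := l2_sum_le lw.
  have [a [ya la] Ha] := Hop_surj VK C1 lo (sum_le_Re yw).
  have [b [yb lb] Hb] := Hop_surj VK C1 lo (sum_le_Im yw).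
  exists (fun n => Complex (a n) (b n)) => _; rewrite sub_scalarE.
  have e : (fun n => Complex (Hop V a n) (Hop V b n)) = w.
    by apply/funext => n; rewrite Ha Hb /=; case: (w n).
  have la' := lo a (ex_intro _ ya la); have lb' := lo b (ex_intro _ yb lb).
  (* Exact sums of the two parts: bounding each part by the full norm would turn [C] into
     [2 * C]. *)
  have [A Aw appA] := sum_le_total (sum_le_Re yw).
  have [B Bw appB] := sum_le_total (sum_le_Im yw).
  have Haw : Hop V a = Re \o w by apply/funext => n; rewrite Ha.
  have Hbw : Hop V b = Im \o w by apply/funext => n; rewrite Hb.
  have AB : A + B <= fine (l2sum w).
    apply/ler_addgt0Pl => e0 e0p.
    have [s us hs] := appA (e0 / 2) ltac:(lra).
    have [s' us' hs'] := appB (e0 / 2) ltac:(lra).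
    have /(_ _ (undup_uniq (s ++ s'))) := yw; rewrite big_split /=.
    have h1 : \sum_(i <- s) sq (Re \o w) i <=
       \sum_(i <- undup (s ++ s')) sq (Re \o w) i.
      apply: ler_sum_subset => // [i|i is_]; first exact: sqr_ge0.
      by rewrite mem_undup mem_cat is_.
    have h2 : \sum_(i <- s') sq (Im \o w) i <=
       \sum_(i <- undup (s ++ s')) sq (Im \o w) i.
      apply: ler_sum_subset => // [i|i is_]; first exact: sqr_ge0.
      by rewrite mem_undup mem_cat is_ orbT.
    rewrite /sq /= in h1 h2 hs hs' *; lra.
  have laA : sum_le (sq a) (C * A) by apply: la'; rewrite Haw.
  have lbB : sum_le (sq b) (C * B) by apply: lb'; rewrite Hbw.
  have [l le] := sum_le_l2 (sum_le_csq (u := fun n => Complex (a n) (b n)) laA lbB).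
  split => //; apply: le_trans le _; rewrite -mulrDr ler_wpM2l//.
  exact: le_trans C1.
have [S HS] := choice ex.
have uniq (u u' : int -> R[i]) : l2 u -> l2 u' ->
    sub_scalar (schrodinger t v x) E%:C%C u =
    sub_scalar (schrodinger t v x) E%:C%C u' -> u = u'.
  move=> lu lu'; rewrite !sub_scalarE => h.
  have [yu yu'] := (l2_sum_le lu, l2_sum_le lu').
  have part (p : R[i] -> R) : (exists y, sum_le (sq (p \o u)) y) ->
      (exists y, sum_le (sq (p \o u')) y) ->
      (forall n, Hop V (p \o u) n = Hop V (p \o u') n) ->
      forall n, p (u n) = p (u' n).
    move=> [y hy] [y' hy'] e n; apply/eqP; rewrite -subr_eq0; apply/eqP.
    apply: (lower_inj (u := fun n => p (u n) - p (u' n)) lo) => [|m].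
      exists (2 * y + 2 * y').
      have := sum_leD (sum_leZ (ler0n R 2) hy) (sum_leZ (ler0n R 2) hy').
      apply: sum_le_mono => // m; apply: le_trans (sqrD2 _ _) _.
      by rewrite sqrrN.
    by rewrite HopB; apply/eqP; rewrite subr_eq0; apply/eqP; exact: (e m).
  have hR n := congr1 (fun f => Re (f n)) h.
  have hI n := congr1 (fun f => Im (f n)) h.
  apply/funext => n; apply/eqP; rewrite eq_complex; apply/andP; split; apply/eqP.
    by apply: (part) hR n; eexists; apply: sum_le_Re; eassumption.
  by apply: (part) hI n; eexists; apply: sum_le_Im; eassumption.
have l2D (a : R[i]) u w : l2 u -> l2 w -> l2 (fun n => a * u n + w n).
  move=> lu lw; have [yu yw] := (l2_sum_le lu, l2_sum_le lw).
  case: a => a b.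
  have h := sum_leD (sum_leZ (_ : 0 <= 2 * (a ^+ 2 + b ^+ 2)) yu) (sum_leZ (ler0n R 2) yw).
  refine (proj1 (sum_le_l2 (sum_le_mono _ (lexx _) (h _)))); last first.
    by rewrite mulr_ge0// addr_ge0 ?sqr_ge0.
  move=> n; rewrite /csq; case: (u n) => c d; case: (w n) => e f /=.
  rewrite -subr_ge0; set lhs := (X in 0 <= X).
  have -> : lhs = (a * c - b * d - e) ^+ 2 + (a * d + b * c - f) ^+ 2.
    by rewrite /lhs; ring.
  by rewrite addr_ge0 ?sqr_ge0.
have l2T u : l2 u -> l2 (sub_scalar (schrodinger t v x) E%:C%C u).
  move=> lu; have yu := l2_sum_le lu; rewrite sub_scalarE.
  have h := sum_le_csq (u := fun n => Complex (Hop V (Re \o u) n) (Hop V (Im \o u) n))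
    (Hop_bounded VK (sum_le_Re yu)) (Hop_bounded VK (sum_le_Im yu)).
  exact: (proj1 (sum_le_l2 h)).
exists S; split; last first.
  move=> u lu; split; last by have [] := HS _ lu.
  have lTu := l2T _ lu; have [lS _ eS] := HS _ lTu.
  by apply: uniq.
split => [w lw|a u w lu lw|].
- by have [] := HS _ lw.
- have [lSu _ eu] := HS _ lu; have [lSw _ ew] := HS _ lw.
  have [l1 _ e1] := HS _ (l2D a u w lu lw).
  apply: uniq => //; first exact: l2D.
  rewrite e1 -{1}eu -{1}ew; apply/funext => n.
  by rewrite /sub_scalar /schrodinger; ring.
- exists (Num.sqrt C) => u lu; have [_ le _] := HS _ lu.
  rewrite /l2norm -sqrtrM ?(le_trans _ C1)//.
  exact: ler_wsqrtr.
Qed.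

Lemma Sigma_lower v x E : ~ Sigma t v x E ->
  exists2 C, 1 <= C & lower (pot v x E) C.
Proof.
move=> /contrapT[S [[_ _ [M bM]] inv]].
exists (Num.max 1 (M ^+ 2)); first by rewrite le_max lexx.
move=> u [z uz] y Hy.
pose cu (n : int) : R[i] := Complex (u n) 0.
have l0 f : (forall n, f n = 0 :> R) -> sum_le (sq f) 0.
  by move=> f0 s us; rewrite big1// => i _; rewrite /sq f0 expr0n.
have lu : l2 cu.
  exact: (proj1 (sum_le_l2 (sum_le_csq (u := cu) uz (l0 _ (fun=> erefl))))).
have Tu : sub_scalar (schrodinger t v x) E%:C%C cu =
    fun n => Complex (Hop (pot v x E) u n) 0.
  rewrite sub_scalarE; apply/funext => n; congr Complex.
  by rewrite /Hop /=; ring.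
have [lT yT] := sum_le_l2
  (sum_le_csq (u := fun n => Complex (Hop (pot v x E) u n) 0) Hy (l0 _ (fun=> erefl))).
rewrite -Tu in lT yT.
have [e _] := inv _ lu.
have := bM _ lT; rewrite e => h.
have h2 : fine (l2sum cu) <= M ^+ 2 * y.
  rewrite -l2norm_sqr; apply: (@le_trans _ _ ((M * l2norm (sub_scalar (schrodinger t v x) E%:C%C cu)) ^+ 2)).
    by apply: sq_abs_le; rewrite ger0_norm// sqrtr_ge0.
  by rewrite exprMn l2norm_sqr ler_wpM2l ?sqr_ge0//; rewrite addr0 in yT.
apply: (sum_le_mono (fun n => lexx _) _ (sum_le_Re (l2_sum_le lu))).
apply: le_trans h2 _; rewrite ler_wpM2r ?(sum_le_ge0 Hy)//.
by rewrite le_max lexx orbT.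
Qed.

End spectrum_criterion.

Section approx_kernel.
Variable R : realType.
Implicit Types (V u g w : int -> R).

(* [||u|| = 1] and [||Hop V u||^2 <= z] *)
Definition approx_kernel V := forall z, 0 < z -> exists u,
  [/\ sum_le (sq u) 1, forall y, sum_le (sq u) y -> 1 <= y &
      sum_le (sq (Hop V u)) z].

(** A sequence violating the lower bound would, once divided by its exact norm, be an approximate
    kernel vector for the excluded [z]. *)
Lemma not_approx_kernel V : ~ approx_kernel V -> exists2 C, 1 <= C & lower V C.
Proof.
move=> /existsNP[z /not_implyP[z0 /forallNP nu]].
exists (Num.max 1 z^-1); first by rewrite le_max lexx.
move=> u [z' uz'] y Hy; have [N uN appN] := sum_le_total uz'.
have y0 := sum_le_ge0 Hy; have N0 := sum_le_ge0 uN.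
suff NC : N <= z^-1 * y.
  apply: (sum_le_mono (fun n => lexx _) _ uN); apply: le_trans NC _.
  by rewrite ler_wpM2r// le_max lexx orbT.
move: N0; rewrite le_eqVlt => /predU1P[<-|N0].
  by rewrite mulr_ge0// invr_ge0 ltW.
rewrite leNgt; apply/negP => Ny.
pose c := (Num.sqrt N)^-1.
have c2 : c ^+ 2 = N^-1 by rewrite exprVn sqr_sqrtr// ltW.
apply: (nu (fun n => c * u n)); split.
- have := sum_leZ (sqr_ge0 c) uN; rewrite c2 mulVf ?gt_eqF//.
  by apply: sum_le_mono => // n; rewrite /sq exprMn c2.
- move=> y' hy'; rewrite leNgt; apply/negP => y'1.
  have [s us] := appN (N * (1 - y')) ltac:(by rewrite mulr_gt0// subr_gt0).
  have := hy' _ us; under eq_bigr do rewrite /sq exprMn c2.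
  rewrite -mulr_sumr ler_pdivrMl// => h.
  rewrite ltNge => /negP; apply; rewrite mulrBr mulr1 opprB addrC subrK.
  exact: h.
- have := sum_leZ (sqr_ge0 c) Hy; apply: sum_le_mono => [n|].
    by rewrite {1}/sq HopZ exprMn.
  rewrite c2 ler_pdivrMl// mulrC -ler_pdivrMl//; exact: ltW.
Qed.

Lemma Hop_perturb V V' u s z r : (forall n, `|V n - V' n| <= r) ->
  sum_le (sq u) s -> sum_le (sq (Hop V u)) z ->
  sum_le (sq (Hop V' u)) (2 * z + 2 * (r ^+ 2 * s)).
Proof.
move=> VV' us Hz.
have h := sum_leD (sum_leZ (ler0n R 2) Hz) (sum_leZ (ler0n R 2) (sum_leZ (sqr_ge0 r) us)).
apply: sum_le_mono h => // n.
have -> : sq (Hop V' u) n = (Hop V u n + (V' n - V n) * u n) ^+ 2.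
  by rewrite /sq /Hop; congr (_ ^+ 2); ring.
apply: le_trans (sqrD2 _ _) _; rewrite lerD2l ler_pM2l// exprMn.
by rewrite ler_wpM2r ?sqr_ge0// sq_abs_le// distrC.
Qed.

(** The perturbation contributes [2 * C * r ^+ 2 * N <= N / 2], which is absorbed into the left-hand
    side [N]. *)
Lemma lower_perturb V V' C r : (forall n, `|V n - V' n| <= r) -> 0 <= C ->
  4 * C * r ^+ 2 <= 1 -> lower V C -> lower V' (4 * C).
Proof.
move=> VV' C0 Cr lV u [z uz] y Hy; have [N uN appN] := sum_le_total uz.
have V'V n : `|V' n - V n| <= r by rewrite distrC.
have h := lV u (ex_intro _ N uN) _ (Hop_perturb V'V uN Hy).
apply: (sum_le_mono (fun n => lexx _) _ uN).
have N0 := sum_le_ge0 uN.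
have : N <= C * (2 * y + 2 * (r ^+ 2 * N)).
  apply/ler_addgt0Pr => e /appN[s us]; rewrite ltrBlDr => /ltW/le_trans; apply.
  by rewrite lerD2r; exact: h.
have := ler_wpM2r N0 Cr; rewrite mul1r; lra.
Qed.

(** Were [|V| >= 3] everywhere, [V n * u n] would dominate the two neighbouring terms:
    [9 <= 3 * (1 / 2 + 1 + 1)] would follow. This later confines the spectrum to a bounded
    interval. *)
Lemma approx_kernel_bounded V : approx_kernel V -> exists n, `|V n| < 3.
Proof.
move=> ap; apply: contrapT => /forallNP nV.
have [u [u1 u1' Hu]] := ap (1 / 2) ltac:(lra).
have h : sum_le (sq u) (3 / 9 * (1 / 2 + 1 + 1)).
  have h0 : 0 <= 3 / 9 :> R by lra.
  have h := sum_leZ h0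
    (sum_leD (sum_leD Hu (sum_le_shift 1 u1)) (sum_le_shift (-1) u1)).
  apply: (sum_le_mono _ (lexx _) h) => n.
  have h3 : 3 ^+ 2 * sq u n <= (V n * u n) ^+ 2.
    rewrite exprMn ler_wpM2r ?sqr_ge0// -[V n ^+ 2]real_normK ?num_real//.
    by rewrite ler_pXn2r// ?nnegrE// leNgt; apply/negP/nV.
  have e : V n * u n = Hop V u n + (- u (n + 1)) + (- u (n - 1)) by rewrite /Hop; ring.
  have := sqrD3 (Hop V u n) (- u (n + 1)) (- u (n - 1)); rewrite -e !sqrrN.
  rewrite /sq in h3 *; lra.
have := u1' _ h; lra.
Qed.

End approx_kernel.

(** * Transfer matrices *)

Section transfer_matrices.
Variable R : realType.
Implicit Types (V u w : int -> R) (A B : 'M[R]_2).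

Local Notation i0 := (@ord0 1).
Local Notation i1 := (@Ordinal 2 1 isT).

Definition Smat (a : R) : 'M[R]_2 :=
  \matrix_(j < 2, k < 2) (nth [::] [:: [:: a; -1]; [:: 1; 0]] j)`_k.

(** Takes [(u i, u (i - 1))] to [(u (i + n), u (i + n - 1))] when [Hop (fun k => - w k) u = 0];
    hence the sign in the arguments [- V k] below. *)
Fixpoint tm w (i : int) n : 'M[R]_2 :=
  if n is m.+1 then Smat (w (i + m%:Z)) *m tm w i m else 1%:M.

Lemma ord2P (k : 'I_2) : k = i0 \/ k = i1.
Proof. by case: k => -[|[|//]] h; [left|right]; apply: val_inj. Qed.

Lemma mulmx2E A B j k : (A *m B) j k = A j i0 * B i0 k + A j i1 * B i1 k.
Proof.
rewrite mxE !big_ord_recl big_ord0 addr0; congr (_ + A j _ * B _ k); exact: val_inj.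
Qed.

Lemma trace2E A : \tr A = A i0 i0 + A i1 i1.
Proof.
rewrite /mxtrace !big_ord_recl big_ord0 addr0; congr (_ + A _ _); exact: val_inj.
Qed.

Lemma mx2P A B : A i0 i0 = B i0 i0 -> A i0 i1 = B i0 i1 ->
  A i1 i0 = B i1 i0 -> A i1 i1 = B i1 i1 -> A = B.
Proof. by move=> *; apply/matrixP => j k; have [->|->] := ord2P j; have [->|->] := ord2P k. Qed.

Lemma det2E A : \det A = A i0 i0 * A i1 i1 - A i0 i1 * A i1 i0.
Proof.
rewrite (expand_det_row _ i0) !big_ord_recl big_ord0 addr0 /cofactor !det_mx11 !mxE /=.
have -> : lift i0 (@ord0 0) = i1 by exact: val_inj.
have -> : lift i1 (@ord0 0) = i0 by exact: val_inj.
by rewrite expr0 expr1; ring.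
Qed.

Lemma Smat_mul a A : [/\ (Smat a *m A) i0 i0 = a * A i0 i0 - A i1 i0,
  (Smat a *m A) i0 i1 = a * A i0 i1 - A i1 i1,
  (Smat a *m A) i1 i0 = A i0 i0 & (Smat a *m A) i1 i1 = A i0 i1].
Proof. by split; rewrite mulmx2E !mxE/=; ring. Qed.

Lemma det_Smat a : \det (Smat a) = 1.
Proof. by rewrite det2E !mxE /=; ring. Qed.

Lemma det_tm w i n : \det (tm w i n) = 1.
Proof. by elim: n => [|n IH] /=; rewrite ?det1// det_mulmx IH det_Smat mulr1. Qed.

Lemma tm_add w i m n : tm w i (m + n) = tm w (i + m%:Z) n *m tm w i m.
Proof.
elim: n => [|n IH]; first by rewrite addn0 mul1mx.
by rewrite addnS /= IH mulmxA PoszD addrA.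
Qed.

Lemma tm_eq w w' i i' n :
  (forall k, (k < n)%N -> w (i + k%:Z) = w' (i' + k%:Z)) -> tm w i n = tm w' i' n.
Proof.
elim: n => [//|n IH] h /=; rewrite h// IH// => k kn; apply: h; exact: ltnW.
Qed.

Lemma tm_period w i n m : (forall k, w (k + n%:Z) = w k) ->
  tm w i (m * n) = iter m (mulmx (tm w i n)) 1%:M.
Proof.
move=> per; have perm : forall m k, w (k + (m * n)%:Z) = w k.
  elim=> [|m' IH] k; first by rewrite mul0n addr0.
  by rewrite mulSn PoszD addrA IH per.
elim: m => [|m IH]; first by rewrite mul0n.
rewrite mulSn addnC tm_add IH /=; congr (_ *m _).
by apply: tm_eq => k _; rewrite -addrA [_%:Z + k%:Z]addrC addrA perm.
Qed.

(** Moving the starting site conjugates the monodromy matrix by [Smat (w i)]. *)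
Lemma trace_tm_shift w i n : (forall k, w (k + n%:Z) = w k) ->
  \tr (tm w (i + 1) n) = \tr (tm w i n).
Proof.
move=> per; have h : tm w (i + 1) n *m Smat (w i) = Smat (w i) *m tm w i n.
  have := tm_add w i 1 n; have := tm_add w i n 1; rewrite add1n addn1 => -> /=.
  by rewrite !mulmx1 !addr0 per => ->.
have -> : tm w (i + 1) n = Smat (w i) *m tm w i n *m invmx (Smat (w i)).
  rewrite -h -mulmxA mulmxV ?mulmx1// unitmxE det_Smat unitr1.
  by [].
rewrite mxtrace_mulC mulmxA mulVmx ?mul1mx// unitmxE det_Smat unitr1.
by [].
Qed.

Lemma trace_tm w i j n : (forall k, w (k + n%:Z) = w k) ->
  \tr (tm w i n) = \tr (tm w j n).
Proof.
move=> per; have up (k : nat) (l : int) : \tr (tm w (l + k%:Z) n) = \tr (tm w l n).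
  elim: k => [|k IH]; first by rewrite addr0.
  by rewrite -IH -(trace_tm_shift (l + k%:Z) per); congr (\tr (tm w _ n)); lia.
have [ij|ji] := leP i j.
  by rewrite -(up (absz (j - i)) i); congr (\tr (tm w _ n)); lia.
by rewrite -(up (absz (i - j)) j); congr (\tr (tm w _ n)); lia.
Qed.

Lemma tm_bound w K i n : (forall k, (k < n)%N -> `|w (i + k%:Z)| <= K) ->
  0 <= K -> forall j k, `|tm w i n j k| <= (K + 2) ^+ n.
Proof.
move=> + K0; elim: n => [|n IH] wK j k.
  by rewrite mxE expr0; case: (j == k); rewrite ?normr1 ?normr0.
have {}IH := IH (fun k kn => wK k (ltnW kn)).
have K2 : 0 <= (K + 2) ^+ n by rewrite exprn_ge0// addr_ge0.
have step x y : `|x| <= (K + 2) ^+ n -> `|y| <= (K + 2) ^+ n ->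
    `|w (i + n%:Z) * x - y| <= (K + 2) ^+ n.+1.
  move=> xb yb; apply: le_trans (ler_normB _ _) _; rewrite normrM exprS.
  have := ler_pM (normr_ge0 _) (normr_ge0 _) (wK n (ltnSn n)) xb; nra.
have step' x : `|x| <= (K + 2) ^+ n -> `|x| <= (K + 2) ^+ n.+1.
  by move=> h; apply: le_trans h _; rewrite exprS; nra.
rewrite /=; set A := tm w i n in IH *; set a := w _ in step *.
have [e1 e2 e3 e4] := Smat_mul a A.
by have [->|->] := ord2P j; have [->|->] := ord2P k; rewrite ?e1 ?e2 ?e3 ?e4;
  (apply: step || apply: step').
Qed.

End transfer_matrices.

(** * Periodic potentials: recurrences and decay *)

Section three_term.
Variable R : realType.
Implicit Types (V u w : int -> R).

Local Notation i0 := (@ord0 1).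
Local Notation i1 := (@Ordinal 2 1 isT).

Lemma sqr_sum_le n (a : nat -> R) :
  (\sum_(k < n) a k) ^+ 2 <= n%:R * \sum_(k < n) a k ^+ 2.
Proof.
elim: n => [|n IH]; first by rewrite !big_ord0 expr0n mul0r.
rewrite !big_ord_recr /=; case: n => [|n] in IH *.
  by rewrite !big_ord0 !add0r mul1r.
set S := \sum_(k < n.+1) a k in IH *; set Q := \sum_(k < n.+1) a k ^+ 2 in IH *.
have N0 : 0 < n.+1%:R :> R by rewrite ltr0n.
have := @sqrD_weighted _ n.+1%:R^-1 S (a n.+1); rewrite invr_gt0 => /(_ N0).
move=> /le_trans; apply; rewrite invrK.
have -> : n.+2%:R * (Q + a n.+1 ^+ 2) =
   (1 + n.+1%:R^-1) * (n.+1%:R * Q) + (1 + n.+1%:R) * a n.+1 ^+ 2.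
  rewrite -[n.+2]add1n natrD; have := lt0r_neq0 N0; move: (n.+1%:R) => N N1.
  by field.
by rewrite lerD2r ler_wpM2l// addr_ge0// invr_ge0 ltW.
Qed.

(** Variation of constants: each source term [Hop V u (i + k)] is carried to the end by fewer than
    [n] one-step matrices, whence the factor [(K + 2) ^+ n]. *)
Lemma tm_inhom V u K i n : 0 <= K -> (forall k, `|V k| <= K) ->
  let A := tm (fun k => - V k) i n in
  let S := (K + 2) ^+ n * \sum_(k < n) `|Hop V u (i + k%:Z)| in
  `|u (i + n%:Z) - (A i0 i0 * u i + A i0 i1 * u (i - 1))| <= S /\
  `|u (i + n%:Z - 1) - (A i1 i0 * u i + A i1 i1 * u (i - 1))| <= S.
Proof.
move=> K0 VK; elim: n => [|n [IH1 IH2]].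
  by rewrite /= big_ord0 mulr0 !mxE/= addr0 !mul1r !mul0r addr0 add0r !subrr normr0.
cbv zeta; set A := tm _ i n in IH1 IH2.
have [e1 e2 e3 e4] := Smat_mul (- V (i + n%:Z)) A.
rewrite /= -/A e1 e2 e3 e4 big_ord_recr /=.
set T := \sum_(k < n) _ in IH1 IH2 *; set g := Hop V u (i + n%:Z).
have T0 : 0 <= T by apply: sumr_ge0.
have K2 : 1 <= (K + 2) ^+ n by apply: exprn_ege1; lra.
have -> : i + n.+1%:Z - 1 = i + n%:Z by lia.
have gE : u (i + n.+1%:Z) = - V (i + n%:Z) * u (i + n%:Z) - u (i + n%:Z - 1) + g.
  by rewrite /g /Hop (_ : i + n%:Z + 1 = i + n.+1%:Z); [ring|lia].
set P := (K + 2) ^+ n in IH1 IH2 K2 *.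
have g0 := normr_ge0 g.
have PT0 : 0 <= P * T by rewrite mulr_ge0// (le_trans _ K2).
have Pg : `|g| <= P * `|g| by rewrite ler_peMl.
rewrite exprS -/P; split; last by nra.
rewrite gE; set x := u (i + n%:Z) in IH1 *; set y := u (i + n%:Z - 1) in IH2 *.
set x' := A i0 i0 * _ + _ in IH1; set y' := A i1 i0 * _ + _ in IH2.
rewrite (_ : _ - _ = - V (i + n%:Z) * (x - x') - (y - y') + g); last first.
  by rewrite /x' /y'; ring.
have h1 : `|- V (i + n%:Z) * (x - x')| <= K * (P * T).
  by rewrite normrM normrN ler_pM.
apply: le_trans (ler_normD _ _) _.
have := ler_normB (- V (i + n%:Z) * (x - x')) (y - y'); nra.
Qed.

(** With [P := (K + 2) ^+ n] this is [(2 * P ^+ 2) ^+ 2 * (2 * n)]: the error is [2 * P ^+ 2] times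
    a sum over [2 * n] sites, squared by Cauchy-Schwarz. *)
Definition three_term_const K n : R := 8 * n%:R * (K + 2) ^+ n ^+ 4.

Lemma three_term_const_ge0 K n : 0 <= K -> 0 <= three_term_const K n.
Proof.
move=> K0; apply: mulr_ge0; first exact: mulr_ge0.
by apply/exprn_ge0/exprn_ge0; lra.
Qed.

Lemma int_shift (i : int) (n k : nat) : i + k%:Z = i - n%:Z + (n + k)%N%:Z.
Proof. by lia. Qed.

(* Cayley-Hamilton for [A] in SL2: [A + A^-1 = tr A]. *)
Lemma three_term V u K i n : 0 <= K -> (forall k, `|V k| <= K) ->
  (forall k, (k < n)%N -> V (i - n%:Z + k%:Z) = V (i + k%:Z)) ->
  (u (i + n%:Z) + u (i - n%:Z) - \tr (tm (fun k => - V k) i n) * u i) ^+ 2 <=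
  three_term_const K n * \sum_(k < n + n) sq (Hop V u) (i - n%:Z + k%:Z).
Proof.
move=> K0 VK per.
have [h1 h2] := tm_inhom u (i - n%:Z) n K0 VK.
have [h3 _] := tm_inhom u i n K0 VK.
have AA : tm (fun k => - V k) (i - n%:Z) n = tm (fun k => - V k) i n.
  by apply: tm_eq => k kn; rewrite per.
rewrite AA subrK in h1 h2; have dA := det_tm (fun k => - V k) i n.
have ab := @tm_bound _ (fun k => - V k) K i n.
have {}ab j k : `|tm (fun k => - V k) i n j k| <= (K + 2) ^+ n.
  by apply: ab => // l _; rewrite normrN.
rewrite trace2E; move: (tm _ i n) => A in h1 h2 h3 dA ab *; rewrite det2E in dA.
set P := (K + 2) ^+ n in h1 h2 h3 ab *.
have P1 : 1 <= P by apply: exprn_ege1; lra.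
set S' := \sum_(k < n) _ in h1 h2; set S := \sum_(k < n) _ in h3.
set a := A i0 i0 in h1 h2 h3 dA ab *; set b := A i0 i1 in h1 h2 h3 dA ab *.
set c := A i1 i0 in h1 h2 h3 dA ab *; set d := A i1 i1 in h1 h2 h3 dA ab *.
set f1 := u i - _ in h1; set f2 := u (i - 1) - _ in h2; set f3 := u _ - _ in h3.
(* The first row of [A^-1] is [(d, - b)], so [u (i - n) = d * u i - b * u (i - 1)] up to
   [- d * f1 + b * f2]; the terms in [u (i - 1)] cancel against those of [u (i + n)]. *)
have -> : u (i + n%:Z) + u (i - n%:Z) - (a + d) * u i = f3 - d * f1 + b * f2.
  have -> : u (i - n%:Z) = (a * d - b * c) * u (i - n%:Z) by rewrite dA mul1r.
  by rewrite /f1 /f2 /f3; ring.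
have S0 : 0 <= S by apply: sumr_ge0.
have P0 : 0 <= P by apply: le_trans P1.
have P2 : P <= P ^+ 2 by rewrite expr2 ler_peMl.
have e : `|f3 - d * f1 + b * f2| <= 2 * P ^+ 2 * (S' + S).
  have hd : `|d * f1| <= P * (P * S') by rewrite normrM ler_pM// ab.
  have hb : `|b * f2| <= P * (P * S') by rewrite normrM ler_pM// ab.
  apply: le_trans (ler_normD _ _) _.
  have h4 := ler_normB f3 (d * f1).
  have h5 : P * S <= P ^+ 2 * S by rewrite ler_wpM2r.
  nra.
apply: le_trans (sq_abs_le e) _.
have SS : S' + S = \sum_(k < n + n) `|Hop V u (i - n%:Z + k%:Z)|.
  rewrite big_split_ord /=; congr (_ + _); apply: eq_bigr => k _.
  by rewrite (int_shift i n k).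
have := sqr_sum_le (n + n) (fun k => `|Hop V u (i - n%:Z + k%:Z)|).
rewrite -SS; under eq_bigr do rewrite real_normK ?num_real//.
rewrite /three_term_const -/P; set Q := (\sum_(k < n + n) _); rewrite natrD => h.
have -> : 8 * n%:R * P ^+ 4 * Q = (2 * P ^+ 2) ^+ 2 * ((n%:R + n%:R) * Q) by ring.
by rewrite [leLHS]exprMn ler_wpM2l ?sqr_ge0.
Qed.

(** For a fixed offset [k] the sites [i + h c - n + k] are distinct, so each of the [n + n] offsets
    costs at most [y]. *)
Lemma sum_le_three_term V u K i n (h : int -> int) y : injective h -> 0 <= K ->
  (forall k, `|V k| <= K) ->
  (forall c k, (k < n)%N -> V (i + h c - n%:Z + k%:Z) = V (i + h c + k%:Z)) ->
  sum_le (sq (Hop V u)) y ->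
  sum_le (fun c => (u (i + h c + n%:Z) + u (i + h c - n%:Z)
      - \tr (tm (fun k => - V k) (i + h c) n) * u (i + h c)) ^+ 2)
    (three_term_const K n * ((n + n)%:R * y)).
Proof.
move=> hi K0 VK per gy.
have h0 : sum_le (fun c => \sum_(k < n + n) sq (Hop V u) (i + h c - n%:Z + k%:Z))
    (\sum_(k < n + n) y).
  apply: (sum_le_sum (f := fun k c => sq (Hop V u) (i + h c - n%:Z + k%:Z))
    (y := fun=> y)) => k kn s us.
  apply: (sum_le_inj (h := fun c => i + h c - n%:Z + k%:Z)) us => //.
  by move=> c c' /addIr/addIr/addrI /hi.
rewrite sumr_const card_ord -mulr_natl in h0.
apply: (sum_le_mono _ (lexx _) (sum_leZ _ h0)).
  by move=> c; apply: three_term => // k kn; exact: per.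
exact: three_term_const_ge0.
Qed.

End three_term.

Section powers.
Variable R : realType.
Implicit Types (A : 'M[R]_2) (tau : R).

Local Notation i0 := (@ord0 1).
Local Notation i1 := (@Ordinal 2 1 isT).

Definition mxpow A n := iter n (mulmx A) 1%:M.

(* Chebyshev polynomials of the second kind: [cheb (2 cos th) n = sin (n th) / sin th]. *)
Fixpoint cheb tau n : R :=
  match n with
  | 0 => 0
  | m.+1 => match m with 0 => 1 | l.+1 => tau * cheb tau m - cheb tau l end
  end.

Lemma chebS tau n : cheb tau n.+2 = tau * cheb tau n.+1 - cheb tau n.
Proof. by []. Qed.

Lemma mxpow_cheb A n : \det A = 1 ->
  mxpow A n.+1 = cheb (\tr A) n.+1 *: A - (cheb (\tr A) n)%:M.
Proof.
move=> dA; elim: n => [|n IH].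
  by rewrite /mxpow /= mulmx1 scale1r raddf0 subr0.
rewrite /mxpow iterS -/(mxpow A n.+1) IH chebS mulmxBr -scalemxAr mul_mx_scalar.
have -> : A *m A = \tr A *: A - 1%:M.
  rewrite det2E in dA; rewrite trace2E -dA.
  by apply: mx2P; rewrite mulmx2E !mxE/= ?mulr1n ?mulr0n; ring.
apply/matrixP => j k; rewrite !mxE.
by case: (j == k); rewrite ?mulr1n ?mulr0n; ring.
Qed.

Lemma cheb_invariant tau n :
  cheb tau n.+1 ^+ 2 - tau * cheb tau n.+1 * cheb tau n + cheb tau n ^+ 2 = 1.
Proof.
elim: n => [|n IH]; first by rewrite /=; ring.
by rewrite chebS -IH; ring.
Qed.

(** Completing the square in [cheb_invariant] gives [(x - tau / 2 * y) ^+ 2 = 1 + (tau ^+ 2 / 4 - 1)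
    * y ^+ 2] for consecutive values, with a coefficient at most [b ^+ 2 / 4]. The elliptic,
    parabolic and slightly hyperbolic cases are thus treated together. *)
Lemma cheb_bound tau b n : 0 < b -> b <= 1 -> `|tau| <= 2 + b ^+ 2 / 8 ->
  `|cheb tau n| <= n%:R * (1 + b) ^+ n.
Proof.
move=> b0 b1 tb.
have step m : `|cheb tau m.+1| <= (1 + b) * `|cheb tau m| + 1.
  have := cheb_invariant tau m; set x := cheb tau m.+1; set y := cheb tau m => e.
  have y0 := normr_ge0 y; have t0 := normr_ge0 tau.
  have bb : b ^+ 2 <= b by rewrite expr2 ler_piMl// ltW.
  have t2 : tau ^+ 2 / 4 <= 1 + b ^+ 2 / 4.
    have : tau ^+ 2 <= (2 + b ^+ 2 / 8) ^+ 2 by exact: sq_abs_le.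
    have := sqr_ge0 b; set b2 := b ^+ 2 in bb *; nra.
  have h : `|x - tau / 2 * y| <= 1 + b / 2 * `|y|.
    rewrite -(@ler_pXn2r _ 2)// ?nnegrE//; last by nra.
    rewrite real_normK ?num_real//.
    have -> : (x - tau / 2 * y) ^+ 2 = 1 + (tau ^+ 2 / 4 - 1) * y ^+ 2.
      transitivity (x ^+ 2 - tau * x * y + y ^+ 2 + (tau ^+ 2 / 4 - 1) * y ^+ 2).
        by field.
      by rewrite e.
    have y2 : `|y| ^+ 2 = y ^+ 2 by rewrite real_normK ?num_real.
    have -> : (1 + b / 2 * `|y|) ^+ 2 = 1 + b * `|y| + b ^+ 2 / 4 * y ^+ 2.
      by rewrite -y2; field.
    have : (tau ^+ 2 / 4 - 1) * y ^+ 2 <= b ^+ 2 / 4 * y ^+ 2.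
      by rewrite ler_wpM2r ?sqr_ge0//; lra.
    by have := mulr_ge0 (ltW b0) y0; lra.
  have h2 : `|tau / 2 * y| <= (1 + b / 2) * `|y|.
    rewrite normrM ler_wpM2r// normrM (ger0_norm (_ : 0 <= 2^-1)) ?invr_ge0//.
    lra.
  have := ler_normD (x - tau / 2 * y) (tau / 2 * y); rewrite subrK; lra.
elim: n => [|n IH]; first by rewrite /= normr0 mul0r.
apply: le_trans (step n) _.
have b1' : 1 <= 1 + b by lra.
have P1 : 1 <= (1 + b) ^+ n.+1 by exact: exprn_ege1.
have -> : n.+1%:R * (1 + b) ^+ n.+1 = (1 + b) * (n%:R * (1 + b) ^+ n) + (1 + b) ^+ n.+1.
  by rewrite -natr1 exprS; ring.
by apply: lerD => //; rewrite ler_wpM2l//; lra.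
Qed.

Lemma mxpow_bound A M b n : \det A = 1 -> (forall j k, `|A j k| <= M) ->
  0 < b -> b <= 1 -> `|\tr A| <= 2 + b ^+ 2 / 8 ->
  forall j k, `|mxpow A n j k| <= (M + 1) * (n.+1%:R * (1 + b) ^+ n).
Proof.
move=> dA AM b0 b1 tb j k.
have M0 : 0 <= M by apply: le_trans (AM i0 i0).
case: n => [|n].
  rewrite mxE expr0 !mulr1; case: (j == k); rewrite ?normr1 ?normr0; lra.
rewrite mxpow_cheb// !mxE.
have h1 := cheb_bound n.+1 b0 b1 tb; have h2 := cheb_bound n b0 b1 tb.
apply: le_trans (ler_normB _ _) _; rewrite normrM.
have P1 : 0 <= (1 + b) ^+ n by apply: exprn_ge0; lra.
have h3 : (1 + b) ^+ n <= (1 + b) ^+ n.+1 by rewrite exprS; nra.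
have N0 : 0 <= n%:R :> R by [].
set P := (1 + b) ^+ n in h2 h3 P1; set Q := (1 + b) ^+ n.+1 in h1 h3 *.
have h4 : `|cheb (\tr A) n *+ (j == k)| <= n.+2%:R * Q.
  have : `|cheb (\tr A) n *+ (j == k)| <= `|cheb (\tr A) n|.
    by case: (j == k); rewrite ?mulr1n ?mulr0n// normr0.
  move=> /le_trans; apply; apply: le_trans h2 _.
  by rewrite ler_pM// ler_nat; lia.
have h5 : `|cheb (\tr A) n.+1| * `|A j k| <= n.+2%:R * Q * M.
  apply: ler_pM => //; apply: le_trans h1 _; rewrite ler_wpM2r ?(le_trans P1)//.
  by rewrite ler_nat.
lra.
Qed.

End powers.

Section recurrence.
Variable R : realType.
Implicit Types (V u w : int -> R).

Lemma sum_le_recurrence (T : choiceType) (x a b : T -> R) (t d ya yb ye : R) :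
  0 < d -> sum_le (fun c => a c ^+ 2) ya -> sum_le (fun c => b c ^+ 2) yb ->
  sum_le (fun c => (a c + b c - t * x c) ^+ 2) ye ->
  sum_le (fun c => t ^+ 2 * x c ^+ 2) (2 * (1 + d) * (ya + yb) + (1 + d^-1) * ye).
Proof.
move=> d0 ha hb he.
have c1 : 0 <= 2 * (1 + d) by lra.
have c2 : 0 <= 1 + d^-1 by rewrite addr_ge0// invr_ge0 ltW.
apply: (sum_le_mono _ (lexx _) (sum_leD (sum_leZ c1 (sum_leD ha hb)) (sum_leZ c2 he))).
move=> c; rewrite -exprMn.
have := sqrD_weighted (a c + b c) (- (a c + b c - t * x c)) d0; rewrite sqrrN.
rewrite (_ : a c + b c + _ = t * x c); last by ring.
move=> /le_trans; apply; rewrite lerD2r.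
have := sqrD2 (a c) (b c) => h.
rewrite [2 * _]mulrC -mulrA ler_wpM2l//; lra.
Qed.

(** By [trace_tm] the trace is the same at every site, so [t * u] is, up to the error, the sum of
    two shifts of [u], each of norm 1. *)
Lemma approx_trace V K q u z d : 0 <= K -> (forall k, `|V k| <= K) ->
  (forall k, V (k + q%:Z) = V k) -> 0 < d ->
  sum_le (sq u) 1 -> (forall y, sum_le (sq u) y -> 1 <= y) ->
  sum_le (sq (Hop V u)) z ->
  \tr (tm (fun k => - V k) 0 q) ^+ 2 <=
    4 * (1 + d) + (1 + d^-1) * (three_term_const K q * ((q + q)%:R * z)).
Proof.
move=> K0 VK per d0 u1 umin Hz; set t := \tr _.
set B := (X in _ <= X).
have h : sum_le (fun c => t ^+ 2 * u c ^+ 2) B.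
  have e := @sum_le_three_term _ V u K 0 q id z (@inj_id _) K0 VK _ Hz.
  have r := sum_le_recurrence d0 (sum_le_shift q%:Z u1) (sum_le_shift (- q%:Z) u1)
    (x := u) (t := t) (ye := three_term_const K q * ((q + q)%:R * z)) _.
  apply: (sum_le_mono (fun n => lexx _) _ (r _)) => [|s us]; first by rewrite /B; lra.
  apply: le_trans (e _ s us) => [|c k kq]; last by rewrite -[LHS]per; congr V; lia.
  rewrite le_eqVlt; apply/orP; left; apply/eqP; apply: eq_bigr => c _.
  by rewrite add0r (_ : \tr _ = t)//; apply: trace_tm => k; rewrite per.
have t2 := sqr_ge0 t; have B0 := sum_le_ge0 h.
move: t2; rewrite le_eqVlt => /predU1P[<-//|t2].
have ti : 0 <= (t ^+ 2)^-1 by rewrite invr_ge0 ltW.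
have := umin _ (sum_le_mono (fun n => _) (lexx _) (sum_leZ ti h)).
rewrite ler_pdivlMl// mulr1; apply => n.
by rewrite mulrA mulVf ?gt_eqF// mul1r.
Qed.

Lemma absz_block (z : int) (n k Z : nat) : (absz z <= Z)%N -> (k < n)%N ->
  (absz (z * n%:Z + k%:Z)%R <= Z.+1 * n)%N /\ (absz (z * n%:Z - n%:Z + k%:Z)%R <= Z.+1 * n)%N.
Proof. by case: z => z zZ kn; split; nia. Qed.

Lemma absz_step (z : int) (j Z : nat) : (absz z + j.+1 <= Z.+1)%N ->
  [/\ (absz z <= Z)%N, (absz (z + 1)%R + j <= Z.+1)%N & (absz (z - 1)%R + j <= Z.+1)%N].
Proof. by move=> zj; split; lia. Qed.

(* With [a_z c := u (i0 + c q + z n)], the three-term relation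
   [a_(z+1) + a_(z-1) = t a_z + error] in the direction [z] inside a block gives
   [t^2 ||a_z||^2 <= 4 (1 + d) max ||a_(z +- 1)||^2 + error]: moving from the ends
   of a block to its centre gains a factor [r] at each step. *)
Lemma block_decay V W K q n Z (i0 : int) u y d r D : 0 <= K ->
  (forall k, `|V k| <= K) -> (0 < q)%N -> (0 < n)%N ->
  (forall k, W (k + n%:Z) = W k) ->
  (forall c k : int, (absz k <= Z.+1 * n)%N -> V (i0 + c * q%:Z + k) = W k) ->
  let t := \tr (tm (fun k => - W k) 0 n) in
  0 < d -> 0 <= r -> 1 <= t ^+ 2 -> 4 * (1 + d) <= r * t ^+ 2 ->
  sum_le (sq u) 1 -> sum_le (sq (Hop V u)) y -> 0 <= D ->
  (1 + d^-1) * (three_term_const K n * ((n + n)%:R * y)) <= (1 - r) * D ->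
  sum_le (fun c : int => u (i0 + c * q%:Z) ^+ 2) (r ^+ Z.+1 + D).
Proof.
move=> K0 VK q0 n0 perW VW t d0 r0 t1 tr u1 Hy D0 yD.
have tE : \tr (tm (fun k => - W k) 0 n) = t by [].
move: t tE t1 tr => t tE t1 tr.
have qi : injective (fun c : int => c * q%:Z).
  by apply: mulIf; rewrite eqz_nat -lt0n.
have t0 : 0 < t ^+ 2 by apply: lt_le_trans t1.
pose C := three_term_const K n * ((n + n)%:R * y).
have base (z : int) : sum_le (fun c => u (i0 + z * n%:Z + c * q%:Z) ^+ 2) 1.
  by move=> s us; apply: (sum_le_inj (h := fun c => i0 + z * n%:Z + c * q%:Z) _ u1) => // a b /addrI/qi.
(* [z] counts periods from the centre. Gaining [j] times requires room for [j] more periods on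
   either side; the base case is the trivial bound 1. *)
have claim (j : nat) : forall z : int, (absz z + j <= Z.+1)%N ->
    sum_le (fun c => u (i0 + z * n%:Z + c * q%:Z) ^+ 2) (r ^+ j + D).
  elim: j => [|j IH] z zj.
    by apply: (sum_le_mono _ _ (base z)) => //; rewrite expr0 lerDl.
  have [zZ zp zm] := absz_step zj.
  have e := @sum_le_three_term _ V u K (i0 + z * n%:Z) n _ y qi K0 VK _ Hy.
  have shift (c k : int) : i0 + z * n%:Z + c * q%:Z + k = i0 + c * q%:Z + (z * n%:Z + k).
    by ring.
  have hp := IH _ zp; have hm := IH _ zm.
  have := sum_le_recurrence d0 hp hm
    (x := fun c => u (i0 + z * n%:Z + c * q%:Z)) (t := t) (ye := C) _.
  have ti : 0 <= (t ^+ 2)^-1 by rewrite invr_ge0 ltW.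
  move=> h; have {}h := sum_leZ ti (h _).
  apply: (sum_le_mono _ _ (h _)) => [c||s us].
  - by rewrite mulrA mulVf ?gt_eqF// mul1r.
  - have rj : 0 <= r ^+ j by apply: exprn_ge0.
    have h1 : 4 * (1 + d) * (r ^+ j + D) <= r * t ^+ 2 * (r ^+ j + D).
      by rewrite ler_wpM2r// addr_ge0.
    (* [D] is a fixed point: [r * (r ^+ j + D) + (1 - r) * D = r ^+ j.+1 + D]. Dividing the error by
       [t ^+ 2 >= 1] does no harm. *)
    have h2 : (1 - r) * D <= t ^+ 2 * ((1 - r) * D).
      rewrite ler_peMl//; apply: le_trans yD; apply: mulr_ge0.
        by rewrite addr_ge0// invr_ge0 ltW.
      apply: mulr_ge0; first exact: three_term_const_ge0.
      by apply: mulr_ge0 => //; exact: sum_le_ge0 Hy.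
    rewrite ler_pdivrMl// [r ^+ _.+1]exprS; apply: (@le_trans _ _ (4 * (1 + d) * (r ^+ j + D) + (1 - r) * D)).
      by apply: lerD => //; rewrite le_eqVlt; apply/orP; left; apply/eqP; ring.
    apply: le_trans (lerD h1 h2) _.
    by rewrite le_eqVlt; apply/orP; left; apply/eqP; ring.
  - apply: le_trans (e _ s us) => [|c k kn].
      rewrite le_eqVlt; apply/orP; left; apply/eqP; apply: eq_bigr => c _.
      have -> : \tr (tm (fun k => - V k) (i0 + z * n%:Z + c * q%:Z) n) = t.
        rewrite (@tm_eq _ _ (fun k => - W k) _ (z * n%:Z)) => [|k kn].
          by rewrite -tE; apply: trace_tm => k; rewrite perW.
        by rewrite shift VW//; have [] := absz_block zZ kn.
      congr ((u _ + u _ - _) ^+ 2); ring.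
    have [h1 h2] := absz_block zZ kn.
    transitivity (W (z * n%:Z + k%:Z)); last by rewrite (shift c k%:Z) VW.
    rewrite (_ : _ - n%:Z + k%:Z = i0 + c * q%:Z + (z * n%:Z - n%:Z + k%:Z)); last by ring.
    by rewrite VW// -[LHS]perW; congr W; ring.
by apply: (sum_le_mono _ (lexx _) (claim Z.+1 0 _)) => // c; rewrite mul0r addr0.
Qed.

End recurrence.

(** * Cutting at periodically placed sites *)

Section spectral_gap.
Variable R : realType.
Local Notation C := R[i].
Local Open Scope sesquilinear_scope.

Definition rowsq d (z : 'rV[C]_d) : R :=
  \sum_i (complex.Re (z ord0 i) ^+ 2 + complex.Im (z ord0 i) ^+ 2).

Lemma mulJE (z : C) : z * z^* = (complex.Re z ^+ 2 + complex.Im z ^+ 2)%:C%C.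
Proof. by rewrite -normCK normc_def -rmorphXn sqr_sqrtr ?addr_ge0 ?sqr_ge0. Qed.

Lemma rowsqE d (z : 'rV[C]_d) : (z *m z^t*) ord0 ord0 = (rowsq z)%:C%C.
Proof.
by rewrite mxE /rowsq rmorph_sum; apply: eq_bigr => i _; rewrite !mxE mulJE.
Qed.

Lemma rowsq_unitary d (z : 'rV[C]_d) (P : 'M[C]_d) : P \is unitarymx ->
  rowsq (z *m P) = rowsq z.
Proof.
move=> /unitarymxP PP; apply: (@complexI R); rewrite -!rowsqE trmx_mul map_mxM.
by rewrite !mulmxA -(mulmxA z) PP mulmx1.
Qed.

(** A unitary diagonalises [D] over the complex numbers. The list holds the real parts of the
    eigenvalues; since [|lam - E| >= |Re lam - E|], a distance to it bounds the diagonal form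
    below. *)
Lemma symmetric_spectral_gap d (D : 'M[R]_d) : D^T = D ->
  exists2 s : seq R, size s = d & forall E eta (x : 'rV[R]_d), 0 <= eta ->
    (forall c, c \in s -> eta <= `|c - E|) ->
    eta ^+ 2 * \sum_i x ord0 i ^+ 2 <= \sum_i (x *m (D - E%:M)) ord0 i ^+ 2.
Proof.
move=> DT; pose A : 'M[C]_d := map_mx (real_complex R) D.
have Anormal : A \is normalmx.
  apply: symmetric_normalmx.
    apply/is_hermitianmxP; rewrite expr0 scale1r; apply/matrixP => i j.
    by rewrite !mxE /= -[in LHS]DT mxE.
  by apply/mxOverP => i j; rewrite mxE complex_real.
have /orthomx_spectralP := Anormal.
set P := spectralmx A; set sp := spectral_diag A => AE.
have Pu : P \is unitarymx by exact: spectral_unitarymx.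
exists [seq complex.Re (sp ord0 i) | i <- enum 'I_d].
  by rewrite size_map size_enum_ord.
move=> E eta x eta0 gap.
pose y := map_mx (real_complex R) x *m invmx P.
have rowsqR (z : 'rV[R]_d) : rowsq (map_mx (real_complex R) z) = \sum_i z ord0 i ^+ 2.
  by apply: eq_bigr => i _; rewrite !mxE /= expr0n addr0.
rewrite -!rowsqR.
have -> : rowsq (map_mx (real_complex R) x) = rowsq y.
  by rewrite -(rowsq_unitary y Pu) /y mulmxKV// unitarymx_unit.
have -> : map_mx (real_complex R) (x *m (D - E%:M)) = y *m (diag_mx sp - (E%:C%C)%:M) *m P.
  rewrite map_mxM map_mxB map_scalar_mx -/A.
  have -> : A - (E%:C%C)%:M = invmx P *m (diag_mx sp - (E%:C%C)%:M) *m P.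
    rewrite mulmxBr mulmxBl -AE mul_mx_scalar -scalemxAl mulVmx ?scalemx1//.
    exact: unitarymx_unit.
  by rewrite /y !mulmxA.
rewrite rowsq_unitary// /rowsq mulr_sumr ler_sum// => i _.
have -> : (y *m (diag_mx sp - (E%:C%C)%:M)) ord0 i = y ord0 i * (sp ord0 i - E%:C%C).
  by rewrite mulmxBr mul_mx_diag mul_mx_scalar !mxE mulrBr; congr (_ - _); rewrite mulrC.
have := gap (complex.Re (sp ord0 i)) (map_f _ (mem_enum _ i)).
case: (y ord0 i) (sp ord0 i) => [a b] [p q] /= h.
have h2 : eta ^+ 2 <= (p - E) ^+ 2.
  by rewrite -[(p - E) ^+ 2]real_normK ?num_real// ler_sqr// nnegrE.
have -> : (a * (p - E) - b * (q - 0)) ^+ 2 + (a * (q - 0) + b * (p - E)) ^+ 2 =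
  ((p - E) ^+ 2 + q ^+ 2) * (a ^+ 2 + b ^+ 2) by ring.
by rewrite ler_wpM2r ?addr_ge0 ?sqr_ge0// (le_trans h2)// lerDl sqr_ge0.
Qed.

End spectral_gap.

Section block_cover.

Lemma divz_block (i n : int) (d : nat) :
  exists2 a : nat, (a < d.+1)%N & n = i + a%:Z + ((n - i) %/ d.+1%:Z)%Z * d.+1%:Z.
Proof.
exists (absz ((n - i) %% d.+1%:Z)%Z).
  by have := ltz_pmod (n - i) (_ : 0 < d.+1%:Z); lia.
have := divz_eq (n - i) d.+1%:Z; have := modz_ge0 (n - i) (_ : d.+1%:Z != 0).
lia.
Qed.

Lemma block_inj (i : int) (d : nat) (c c' : int) (a a' : nat) :
  (a < d.+1)%N -> (a' < d.+1)%N ->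
  i + a%:Z + c * d.+1%:Z = i + a'%:Z + c' * d.+1%:Z -> c = c' /\ a = a'.
Proof.
move=> ad ad' e.
have e' : (c - c') * d.+1%:Z = a'%:Z - a%:Z by rewrite mulrBl; lia.
have cc : c = c' by nia.
by split=> //; move: e; rewrite cc; lia.
Qed.

Definition blocks (i : int) (d : nat) (cs : seq int) : seq int :=
  [seq i + a%:Z + c * d.+1%:Z | c <- cs, a <- iota 0 d.+1].

Lemma blocks_uniq i d cs : uniq cs -> uniq (blocks i d cs).
Proof.
move=> ucs; apply: allpairs_uniq => //; first exact: iota_uniq.
move=> [c a] [c' a'] /allpairsP[[x y] [_ h [-> ->]]] /allpairsP[[x' y'] [_ h' [-> ->]]].
by rewrite !mem_iota in h h'; move=> /(block_inj h h')[/= -> ->].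
Qed.

Lemma blocks_cover i d (L : seq int) : exists2 cs, uniq cs & {subset L <= blocks i d cs}.
Proof.
exists (undup [seq ((n - i) %/ d.+1%:Z)%Z | n <- L]); first exact: undup_uniq.
move=> n nL; have [a ad e] := divz_block i n d.
apply/allpairsP; exists (((n - i) %/ d.+1%:Z)%Z, a); split => //.
  by rewrite mem_undup; apply/mapP; exists n.
by rewrite mem_iota.
Qed.

End block_cover.

Section cut.
Variable R : realType.
Implicit Types (V u : int -> R) (E : R).

Definition cut_matrix V (i : int) d : 'M[R]_d :=
  \matrix_(a, b) ((a == b.+1 :> nat)%:R + (b == a.+1 :> nat)%:R
    + (a == b :> nat)%:R * V (i + a%:Z)).

Lemma cut_matrix_sym V i d : (cut_matrix V i d)^T = cut_matrix V i d.
Proof.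
apply/matrixP => a b; rewrite !mxE [X in X + _]addrC; congr (_ + _).
by rewrite eq_sym; case: eqP => [->|_]; rewrite ?mul0r.
Qed.

Lemma sum_pick d (F : nat -> R) k :
  \sum_(a < d) F a * (a == k :> nat)%:R = if (k < d)%N then F k else 0.
Proof.
case: ltnP => kd.
  rewrite (bigD1 (Ordinal kd))//= eqxx mulr1 big1 ?addr0// => a.
  by rewrite -val_eqE /= => /negPf ->; rewrite mulr0.
rewrite big1// => a _; case: eqP => [ak|]; last by rewrite mulr0.
by have := ltn_ord a; rewrite ak ltnNge kd.
Qed.

(* [i] is the first site after a cut, so that [u] vanishes at [i - 1]. *)
Lemma cut_matrixE V u i d E (c : int) (b : 'I_d) :
  (forall k, V (k + d.+1%:Z) = V k) ->
  (forall c : int, u (i + d%:Z + c * d.+1%:Z) = 0) ->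
  ((\row_(a < d) u (i + a%:Z + c * d.+1%:Z)) *m (cut_matrix V i d - E%:M)) ord0 b =
  Hop (fun n => V n - E) u (i + b%:Z + c * d.+1%:Z).
Proof.
move=> perV u0; pose f (k : nat) := u (i + k%:Z + c * d.+1%:Z).
have perV' (m : int) k : V (k + m * d.+1%:Z) = V k.
  have up (m' : nat) l : V (l + m'%:Z * d.+1%:Z) = V l.
    elim: m' l => [|m' IH] l; first by rewrite mul0r addr0.
    by rewrite -[RHS]IH -[RHS]perV; congr V; lia.
  case: m => m; first exact: up.
  rewrite -[LHS](up m.+1); congr V; lia.
rewrite mulmxBr mul_mx_scalar !mxE /Hop perV'.
have bd := ltn_ord b.
have -> : \sum_(a < d) (\row_(a < d) f a) ord0 a * cut_matrix V i d a b =
    (if (b.+1 < d)%N then f b.+1 else 0) +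
    (if (0 < b)%N then f b.-1 else 0) + f b * V (i + b%:Z).
  transitivity (\sum_(a < d) (f a * (a == b.+1 :> nat)%:R) +
      (if (0 < b)%N then f b.-1 else 0) +
      \sum_(a < d) (f a * V (i + a%:Z)) * (a == b :> nat)%:R).
    have -> : (if (0 < b)%N then f b.-1 else 0) =
        \sum_(a < d) (f a * (b == a.+1 :> nat)%:R).
      case: (nat_of_ord b) bd => [|b'] /= bd; first by rewrite big1// => a _; rewrite mulr0.
      under eq_bigr => a _ do rewrite eqSS eq_sym.
      by rewrite (sum_pick d f) (ltn_trans _ bd).
    rewrite -!big_split; apply: eq_bigr => a _; rewrite !mxE /=; ring.
  by rewrite (sum_pick d f) (sum_pick d (fun a => f a * V (i + a%:Z))) bd.
have -> : (if (b.+1 < d)%N then f b.+1 else 0) = u (i + b%:Z + c * d.+1%:Z + 1).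
  case: ltnP => h; first by congr u; lia.
  by rewrite -[LHS](u0 c); congr u; lia.
have -> : (if (0 < b)%N then f b.-1 else 0) = u (i + b%:Z + c * d.+1%:Z - 1).
  case: ltnP => h; first by congr u; lia.
  by rewrite -[LHS](u0 (c - 1)); congr u; lia.
rewrite /f; ring.
Qed.

(** By periodicity all blocks between cuts carry the same matrix, so one list of [d] eigenvalues
    serves for the whole line. At the cut sites [u] vanishes and the value of [Hop] is simply
    dropped. *)
Lemma cut_resolvent V i d : (forall k, V (k + d.+1%:Z) = V k) ->
  exists2 s : seq R, size s = d & forall E eta u y, 0 <= eta ->
    (forall c, c \in s -> eta <= `|c - E|) ->
    (forall c : int, u (i + d%:Z + c * d.+1%:Z) = 0) ->
    sum_le (sq (Hop (fun n => V n - E) u)) y ->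
    sum_le (fun n => eta ^+ 2 * sq u n) y.
Proof.
move=> perV; have [s sd gap] := symmetric_spectral_gap (cut_matrix_sym V i d).
exists s => // E eta u y eta0 sE u0 Hy L uL.
have [cs ucs Lcs] := blocks_cover i d L.
have h1 : \sum_(n <- L) eta ^+ 2 * sq u n <= \sum_(n <- blocks i d cs) eta ^+ 2 * sq u n.
  by apply: ler_sum_subset => // n; rewrite mulr_ge0 ?sqr_ge0.
apply: le_trans h1 _; apply: le_trans (Hy _ (blocks_uniq i d ucs)).
rewrite /blocks !big_allpairs_dep ler_sum// => c _.
have tosum (F : int -> R) : \sum_(a <- iota 0 d.+1) F (i + a%:Z + c * d.+1%:Z) =
    \sum_(a < d) F (i + a%:Z + c * d.+1%:Z) + F (i + d%:Z + c * d.+1%:Z).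
  rewrite -[iota 0 d.+1]/(index_iota 0 d.+1) big_mkord big_ord_recr /=.
  by [].
rewrite (tosum (fun n => eta ^+ 2 * sq u n)) (tosum (sq (Hop (fun n => V n - E) u))).
apply: lerD; last by rewrite /sq u0 expr0n /= mulr0 sqr_ge0.
have := gap E eta (\row_(a < d) u (i + a%:Z + c * d.+1%:Z)) eta0 sE.
rewrite mulr_sumr => /le_trans h; apply: le_trans; last apply: h.
  by rewrite le_eqVlt; apply/orP; left; apply/eqP; apply: eq_bigr => a _; rewrite mxE.
rewrite le_eqVlt; apply/orP; left; apply/eqP; apply: eq_bigr => a _.
by rewrite cut_matrixE.
Qed.

End cut.

(** * Opening a gap at one energy *)

Section perturbation.
Variable R : realType.
Implicit Types (w : int -> R) (A : 'M[R]_2).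

Local Notation i0 := (@ord0 1).
Local Notation i1 := (@Ordinal 2 1 isT).

(** The effect of changing the potential by [s] at the first site of a transfer product. The trace
    moves by [- s] times the upper right entry, which must therefore not vanish. *)
Definition shear (s : R) : 'M[R]_2 :=
  \matrix_(j < 2, k < 2) (nth [::] [:: [:: 1; 0]; [:: - s; 1]] j)`_k.

Lemma Smat_shear a s : Smat (a + s) = Smat a *m shear s.
Proof. by apply: mx2P; rewrite mulmx2E !mxE /=; ring. Qed.

Lemma shear_entries A s : [/\ (A *m shear s) i0 i0 = A i0 i0 - s * A i0 i1,
  (A *m shear s) i0 i1 = A i0 i1 & \tr (A *m shear s) = \tr A - s * A i0 i1].
Proof. by split; rewrite ?trace2E !mulmx2E !mxE /=; ring. Qed.

Definition pert w (M : nat) (j : int) (s : R) : int -> R :=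
  fun k => w k + (if (M%:Z %| k - j)%Z then s else 0).

Lemma pert_periodic w M j s : (forall k, w (k + M%:Z) = w k) ->
  forall k, pert w M j s (k + M%:Z) = pert w M j s k.
Proof.
move=> per k; rewrite /pert per; suff -> : (M%:Z %| k + M%:Z - j)%Z = (M%:Z %| k - j)%Z by [].
by rewrite addrAC rpredDr ?dvdzz.
Qed.

Lemma pert_close w M j s k : `|pert w M j s k - w k| <= `|s|.
Proof. by rewrite /pert addrC addKr; case: ifP; rewrite ?normr0. Qed.

Lemma pert_at w M j s : pert w M j s j = w j + s.
Proof. by rewrite /pert subrr dvdz0. Qed.

Lemma pert_off w M (j : int) s (k : nat) : (0 < k < M)%N ->
  pert w M j s (j + k%:Z) = w (j + k%:Z).
Proof.
move=> /andP[k0 kM]; rewrite /pert (_ : j + k%:Z - j = k%:Z); last by ring.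
rewrite dvdzE /=.
by rewrite gtnNdvd// addr0.
Qed.

Lemma tm_pert w w' i n s : w' i = w i + s ->
  (forall k, (0 < k < n.+1)%N -> w' (i + k%:Z) = w (i + k%:Z)) ->
  tm w' i n.+1 = tm w i n.+1 *m shear s.
Proof.
move=> h0 hk; rewrite -[n.+1]add1n !tm_add /= !addr0 !mulmx1 h0 Smat_shear mulmxA.
congr (_ *m _ *m _); apply: tm_eq => k kn.
by rewrite -!addrA -!intS hk.
Qed.

Lemma tm_pert0 w M s : (0 < M)%N -> tm (pert w M 0 s) 0 M = tm w 0 M *m shear s.
Proof.
case: M => // M _; apply: tm_pert => [|k kM]; first by rewrite pert_at.
exact: pert_off.
Qed.

(** Up to sign the corner is the upper left entry of the product started at site 1. If it vanishes,
    the entry next to it does not, as the determinant is 1; changing the potential at site 1,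
    distinct from site 0 modulo [m], moves a multiple of that neighbour into the corner. *)
Lemma nonzero_corner w m e : (1 < m)%N -> (forall k, w (k + m%:Z) = w k) ->
  0 < e -> exists w', [/\ forall k, w' (k + m%:Z) = w' k,
    forall k, `|w' k - w k| <= e & tm w' 0 m i0 i1 != 0].
Proof.
case: m => [//|[//|m]] _ per e0.
have corner v : tm v 0 m.+2 i0 i1 = - tm v 1 m.+1 i0 i0.
  by rewrite -[m.+2]add1n tm_add mulmx2E /= mulmx1 addr0 !mxE /=; ring.
have [b0|nb] := eqVneq (tm w 0 m.+2 i0 i1) 0; last first.
  by exists w; split=> // k; rewrite subrr normr0 ltW.
exists (pert w m.+2 1 e); split.
- exact: pert_periodic.
- by move=> k; apply: le_trans (pert_close _ _ _ _ _) _; rewrite gtr0_norm.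
rewrite corner (tm_pert (w := w) (s := e)) ?pert_at// => [|k /andP[k0 km]]; last first.
  by rewrite pert_off// k0 ltnW.
have [-> _ _] := shear_entries (tm w 1 m.+1) e.
move/eqP: b0; rewrite corner oppr_eq0 => /eqP c0.
have := det_tm w 1 m.+1; rewrite det2E c0 mul0r sub0r => d.
rewrite sub0r opprK mulf_neq0 ?(lt0r_neq0 e0)//.
apply/eqP => h; move: d; rewrite h mul0r oppr0 => /eqP.
by rewrite eq_sym oner_eq0.
Qed.

End perturbation.

Section single_gap.
Variable R : realType.
Implicit Types (w : int -> R) (A : 'M[R]_2) (th : R).

Local Notation i0 := (@ord0 1).
Local Notation i1 := (@Ordinal 2 1 isT).

Lemma cheb_sin th n : cheb (2 * cos th) n * sin th = sin (n%:R * th).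
Proof.
have H k : cheb (2 * cos th) k * sin th = sin (k%:R * th) /\
    cheb (2 * cos th) k.+1 * sin th = sin (k.+1%:R * th).
  elim: k => [|k [IH1 IH2]]; first by rewrite /= !mul0r sin0 !mul1r.
  split => //; rewrite chebS.
  transitivity (2 * cos th * (cheb (2 * cos th) k.+1 * sin th) - cheb (2 * cos th) k * sin th).
    by ring.
  rewrite IH1 IH2 (_ : k%:R * th = k.+1%:R * th - th); last by rewrite -natr1; ring.
  rewrite (_ : k.+2%:R * th = k.+1%:R * th + th); last by rewrite -[k.+2%:R]natr1; ring.
  by rewrite sinB sinD; ring.
by have [] := H n.
Qed.

Lemma mxpow_trig A th n : \det A = 1 -> \tr A = 2 * cos th ->
  mxpow A n.+1 i0 i1 * sin th = sin (n.+1%:R * th) * A i0 i1 /\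
  \tr (mxpow A n.+1) * sin th = 2 * cos (n.+1%:R * th) * sin th.
Proof.
move=> dA tA; rewrite mxpow_cheb// tA.
have h1 := cheb_sin th n.+1; have h2 := cheb_sin th n; split.
  by rewrite !mxE mulr0n subr0 -h1; ring.
rewrite !trace2E !mxE !mulr1n.
have -> : cheb (2 * cos th) n.+1 * A i0 i0 - cheb (2 * cos th) n +
    (cheb (2 * cos th) n.+1 * A i1 i1 - cheb (2 * cos th) n) =
    cheb (2 * cos th) n.+1 * \tr A - 2 * cheb (2 * cos th) n by rewrite trace2E; ring.
rewrite tA; transitivity (cheb (2 * cos th) n.+1 * sin th * (2 * cos th) -
    2 * (cheb (2 * cos th) n * sin th)); first by ring.
rewrite h1 h2.
have -> : n%:R * th = n.+1%:R * th - th by rewrite -natr1; ring.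
by rewrite sinB; ring.
Qed.

Lemma sin_cos_Dpin (h : R) j : exists2 e : R, e ^+ 2 = 1 &
  sin (j%:R * pi + h) = e * sin h /\ cos (j%:R * pi + h) = e * cos h.
Proof.
elim: j => [|j [e e2 [IH1 IH2]]].
  by exists 1; rewrite ?expr1n// mul0r add0r !mul1r.
exists (- e); first by rewrite sqrrN.
have -> : j.+1%:R * pi + h = j%:R * pi + h + pi by rewrite -natr1; ring.
by rewrite sinDpi cosDpi IH1 IH2 !mulNr.
Qed.

(* If small changes of [w] at one site keep the monodromy elliptic, its angle
   covers an interval, so some choice makes [l th] equal to [j pi + h] for a large
   [l]; a perturbation at one site of the [l m]-periodic potential then pushes the
   trace beyond 2, because the off-diagonal entry [A_01] becomes [+- b sin h / sin th] in
   the [l]-th power. *)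
Lemma single_gap_elliptic w m e : (0 < m)%N -> (forall k, w (k + m%:Z) = w k) ->
  0 < e -> tm w 0 m i0 i1 != 0 ->
  exists l w', [/\ (0 < l)%N, forall k, w' (k + (l * m)%:Z) = w' k,
    forall k, `|w' k - w k| <= e + e & 4 < \tr (tm w' 0 (l * m)) ^+ 2].
Proof.
move=> m0 per e0 b0; set A := tm w 0 m in b0; set b := A i0 i1 in b0.
have trc c : \tr (tm (pert w m 0 c) 0 m) = \tr A - c * b.
  by rewrite tm_pert0//; have [] := shear_entries A c.
have [[c ce hc]|nc] := pselect (exists2 c, `|c| <= e & 4 < (\tr A - c * b) ^+ 2).
  exists 1%N, (pert w m 0 c); rewrite mul1n; split => //.
  - exact: pert_periodic.
  - by move=> k; apply: le_trans (pert_close _ _ _ _ _) _; rewrite (le_trans ce)// lerDl ltW.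
  - by rewrite trc.
have {nc}ell c : `|c| <= e -> -2 <= \tr A - c * b <= 2.
  move=> ce; have h : (\tr A - c * b) ^+ 2 <= 4.
    by rewrite leNgt; apply/negP => h; apply: nc; exists c.
  have : `|\tr A - c * b| <= 2.
    rewrite -(@ler_pXn2r _ 2)// ?nnegrE// real_normK ?num_real// (le_trans h)//.
    by rewrite le_eqVlt; apply/orP; left; apply/eqP; ring.
  by rewrite ler_norml.
pose d := e * `|b|.
have dE : d = e * `|b| by [].
have d0 : 0 < d by rewrite mulr_gt0// normr_gt0.
have ell' y : `|y| <= d -> -2 <= \tr A - y <= 2.
  move=> yd; rewrite -[y](divfK b0); apply: ell.
  by rewrite normf_div ler_pdivrMr ?normr_gt0.
have e1 := ell' d ltac:(by rewrite gtr0_norm).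
have e2 := ell' (- d) ltac:(by rewrite normrN gtr0_norm).
set tau := \tr A in ell ell' e1 e2 trc.
clearbody tau d; clear ell ell'.
rewrite opprK in e2.
have [/andP[e1a e1b] /andP[e2a e2b]] := (e1, e2).
pose th1 := acos ((tau + d) / 2); pose th2 := acos ((tau - d) / 2).
have i1' : -1 <= (tau + d) / 2 <= 1 by apply/andP; split; lra.
have i2' : -1 <= (tau - d) / 2 <= 1 by apply/andP; split; lra.
have r1 : th1 \in `[0, pi] by rewrite in_itv /= acos_ge0// acos_lepi.
have r2 : th2 \in `[0, pi] by rewrite in_itv /= acos_ge0// acos_lepi.
have k1 : cos th1 = (tau + d) / 2 by apply: acosK; rewrite in_itv.
have k2 : cos th2 = (tau - d) / 2 by apply: acosK; rewrite in_itv.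
have th12 : th1 < th2 by rewrite -(ltr_cos r1 r2) k1 k2; lra.
clearbody th1 th2.
have pi0 := pi_gt0 R.
(* The interval from [l * th1] to [l * th2] is longer than [2 * pi]: at most [pi] leads to a
   multiple [j * pi], and [h < pi] is added. *)
pose l := (Num.truncn (2 * pi / (th2 - th1))).+1.
have lbig : 2 * pi < l%:R * (th2 - th1).
  by rewrite -ltr_pdivrMr ?subr_gt0// truncnS_gt.
have l0 : 0 < l%:R :> R by rewrite ltr0n.
have l1 : (0 < l)%N by [].
clearbody l.
have th2_pi : th2 <= pi by move: r2; rewrite in_itv /= => /andP[].
have th1_0 : 0 <= th1 by move: r1; rewrite in_itv /= => /andP[].
pose j := (Num.truncn (l%:R * th1 / pi)).+1.
have j1 : l%:R * th1 < j%:R * pi by rewrite -ltr_pdivrMr// truncnS_gt.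
have j2 : j%:R * pi <= l%:R * th1 + pi.
  rewrite -natr1 mulrDl mul1r lerD2r -ler_pdivlMr// truncn_le.
  by rewrite divr_ge0 ?mulr_ge0// ltW.
clearbody j.
(* With [tan x = d / 4] and [h = 2 x], [2 * cos h + d * sin h = 2 + d * sin x * cos x > 2]. *)
pose x := atan (d / 4).
have x0 : 0 < x by rewrite -[0](@atan0 R) lt_atan// divr_gt0.
have xpi := atan_ltpi2 (d / 4); rewrite -/x in xpi.
have cx : 0 < cos x by apply: cos_gt0_pihalf; rewrite xpi andbT; lra.
have sx : 0 < sin x by apply: sin_gt0_pihalf; rewrite x0 xpi.
have sxE : sin x = d / 4 * cos x.
  by have := atanK (d / 4); rewrite -/x /tan => <-; rewrite mulfVK// gt_eqF.
clearbody x.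
pose h := x *+ 2.
have h_pi : h < pi by rewrite /h mulr2n; lra.
have h0 : 0 < h by rewrite /h mulr2n; lra.
have big : 2 < 2 * cos h + d * sin h.
  rewrite /h cos_mulr2n sin_mulr2n.
  have := mulr_gt0 sx (mulr_gt0 d0 cx); have := cos2Dsin2 x.
  rewrite [cos x * sin x *+ 2]mulr2n [cos x ^+ 2 *+ 2]mulr2n => cs.
  have -> : cos x ^+ 2 = 1 - sin x ^+ 2 by rewrite -cs; ring.
  have -> : sin x ^+ 2 = sin x * (d / 4 * cos x) by rewrite expr2 {2}sxE.
  lra.
pose phi := j%:R * pi + h; pose th := phi / l%:R.
have lth : l%:R * th = phi by rewrite mulrC divfK// gt_eqF.
clearbody h th.
have tha : th1 < th.
  by rewrite -(ltr_pM2l l0) lth /phi; lra.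
have thb : th < th2.
  by rewrite -(ltr_pM2l l0) lth /phi; lra.
have r : th \in `[0, pi].
  by rewrite in_itv /= (le_trans th1_0 (ltW tha)) (le_trans (ltW thb) th2_pi).
have cos1 : cos th < cos th1 by rewrite (ltr_cos r1 r).
have cos2 : cos th2 < cos th by rewrite (ltr_cos r r2).
have sth : 0 < sin th.
  by apply: sin_gt0_pi; rewrite (le_lt_trans th1_0 tha) (lt_le_trans thb th2_pi).
pose c := (tau - 2 * cos th) / b.
have ce : `|c| <= e.
  rewrite normf_div ler_pdivrMr ?normr_gt0// -dE ler_norml.
  move: cos1 cos2; rewrite k1 k2; move: (cos th) => y; clear => y1 y2.
  by apply/andP; split; lra.
set w1 := pert w m 0 c; set B := tm w1 0 m.
have per1 : forall k, w1 (k + m%:Z) = w1 k by exact: pert_periodic.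
have trB : \tr B = 2 * cos th by rewrite trc /c divfK//; ring.
have Bb : B i0 i1 = b by rewrite /B tm_pert0//; have [] := shear_entries A c.
have dB : \det B = 1 by exact: det_tm.
have lm0 : (0 < l * m)%N by rewrite muln_gt0 l1.
(* The sign gives [s * b = - d], so that the change of the trace adds to [2 * cos h] instead of
   cancelling it. *)
pose s := - Num.sg b * e.
exists l, (pert w1 (l * m) 0 s); split => //.
- apply: pert_periodic => k; move: (l) => l'.
  elim: l' => [|l' IH]; first by rewrite mul0n addr0.
  by rewrite mulSn PoszD addrA addrAC per1.
- move=> k; rewrite -[X in `|X|](subrKA (w1 k)).
  apply: le_trans (ler_normD _ _) _; apply: lerD.
    apply: le_trans (pert_close _ _ _ _ _) _.
    by rewrite normrM normrN normr_sg b0 mul1r gtr0_norm.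
  exact: le_trans (pert_close _ _ _ _ _) ce.
rewrite tm_pert0// tm_period//.
have [_ _ ->] := shear_entries (iter l (mulmx (tm w1 0 m)) 1%:M) s.
have [m1 m2] := mxpow_trig l.-1 dB trB; rewrite prednK// lth in m1 m2.
rewrite -/B -/(mxpow B l).
have {}m2 : \tr (mxpow B l) = 2 * cos phi by apply: (mulIf (lt0r_neq0 sth)).
have {}m1 : mxpow B l i0 i1 = sin phi * b / sin th.
  by rewrite -Bb -m1 mulfK// gt_eqF.
have [eps eps2 [sphi cphi]] := sin_cos_Dpin h j.
rewrite m1 m2 /phi sphi cphi.
have sb : s * b = - d by rewrite /s dE [`|b|]normrEsg; ring.
have -> : 2 * (eps * cos h) - s * (eps * sin h * b / sin th) =
    eps * (2 * cos h - (s * b) * sin h / sin th) by ring.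
rewrite sb exprMn eps2 mul1r mulNr mulNr opprK.
have sh : 0 < sin h by apply: sin_gt0_pi; rewrite h0.
have h4 : d * sin h <= d * sin h / sin th.
  by rewrite ler_pdivlMr// ler_piMr ?sin_le1// mulr_ge0// ltW.
have : 2 < 2 * cos h + d * sin h / sin th by apply: lt_le_trans big _; rewrite lerD2l.
set z := _ + _; move: z => z; clear; nra.
Qed.

Lemma single_gap w m e : (1 < m)%N -> (forall k, w (k + m%:Z) = w k) -> 0 < e ->
  exists l w', [/\ (0 < l)%N, forall k, w' (k + (l * m)%:Z) = w' k,
    forall k, `|w' k - w k| <= e & 4 < \tr (tm w' 0 (l * m)) ^+ 2].
Proof.
move=> m1 per e0; have e3 : 0 < e / 3 by rewrite divr_gt0.
have [w1 [per1 close1 b1]] := nonzero_corner m1 per e3.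
have [l [w2 [l0 per2 close2 tr2]]] := single_gap_elliptic (ltnW m1) per1 e3 b1.
exists l, w2; split => // k; rewrite -[X in `|X|](subrKA (w1 k)).
apply: le_trans (ler_normD _ _) _; have := close1 k; have := close2 k; lra.
Qed.

End single_gap.

(** * Supermultiplicativity of transfer matrices off the spectrum *)

Section supermultiplicativity.
Variable R : realType.
Implicit Types (V u w s : int -> R) (A B : 'M[R]_2).

Local Notation i0 := (@ord0 1).
Local Notation i1 := (@Ordinal 2 1 isT).

Lemma solution_exists V (i : int) (a b : R) :
  exists s, [/\ s i = a, s (i - 1) = b & forall k, Hop V s k = 0].
Proof.
pose F := fix F (n : nat) : R * R := if n is m.+1 then
  let p := F m in (- V (i + m%:Z) * p.1 - p.2, p.1) else (a, b).
pose G := fix G (n : nat) : R * R := if n is m.+1 then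
  let p := G m in (- V (i - m.+1%:Z) * p.1 - p.2, p.1) else (b, a).
pose s0 (k : int) : R := match k with Posz n => (F n).1 | Negz n => (G n).1 end.
exists (fun k => s0 (k - i)); split.
- by rewrite subrr.
- by rewrite addrAC subrr add0r.
move=> k; rewrite /Hop.
have -> : k + 1 - i = k - i + 1 by ring.
have -> : k - 1 - i = k - i - 1 by ring.
rewrite -[in V k](subrK i k); move: (k - i) => {}k; rewrite [k + i]addrC.
case: k => [[|n]|[|n]].
- by rewrite /s0 /=; ring.
- have -> : n.+1%:Z + 1 = Posz n.+2 by lia.
  have -> : n.+1%:Z - 1 = Posz n by lia.
  by rewrite /s0 /=; ring.
- have -> : Negz 0 + 1 = Posz 0 by lia.
  have -> : Negz 0 - 1 = Negz 1 by lia.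
  by rewrite /s0 /=; ring.
- have -> : Negz n.+1 + 1 = Negz n by lia.
  have -> : Negz n.+1 - 1 = Negz n.+2 by lia.
  by rewrite /s0 /=; ring.
Qed.

Definition delta (j : int) : int -> R := fun k => (k == j)%:R.

Lemma sum_le_delta j (c : R) : 0 <= c -> sum_le (fun k => c * delta j k) c.
Proof.
move=> c0 L uL; rewrite -mulr_sumr -[leRHS]mulr1 ler_wpM2l//.
have -> : \sum_(k <- L) delta j k = (count_mem j L)%:R.
  rewrite -sum1_count natr_sum [RHS]big_mkcond /=; apply: eq_bigr => k _.
  by rewrite /delta; case: (k == j).
by rewrite (count_uniq_mem _ uL); case: (j \in L).
Qed.

Lemma delta_sqr j k : delta j k ^+ 2 = delta j k.
Proof. by rewrite /delta; case: (k == j); rewrite ?expr1n ?expr0n. Qed.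

Definition cutoff (a b : int) s : int -> R := fun k => if a <= k <= b then s k else 0.

(** Truncating a solution leaves sources only at the last site inside and the first site outside
    each end. For [a = b + 1] the range is empty and the four sources cancel in pairs. *)
Lemma Hop_cutoff V a b s k : a <= b + 1 -> (forall k, Hop V s k = 0) ->
  Hop V (cutoff a b s) k = s a * delta (a - 1) k - s (a - 1) * delta a k
    - s (b + 1) * delta b k + s b * delta (b + 1) k.
Proof.
move=> ab sol; have := sol k; rewrite /Hop /cutoff /delta => sk.
have Vs : V k * s k = - s (k + 1) - s (k - 1).
  by apply/eqP; rewrite -subr_eq0 -sk; apply/eqP; ring.
move: sk => _.
have e1 : (a <= k + 1 <= b) = (a - 1 <= k <= b - 1) by lia.
have e2 : (a <= k - 1 <= b) = (a + 1 <= k <= b + 1) by lia.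
rewrite e1 e2.
have [->|ka1] := eqVneq k (a - 1).
  have -> : (a - 1 == a) = false by lia.
  have -> : (a - 1 == b + 1) = false by lia.
  have -> : (a + 1 <= a - 1 <= b + 1) = false by lia.
  have -> : (a <= a - 1 <= b) = false by lia.
  have [<-|nb] := eqVneq (a - 1) b.
    have -> : (a - 1 <= a - 1 <= a - 1 - 1) = false by lia.
    by rewrite !subrK /=; ring.
  have -> : (a - 1 <= a - 1 <= b - 1) by lia.
  by rewrite subrK /=; ring.
have [ka|nka] := eqVneq k a.
  subst k.
  have -> : (a + 1 <= a <= b + 1) = false by lia.
  have [ba|nba] := eqVneq a b.
    subst b.
    have -> : (a - 1 <= a <= a - 1) = false by lia.
    have -> : (a <= a <= a) by lia.
    have -> : (a == a + 1) = false by lia.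
    by rewrite /= Vs; ring.
  have [b1|nb1] := eqVneq a (b + 1).
    have -> : (a - 1 <= a <= b - 1) = false by lia.
    have -> : (a <= a <= b) = false by lia.
    have -> : b = a - 1 by lia.
    by rewrite /=; ring.
  have -> : (a - 1 <= a <= b - 1) by lia.
  have -> : (a <= a <= b) by lia.
  by rewrite /= Vs; ring.
have [kb|nkb] := eqVneq k b.
  subst k.
  have -> : (a - 1 <= b <= b - 1) = false by lia.
  have -> : (b == b + 1) = false by lia.
  have [h|h] := boolP (a <= b).
    have -> : (a + 1 <= b <= b + 1) by lia.
    by rewrite lexx /= Vs; ring.
  lia.
have [kb1|nkb1] := eqVneq k (b + 1).
  subst k.
  have -> : (a - 1 <= b + 1 <= b - 1) = false by lia.
  have -> : (a <= b + 1 <= b) = false by lia.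
  have -> : (a + 1 <= b + 1 <= b + 1) by lia.
  by rewrite addrK /=; ring.
have [h|h] := boolP (a <= k <= b).
  have -> : (a - 1 <= k <= b - 1) by lia.
  have -> : (a + 1 <= k <= b + 1) by lia.
  by rewrite /= Vs; ring.
have -> : (a - 1 <= k <= b - 1) = false by lia.
have -> : (a + 1 <= k <= b + 1) = false by lia.
by rewrite /=; ring.
Qed.

Lemma cutoff_l2 a b s : exists z, sum_le (sq (cutoff a b s)) z.
Proof.
exists (\sum_(k <- window (absz a + absz b)) sq s k) => L uL.
rewrite (bigID (fun k => a <= k <= b)) /= [X in _ + X]big1 ?addr0 => [|k]; last first.
  by rewrite /sq /cutoff => /negPf ->; rewrite expr0n.
rewrite -big_filter; apply: (@le_trans _ _ (\sum_(k <- [seq k <- L | a <= k <= b]) sq s k)).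
  rewrite big_filter [leRHS]big_filter; apply: ler_sum => k kab.
  by rewrite /sq /cutoff kab.
apply: ler_sum_subset; [by move=> k; exact: sqr_ge0|exact: filter_uniq|].
by move=> k; rewrite mem_filter mem_window => /andP[kab _]; move: kab; clear; lia.
Qed.

Lemma junction (i : int) (m n : nat) : [/\ i + m%:Z - 1 != i + m%:Z,
  i - 1 <= i + m%:Z - 1 <= i + m%:Z - 1,
  (i + m%:Z <= i + m%:Z - 1 <= i + m%:Z + n%:Z) = false,
  (i - 1 <= i + m%:Z <= i + m%:Z - 1) = false &
  i + m%:Z <= i + m%:Z <= i + m%:Z + n%:Z].
Proof. by split; lia. Qed.

Lemma tm_solution V K i n s : 0 <= K -> (forall k, `|V k| <= K) ->
  (forall k, Hop V s k = 0) -> let A := tm (fun k => - V k) i n in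
  s (i + n%:Z) = A i0 i0 * s i + A i0 i1 * s (i - 1) /\
  s (i + n%:Z - 1) = A i1 i0 * s i + A i1 i1 * s (i - 1).
Proof.
move=> K0 VK sol; have [] := tm_inhom s i n K0 VK.
rewrite big1 => [|k _]; last by rewrite sol normr0.
by rewrite mulr0 !normr_le0 !subr_eq0 => /eqP h1 /eqP h2.
Qed.

Lemma glue_bounds (x1 x2 b1 b2 e1 e2 K : R) : 0 <= K ->
  let X := `|x1| + `|x2| + (`|b1| + `|b2|) + (`|e1| + `|e2|) in
  [/\ 0 <= X, `|x2| <= (K + 2) * X, K * `|x2| + `|x1| <= (K + 2) * X,
    `|e1| <= (K + 2) * X & `|e2| <= (K + 2) * X] /\
  (K * `|b1| + `|b2| <= (K + 2) * X /\ `|b1| <= (K + 2) * X).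
Proof.
move=> K0 X; have := (normr_ge0 x1, normr_ge0 x2, normr_ge0 b1, normr_ge0 b2,
  normr_ge0 e1, normr_ge0 e2).
rewrite /X; move: `|x1| `|x2| `|b1| `|b2| `|e1| `|e2| => {X} p q r s u w.
move=> [[[[[p0 q0] r0] s0] u0] w0].
have X0 : 0 <= p + q + (r + s) + (u + w) by lra.
have KX := mulr_ge0 K0 X0.
have h a : a <= p + q + (r + s) + (u + w) ->
    K * a <= K * (p + q + (r + s) + (u + w)) by move=> *; rewrite ler_wpM2l.
rewrite mulrDl; move: (h q) (h r) X0 KX; clear h K0.
by move: (K * _) (K * _) (K * _) => kx kq kr hq hr *; do !split; lra.
Qed.

Lemma sqrD6 (a1 a2 a3 a4 a5 a6 : R) : (a1 + a2 + a3 + a4 + a5 + a6) ^+ 2 <=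
  6 * (a1 ^+ 2 + a2 ^+ 2 + a3 ^+ 2 + a4 ^+ 2 + a5 ^+ 2 + a6 ^+ 2).
Proof.
have := sqrD2 (a1 + a2 + a3) (a4 + a5 + a6).
by have := sqrD3 a1 a2 a3; have := sqrD3 a4 a5 a6; lra.
Qed.

Lemma six_copies (y c : R) : y <= c -> 6 * (y + y + y + y + y + y) <= 36 * c.
Proof. move=> *; lra. Qed.

Lemma sum_bound (p q s y c : R) : p <= s + y -> q <= 6 * c -> s <= 6 * c -> y <= c ->
  p + q <= 13 * c.
Proof. move=> *; lra. Qed.

(* The lower bound is applied to the function equal to the solution with data
   [(x1, x2)] at [i] to the left of [i + m], to the solution with data [(s1, s2)]
   at [i + m] to its right, and to 0 outside [[i - 1, i + m + n]]. *)
Lemma matching_bound V K C i m n (x1 x2 s1 s2 : R) : 0 <= K ->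
  (forall k, `|V k| <= K) -> 1 <= C -> lower V C ->
  let w := fun k => - V k in
  let A := tm w i m in let B := tm w (i + m%:Z) n in
  let y1 := A i0 i0 * x1 + A i0 i1 * x2 in
  let y2 := A i1 i0 * x1 + A i1 i1 * x2 in
  `|y1| + `|y2| <= 13 * C * (K + 2) * (`|x1| + `|x2| +
    (`|B i0 i0 * s1 + B i0 i1 * s2| + `|B i1 i0 * s1 + B i1 i1 * s2|) +
    (`|y1 - s1| + `|y2 - s2|)).
Proof.
move=> K0 VK C1 lo; cbv zeta; set w := fun k => - V k.
set A := tm w i m; set B := tm w _ n; set y1 := _ + _ * x2; set y2 := A i1 i0 * x1 + _.
have [l [l0 l1 Hl]] := solution_exists V i x1 x2.
have [r [r0 r1 Hr]] := solution_exists V (i + m%:Z) s1 s2.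
have := tm_solution i m K0 VK Hl; have := tm_solution (i + m%:Z) n K0 VK Hr.
rewrite /= -/w -/A -/B r0 r1 l0 l1.
set b1 := _ + _ * s2; set b2 := B i1 i0 * s1 + _ => -[rz rz1] [].
rewrite -/y1 -/y2 => ly1 ly2.
set X := `|x1| + `|x2| + _ + _; set z := i + m%:Z + n%:Z in rz rz1.
have lm2 : l (i - 1 - 1) = - V (i - 1) * x2 - x1.
  by have := Hl (i - 1); rewrite /Hop subrK l0 l1 => h; rewrite -[LHS]subr0 -h; ring.
have rp : r (z + 1) = - V z * b1 - b2.
  by have := Hr z; rewrite /Hop rz rz1 => h; rewrite -[LHS]subr0 -h; ring.
pose u k := cutoff (i - 1) (i + m%:Z - 1) l k + cutoff (i + m%:Z) z r k.
have Hu k : Hop V u k = x2 * delta (i - 1 - 1) k + (V (i - 1) * x2 + x1) * delta (i - 1) k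
   + (s1 - y1) * delta (i + m%:Z - 1) k + (y2 - s2) * delta (i + m%:Z) k
   + (V z * b1 + b2) * delta z k + b1 * delta (z + 1) k.
  rewrite HopD !Hop_cutoff//; [|lia|lia].
  by rewrite l1 lm2 !subrK ly1 ly2 r0 r1 rp rz; ring.
have X1 : 0 <= (K + 2) * X by rewrite mulr_ge0 ?addr_ge0.
have Vb a c p : `|V p * a + c| <= K * `|a| + `|c|.
  apply: le_trans (ler_normD _ _) _; rewrite lerD2r normrM ler_wpM2r//.
have cb c : `|c| <= (K + 2) * X -> 0 <= c ^+ 2 <= ((K + 2) * X) ^+ 2.
  by move=> h; rewrite sqr_ge0 sq_abs_le.
have XE : X = `|x1| + `|x2| + (`|b1| + `|b2|) + (`|y1 - s1| + `|y2 - s2|) by [].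
have [[X0 c1 c2' c3' c4] [c5' c6]] := glue_bounds x1 x2 b1 b2 (y1 - s1) (y2 - s2) K0.
rewrite -XE in X0 c1 c2' c3' c4 c5' c6.
have c2 : `|V (i - 1) * x2 + x1| <= (K + 2) * X by exact: le_trans (Vb _ _ _) c2'.
have c3 : `|s1 - y1| <= (K + 2) * X by rewrite distrC.
have c5 : `|V z * b1 + b2| <= (K + 2) * X by exact: le_trans (Vb _ _ _) c5'.
set Y := (K + 2) * X in X1 cb c1 c2 c3 c4 c5 c6.
have YE : (K + 2) * X = Y by [].
have Y2 : 0 <= Y ^+ 2 by exact: sqr_ge0.
have d j := sum_le_delta j Y2.
have Hle : sum_le (sq (Hop V u)) (6 * (Y ^+ 2 + Y ^+ 2 + Y ^+ 2 + Y ^+ 2 + Y ^+ 2 + Y ^+ 2)).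
  apply: (sum_le_mono _ (lexx _) (sum_leZ (ler0n R 6) (sum_leD (sum_leD (sum_leD
    (sum_leD (sum_leD (d (i - 1 - 1)) (d (i - 1))) (d (i + m%:Z - 1)))
    (d (i + m%:Z))) (d z)) (d (z + 1))))) => k.
  rewrite /sq Hu; apply: le_trans (sqrD6 _ _ _ _ _ _) _; rewrite ler_pM2l//.
  have dl c j : `|c| <= Y -> (c * delta j k) ^+ 2 <= Y ^+ 2 * delta j k.
    by move=> /cb/andP[_ h]; rewrite exprMn delta_sqr ler_wpM2r.
  by rewrite !lerD ?dl.
have lu : exists z0, sum_le (sq u) z0.
  have [z1 h1] := cutoff_l2 (i - 1) (i + m%:Z - 1) l; have [z2 h2] := cutoff_l2 (i + m%:Z) z r.
  exists (2 * z1 + 2 * z2).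
  apply: (sum_le_mono _ (lexx _) (sum_leD (sum_leZ (ler0n R 2) h1) (sum_leZ (ler0n R 2) h2))).
  by move=> k; exact: sqrD2.
have [ne j1 j2 j3 j4] := junction i m n.
(* On the two sides of the junction [u] equals [y2] and [s1]; [y1] is within [Y] of [s1]. The
   constant 13 is [6 + 1 + 6]. *)
have := sum_le_at2 ne (lo u lu _ Hle).
have -> : sq u (i + m%:Z - 1) = y2 ^+ 2.
  by rewrite /sq /u /cutoff j1 j2 addr0 ly2.
have -> : sq u (i + m%:Z) = s1 ^+ 2.
  by rewrite /sq /u /cutoff j3 j4 add0r r0.
move=> h.
have h36 : y2 ^+ 2 + s1 ^+ 2 <= (6 * C * Y) ^+ 2.
  apply: le_trans h _; have -> : (6 * C * Y) ^+ 2 = C * (36 * (C * Y ^+ 2)) by ring.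
  rewrite ler_wpM2l ?(le_trans _ C1)//.
  by apply: six_copies; rewrite ler_peMl.
have CY0 : 0 <= 6 * C * Y by rewrite mulr_ge0// mulr_ge0// (le_trans _ C1).
have root a : a ^+ 2 <= (6 * C * Y) ^+ 2 -> `|a| <= 6 * C * Y.
  by move=> ha; rewrite -(@ler_pXn2r _ 2)// ?nnegrE// real_normK ?num_real.
have a1 := root y2 (le_trans _ h36); have a2 := root s1 (le_trans _ h36).
have {}a1 := a1 ltac:(by rewrite lerDl sqr_ge0).
have {}a2 := a2 ltac:(by rewrite lerDr sqr_ge0).
have a3 : `|y1| <= `|s1| + Y.
  rewrite -[y1](subrKC s1); apply: le_trans (ler_normD _ _) _.
  by rewrite lerD2l distrC.
have a4 : Y <= C * Y by rewrite ler_peMl.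
by rewrite -!mulrA YE; apply: sum_bound a3 _ _ a4; rewrite mulrA.
Qed.

End supermultiplicativity.

Section entry_norm.
Variable R : realType.
Implicit Types (V w : int -> R) (A B : 'M[R]_2).

Local Notation i0 := (@ord0 1).
Local Notation i1 := (@Ordinal 2 1 isT).

Definition nrm A : R := `|A i0 i0| + `|A i0 i1| + `|A i1 i0| + `|A i1 i1|.

Lemma nrm_ge0 A : 0 <= nrm A.
Proof. by rewrite /nrm !addr_ge0. Qed.

Lemma nrm_ge1 A : \det A = 1 -> 1 <= nrm A.
Proof.
rewrite det2E => dA; rewrite -(@ler_pXn2r _ 2)// ?nnegrE ?nrm_ge0// expr1n.
have := ler_normB (A i0 i0 * A i1 i1) (A i0 i1 * A i1 i0).
rewrite dA normr1 !normrM /nrm.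
have := normr_ge0 (A i0 i0); have := normr_ge0 (A i0 i1).
have := normr_ge0 (A i1 i0); have := normr_ge0 (A i1 i1).
move: `|_| => a; move: `|_| => b; move: `|_| => c; move: `|_| => d.
move=> a0 b0 c0 d0 h; apply: le_trans h _.
have := mulr_ge0 a0 d0; have := mulr_ge0 b0 c0; have := mulr_ge0 a0 b0.
have := mulr_ge0 a0 c0; have := mulr_ge0 b0 d0; have := mulr_ge0 c0 d0.
have := sqr_ge0 a; have := sqr_ge0 b; have := sqr_ge0 c; have := sqr_ge0 d.
nra.
Qed.

(* The hypothesis is used for [s] the projection of [y] orthogonal to [(p, q)]. *)
Lemma row_splitting (p q p' q' y1 y2 G : R) :
  `|p * q' - q * p'| = 1 -> 0 <= G -> 0 < `|p| + `|q| ->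
  (forall s1 s2, `|y1| + `|y2| <= G * (1 + (`|p * s1 + q * s2| + `|p' * s1 + q' * s2|)
     + (`|y1 - s1| + `|y2 - s2|))) ->
  (`|y1| + `|y2|) * (`|p| + `|q|) <=
    G * ((`|p| + `|q|) + 2 * (`|y1| + `|y2|) + 2 * `|p * y1 + q * y2|).
Proof.
move=> det G0 r0 H; set r := `|p| + `|q| in r0 *.
pose N := p ^+ 2 + q ^+ 2.
have rN : r ^+ 2 <= 2 * N.
  rewrite /r /N -[p ^+ 2]real_normK ?num_real// -[q ^+ 2]real_normK ?num_real//.
  by have := sqrD2 `|p| `|q|; lra.
have N0 : 0 < N by have := exprn_gt0 2 r0; lra.
have N1 := lt0r_neq0 N0.
pose sg := (p * y2 - q * y1) / N; pose D := p * y1 + q * y2.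
have e0 : p * (- q * sg) + q * (p * sg) = 0 by ring.
have e1 : p' * (- q * sg) + q' * (p * sg) = (p * q' - q * p') * sg by ring.
have e2 : y1 - (- q * sg) = p * (D / N) by rewrite /sg /D /N; field.
have e3 : y2 - p * sg = q * (D / N) by rewrite /sg /D /N; field.
have := H (- q * sg) (p * sg).
rewrite e0 e1 e2 e3 normr0 add0r !normrM det mul1r -mulrDl -/r.
have rNi : r / N <= 2 / r.
  by rewrite ler_pdivrMr// mulrAC ler_pdivlMr// -expr2.
have h1 : `|sg| <= 2 / r * (`|y1| + `|y2|).
  rewrite /sg normrM normfV (gtr0_norm N0).
  apply: (@le_trans _ _ (r * (`|y1| + `|y2|) / N)).
    rewrite ler_pM2r ?invr_gt0//; apply: le_trans (ler_normB _ _) _.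
    rewrite !normrM /r; have := normr_ge0 p; have := normr_ge0 q.
    have := normr_ge0 y1; have := normr_ge0 y2; nra.
  by rewrite mulrAC ler_wpM2r// addr_ge0.
have h2 : r * (`|D| * `|N^-1|) <= 2 / r * `|D|.
  by rewrite normfV (gtr0_norm N0) mulrCA mulrC ler_wpM2r.
rewrite -[`|p * y2 - q * y1| * _]normrM -/sg.
move=> h; have {}h : `|y1| + `|y2| <= G * (1 + 2 / r * (`|y1| + `|y2|) + 2 / r * `|D|).
  by apply: le_trans h _; rewrite ler_wpM2l// !lerD.
have := ler_wpM2r (ltW r0) h; move=> /le_trans; apply.
rewrite le_eqVlt; apply/orP; left; apply/eqP; rewrite -/D.
have fin (a c g e : R) : a != 0 ->
  g * (1 + 2 / a * c + 2 / a * e) * a = g * (a + 2 * c + 2 * e) by move=> a0; field.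
exact: fin (lt0r_neq0 r0).
Qed.

Definition match_const (K C : R) : R := 13 * C * (K + 2).
Definition super_const (K C : R) : R :=
  4 * match_const K C * (6 * match_const K C + 1).

Lemma match_const_ge1 K C : 0 <= K -> 1 <= C -> 1 <= match_const K C.
Proof. rewrite /match_const => K0 C1; nra. Qed.

Lemma absorb_two (G x y : R) : 0 <= G -> 1 <= y -> x <= G * (2 + y) -> x <= 3 * G * y.
Proof.
move=> G0 y1 /le_trans; apply; have -> : 3 * G * y = G * (3 * y) by ring.
by rewrite ler_wpM2l//; lra.
Qed.

Lemma row_combine (G a1 a2 a b r d e1 e2 : R) : 0 <= G -> 0 <= a ->
  a1 * r <= G * (r + 2 * a1 + 2 * e1) -> a2 * r <= G * (r + 2 * a2 + 2 * e2) ->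
  e1 + e2 <= d -> r <= b -> b <= 2 * r -> a1 + a2 = a ->
  a <= 3 * G * d -> b <= 3 * G * d -> a * b <= 4 * G * (6 * G + 1) * d.
Proof.
move=> G0 a0 h1 h2 ed rb br aE ad bd.
apply: le_trans (ler_wpM2l a0 br) _.
have -> : a * (2 * r) = 2 * (a1 * r + a2 * r) by rewrite -aE; ring.
have -> : 4 * G * (6 * G + 1) * d = 2 * (G * (12 * G * d + 2 * d)) by ring.
rewrite ler_pM2l//; apply: le_trans (lerD h1 h2) _; rewrite -mulrDr ler_wpM2l//.
by rewrite -aE in ad; lra.
Qed.

(** For general unimodular matrices the norm of a product may collapse, as with [B = A^-1]. Here
    [matching_bound] excludes solutions that are large at the junction and small at both ends; it is
    applied to the columns of [A], with [(p, q)] the larger row of [B]. *)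
Lemma tm_supermul V K C i m n : 0 <= K ->
  (forall k, `|V k| <= K) -> 1 <= C -> lower V C ->
  nrm (tm (fun k => - V k) i m) * nrm (tm (fun k => - V k) (i + m%:Z) n) <=
  super_const K C * nrm (tm (fun k => - V k) i (m + n)).
Proof.
move=> K0 VK C1 lo; rewrite tm_add.
have mb := @matching_bound _ V K C i m n.
set A := tm _ i m in mb *; set B := tm _ (i + m%:Z) n in mb *.
have {}mb x1 x2 s1 s2 := mb x1 x2 s1 s2 K0 VK C1 lo.
rewrite /= -/(match_const K C) in mb.
have G1 := match_const_ge1 K0 C1; rewrite /super_const.
set G := match_const K C in mb G1 *.
have G0 : 0 <= G by lra.
have dA : \det A = 1 by exact: det_tm.
have dB : \det B = 1 by exact: det_tm.
have N1 : 1 <= nrm (B *m A) by apply: nrm_ge1; rewrite det_mulmx dA dB mulr1.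
have A0 := nrm_ge0 A; have B0 := nrm_ge0 B.
have [E00 E01 E10 E11] : [/\ (B *m A) i0 i0 = B i0 i0 * A i0 i0 + B i0 i1 * A i1 i0,
  (B *m A) i0 i1 = B i0 i0 * A i0 i1 + B i0 i1 * A i1 i1,
  (B *m A) i1 i0 = B i1 i0 * A i0 i0 + B i1 i1 * A i1 i0 &
  (B *m A) i1 i1 = B i1 i0 * A i0 i1 + B i1 i1 * A i1 i1].
  by rewrite !mulmx2E.
rewrite det2E in dA; rewrite det2E in dB.
have hA : nrm A <= 3 * G * nrm (B *m A).
  (* The right-hand data continue the left solution exactly, so there is no jump and only the two
     ends contribute. *)
  have h0 := mb 1 0 (A i0 i0) (A i1 i0); have h1 := mb 0 1 (A i0 i1) (A i1 i1).
  rewrite !mulr1 !mulr0 ?addr0 ?add0r !subrr !normr0 ?addr0 ?add0r !normr1 in h0 h1.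
  rewrite -E00 -E10 in h0; rewrite -E01 -E11 in h1.
  have : nrm A <= G * (2 + nrm (B *m A)).
    by rewrite /nrm; move: h0 h1; lra.
  exact: absorb_two.
have hB : nrm B <= 3 * G * nrm (B *m A).
  (* The initial data are the columns of the inverse of [B *m A]; the data at the junction are then
     the columns of [B^-1], and those at the right end the unit vectors. *)
  have h0 := mb ((B *m A) i1 i1) (- (B *m A) i1 i0) (B i1 i1) (- B i1 i0).
  have h1 := mb (- (B *m A) i0 i1) ((B *m A) i0 i0) (- B i0 i1) (B i0 i0).
  have e1 : A i0 i0 * (B *m A) i1 i1 + A i0 i1 * - (B *m A) i1 i0 = B i1 i1.
    by rewrite E11 E10 -[RHS]mulr1 -dA; ring.
  have e2 : A i1 i0 * (B *m A) i1 i1 + A i1 i1 * - (B *m A) i1 i0 = - B i1 i0.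
    by rewrite E11 E10 -[RHS]mulr1 -dA; ring.
  have e3 : A i0 i0 * - (B *m A) i0 i1 + A i0 i1 * (B *m A) i0 i0 = - B i0 i1.
    by rewrite E01 E00 -[RHS]mulr1 -dA; ring.
  have e4 : A i1 i0 * - (B *m A) i0 i1 + A i1 i1 * (B *m A) i0 i0 = B i0 i0.
    by rewrite E01 E00 -[RHS]mulr1 -dA; ring.
  have f1 : B i0 i0 * B i1 i1 + B i0 i1 * - B i1 i0 = 1 by rewrite -dB; ring.
  have f2 : B i1 i0 * B i1 i1 + B i1 i1 * - B i1 i0 = 0 by ring.
  have f3 : B i0 i0 * - B i0 i1 + B i0 i1 * B i0 i0 = 0 by ring.
  have f4 : B i1 i0 * - B i0 i1 + B i1 i1 * B i0 i0 = 1 by rewrite -dB; ring.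
  rewrite e1 e2 f1 f2 in h0; rewrite e3 e4 f3 f4 in h1.
  rewrite !subrr !normrN !normr0 normr1 ?addr0 ?add0r in h0 h1.
  have : nrm B <= G * (2 + nrm (B *m A)).
    by rewrite /nrm; move: h0 h1; lra.
  exact: absorb_two.
have row (p q p' q' : R) : `|p * q' - q * p'| = 1 ->
    (forall s1 s2, `|B i0 i0 * s1 + B i0 i1 * s2| + `|B i1 i0 * s1 + B i1 i1 * s2| =
      `|p * s1 + q * s2| + `|p' * s1 + q' * s2|) ->
    nrm B <= 2 * (`|p| + `|q|) -> `|p| + `|q| <= nrm B ->
    `|p * A i0 i0 + q * A i1 i0| + `|p * A i0 i1 + q * A i1 i1| <= nrm (B *m A) ->
    nrm A * nrm B <= 4 * G * (6 * G + 1) * nrm (B *m A).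
  move=> det eqB Br rB hD.
  have r0 : 0 < `|p| + `|q|.
    have : 1 <= nrm B by apply: nrm_ge1; rewrite det2E.
    lra.
  have h0 := @row_splitting p q p' q' (A i0 i0) (A i1 i0) G det G0 r0.
  have h1 := @row_splitting p q p' q' (A i0 i1) (A i1 i1) G det G0 r0.
  have {}h0 := h0 ltac:(by move=> s1 s2; have := mb 1 0 s1 s2;
    rewrite eqB !mulr1 !mulr0 !addr0 normr1 normr0 addr0).
  have {}h1 := h1 ltac:(by move=> s1 s2; have := mb 0 1 s1 s2;
    rewrite eqB !mulr1 !mulr0 !add0r normr1 normr0 add0r).
  apply: (row_combine G0 A0 h0 h1 hD rB Br _ hA hB).
  by rewrite addrACA !addrA.
have [h|h] := leP (`|B i1 i0| + `|B i1 i1|) (`|B i0 i0| + `|B i0 i1|).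
  apply: (row (B i0 i0) (B i0 i1) (B i1 i0) (B i1 i1)) => //.
  - by rewrite dB normr1.
  - by rewrite /nrm; lra.
  - by rewrite /nrm -addrA lerDl addr_ge0.
  - by rewrite -E00 -E01 /nrm -addrA lerDl addr_ge0.
apply: (row (B i1 i0) (B i1 i1) (B i0 i0) (B i0 i1)) => //.
- by rewrite -normrN -[RHS]normr1 -dB; congr (`|_|); ring.
- by move=> s1 s2; rewrite addrC.
- by rewrite /nrm; lra.
- by rewrite /nrm -addrA lerDr addr_ge0.
- by rewrite -E10 -E11 /nrm -addrA lerDr addr_ge0.
Qed.

End entry_norm.

(** * The Lyapunov exponent *)

Section operator_norm.
Variable R : realType.
Implicit Types (A B : 'M[R]_2) (w : 'cV[R]_2).

Local Notation i0 := (@ord0 1).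
Local Notation i1 := (@Ordinal 2 1 isT).

Lemma vnormE w : vnorm w = ComplexField.Normc.normc (Complex (w i0 ord0) (w i1 ord0)).
Proof.
rewrite /vnorm !big_ord_recl big_ord0 addr0 /=; congr (Num.sqrt (_ + w _ _ ^+ 2)).
exact: val_inj.
Qed.

Lemma vnorm_ge0 w : 0 <= vnorm w.
Proof. exact: sqrtr_ge0. Qed.

Lemma vnormD w w' : vnorm (w + w') <= vnorm w + vnorm w'.
Proof.
rewrite !vnormE !mxE; apply: le_trans (le_normcD _ _).
by rewrite le_eqVlt eqxx.
Qed.

Lemma vnormZ c w : vnorm (c *: w) = `|c| * vnorm w.
Proof.
by rewrite /vnorm -sqrtr_sqr -sqrtrM ?sqr_ge0// mulr_sumr; congr Num.sqrt;
  apply: eq_bigr => i _; rewrite mxE exprMn.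
Qed.

Lemma vnorm_eq0 w : vnorm w = 0 -> w = 0.
Proof.
rewrite vnormE => h; have := @ComplexField.Normc.eq0_normc R _ h => -[e0 e1].
by apply/matrixP => i j; rewrite ord1 mxE; have [->|->] := ord2P i.
Qed.

Lemma vnorm_coord w i : `|w i ord0| <= vnorm w.
Proof.
rewrite /vnorm -sqrtr_sqr ler_wsqrtr// (bigD1 i)//= lerDl sumr_ge0// => j _.
exact: sqr_ge0.
Qed.

Lemma vnorm_le w : vnorm w <= `|w i0 ord0| + `|w i1 ord0|.
Proof.
rewrite vnormE /= -[leRHS]ger0_norm ?addr_ge0// -sqrtr_sqr ler_wsqrtr//.
rewrite sqrrD !real_normK ?num_real// -addrA lerD2l lerDr mulrn_wge0//.
Qed.

Lemma vnorm_mul_le A w : vnorm (A *m w) <= nrm A * vnorm w.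
Proof.
apply: le_trans (vnorm_le _) _.
have e i : (A *m w) i ord0 = A i i0 * w i0 ord0 + A i i1 * w i1 ord0.
  by rewrite mxE !big_ord_recl big_ord0 addr0; congr (_ + A _ _ * w _ _); exact: val_inj.
rewrite !e /nrm.
have h i j : `|A i j * w j ord0| <= `|A i j| * vnorm w.
  by rewrite normrM ler_wpM2l// vnorm_coord.
have := ler_normD (A i0 i0 * w i0 ord0) (A i0 i1 * w i1 ord0).
have := ler_normD (A i1 i0 * w i0 ord0) (A i1 i1 * w i1 ord0).
have := h i0 i0; have := h i0 i1; have := h i1 i0; have := h i1 i1; lra.
Qed.

Definition opset A := [set vnorm (A *m w) | w in [set w : 'cV[R]_2 | vnorm w <= 1]].

Lemma opset_ub A : ubound (opset A) (nrm A).
Proof.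
move=> _ [w /= w1 <-]; apply: le_trans (vnorm_mul_le A w) _.
by rewrite ler_piMr// nrm_ge0.
Qed.

Lemma vnorm0 : vnorm (0 : 'cV[R]_2) = 0.
Proof. by rewrite -[0](scale0r 0) vnormZ normr0 mul0r. Qed.

Lemma opset_neq0 A : opset A !=set0.
Proof. by exists (vnorm (A *m 0)), 0 => //=; rewrite vnorm0. Qed.

Lemma opnorm_le A c : (forall w, vnorm w <= 1 -> vnorm (A *m w) <= c) -> opnorm A <= c.
Proof.
by move=> h; apply: ge_sup; [exact: opset_neq0|move=> _ [w /= w1 <-]; exact: h].
Qed.

Lemma opnorm_le_nrm A : opnorm A <= nrm A.
Proof. by apply: ge_sup; [exact: opset_neq0|exact: opset_ub]. Qed.

Lemma opnorm_ub1 A w : vnorm w <= 1 -> vnorm (A *m w) <= opnorm A.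
Proof.
move=> w1; apply: ub_le_sup; last by exists w.
by exists (nrm A); exact: opset_ub.
Qed.

Lemma opnorm_ge0 A : 0 <= opnorm A.
Proof. by apply: le_trans (vnorm_ge0 (A *m 0)) (opnorm_ub1 _ _); rewrite vnorm0. Qed.

Lemma opnorm_ub A w : vnorm (A *m w) <= opnorm A * vnorm w.
Proof.
have [w0|w0] := eqVneq (vnorm w) 0.
  by rewrite (vnorm_eq0 w0) mulmx0 vnorm0 mulr0.
have wp : 0 < vnorm w by rewrite lt_def w0 vnorm_ge0.
have -> : A *m w = vnorm w *: (A *m ((vnorm w)^-1 *: w)).
  by rewrite -scalemxAr scalerA divff// scale1r.
rewrite vnormZ gtr0_norm// mulrC ler_wpM2r ?vnorm_ge0// opnorm_ub1//.
by rewrite vnormZ normfV gtr0_norm// mulVf.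
Qed.

Lemma opnormM A B : opnorm (A *m B) <= opnorm A * opnorm B.
Proof.
apply: opnorm_le => w w1; rewrite -mulmxA; apply: le_trans (opnorm_ub _ _) _.
by rewrite ler_wpM2l ?opnorm_ge0// opnorm_ub1.
Qed.

Lemma opnorm_lip A B : opnorm A <= opnorm B + nrm (A - B).
Proof.
apply: opnorm_le => w w1; rewrite -[A in A *m _](subrK B) addrC mulmxDl.
apply: le_trans (vnormD _ _) _; apply: lerD; first exact: opnorm_ub1.
by apply: le_trans (vnorm_mul_le _ _) _; rewrite ler_piMr// nrm_ge0.
Qed.

Lemma entry_le_opnorm A i j : `|A i j| <= opnorm A.
Proof.
pose w : 'cV[R]_2 := delta_mx j ord0.
have w1 : vnorm w <= 1.
  rewrite /vnorm -sqrtr1 ler_wsqrtr// (bigD1 j)//= big1 => [|k kj].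
    by rewrite mxE !eqxx addr0 expr1n.
  by rewrite mxE (negPf kj) expr0n.
have -> : A i j = (A *m w) i ord0 by rewrite -colE mxE.
exact: le_trans (vnorm_coord _ _) (opnorm_ub1 _ _).
Qed.

Lemma nrm_le_opnorm A : nrm A <= 4 * opnorm A.
Proof.
rewrite /nrm; have h := entry_le_opnorm A.
have := h i0 i0; have := h i0 i1; have := h i1 i0; have := h i1 i1; lra.
Qed.

Lemma opnorm_ge1 A : \det A = 1 -> 1 <= opnorm A.
Proof.
move=> dA; have h0 (j : 'I_2) : (A i0 j) ^+ 2 + (A i1 j) ^+ 2 <= opnorm A ^+ 2.
  pose w : 'cV[R]_2 := delta_mx j ord0.
  have w1 : vnorm w <= 1.
    rewrite /vnorm -sqrtr1 ler_wsqrtr// (bigD1 j)//= big1 => [|k kj].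
      by rewrite mxE !eqxx addr0 expr1n.
    by rewrite mxE (negPf kj) expr0n.
  have := opnorm_ub1 A w1; rewrite -(@ler_pXn2r _ 2)// ?nnegrE ?opnorm_ge0 ?vnorm_ge0//.
  by rewrite vnormE /= sqr_sqrtr ?addr_ge0 ?sqr_ge0// -colE !mxE.
have := h0 i0; have := h0 i1; rewrite det2E in dA.
move: (opnorm_ge0 A); set N := opnorm A => N0 h2 h1.
rewrite leNgt; apply/negP => N1.
have N2 : N ^+ 2 < 1 by rewrite expr_lt1.
have := sqr_ge0 (A i0 i0 - A i1 i1); have := sqr_ge0 (A i0 i1 + A i1 i0).
move: dA h1 h2; move: (A i0 i0) (A i0 i1) (A i1 i0) (A i1 i1) => a b c d; nra.
Qed.

(** Norms of unimodular matrices are at least 1, and [ln] is 1-Lipschitz there. *)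
Lemma ln_opnorm_lip A B : \det A = 1 -> \det B = 1 ->
  ln (opnorm A) <= ln (opnorm B) + nrm (A - B).
Proof.
move=> dA dB; have A1 := opnorm_ge1 dA; have B1 := opnorm_ge1 dB.
have B0 : 0 < opnorm B by lra.
have D0 := nrm_ge0 (A - B).
have h : opnorm A <= opnorm B * (1 + nrm (A - B)).
  by apply: le_trans (opnorm_lip A B) _; rewrite mulrDr mulr1 lerD2l ler_peMl.
apply: (@le_trans _ _ (ln (opnorm B * (1 + nrm (A - B))))).
  by rewrite ler_ln ?posrE//; [lra|rewrite mulr_gt0//; lra].
rewrite lnM ?posrE//; last by lra.
rewrite lerD2l; have := @le_ln1Dx R (nrm (A - B)); apply; lra.
Qed.

End operator_norm.

Section fekete.
Variable R : realType.
Variable a : nat -> R.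
Hypothesis a_ge0 : forall n, 0 <= a n.
Hypothesis a_sub : forall n m, a (n + m)%N <= a n + a m.

Let ratio : nat -> R := fun n => n%:R^-1 * a n.

Lemma subadd_muln q m : a (q * m) <= q%:R * a m + a 0%N.
Proof.
elim: q => [|q IH]; first by rewrite mul0n mul0r add0r.
rewrite mulSn; apply: le_trans (a_sub _ _) _.
by rewrite -natr1 mulrDl mul1r [X in _ <= X + _]addrC -addrA lerD2l.
Qed.

Lemma fekete : exists L, [/\ ratio n @[n --> \oo] --> L, 0 <= L,
  forall n, (0 < n)%N -> L <= ratio n &
  forall c, (forall n m, a n + a m - c <= a (n + m)%N) ->
    forall n, (0 < n)%N -> n%:R^-1 * (a n - c) <= L].
Proof.
pose S := [set ratio n.+1 | n in [set: nat]].
have S0 : lbound S 0 by move=> _ [n _ <-]; rewrite mulr_ge0// invr_ge0.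
have hS : has_inf S by split; [exists (ratio 1), 0%N|exists 0].
pose L := inf S.
have Lle n : (0 < n)%N -> L <= ratio n.
  by case: n => // n _; apply: ge_inf; [exists 0|exists n].
have cv : ratio n @[n --> \oo] --> L.
  apply/cvgrPdist_le => e e0.
  have e2 : 0 < e / 2 by rewrite divr_gt0.
  have [_ [m _ <-] hm] := inf_adherent e2 hS.
  rewrite -/L in hm.
  pose B := a 0%N + \sum_(r < m.+1) a r.
  have B0 : 0 <= B by rewrite addr_ge0// sumr_ge0.
  near=> n.
  have n0 : 0 < n%:R :> R by rewrite ltr0n; near: n; exact: nbhs_infty_gt.
  have nB : B / (e / 2) <= n%:R.
    near: n; exact: nbhs_infty_ger.
  rewrite ler0_norm; last by rewrite subr_le0 Lle// -(ltr0n R).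
  rewrite opprB lerBlDl.
  have an : a n <= n%:R * ratio m.+1 + B.
    rewrite {1}(divn_eq n m.+1); apply: le_trans (a_sub _ _) _.
    have h1 := subadd_muln (n %/ m.+1) m.+1.
    have h2 : a (n %% m.+1) <= \sum_(r < m.+1) a r.
      have lt := ltn_pmod n (ltn0Sn m).
      by rewrite (bigD1 (Ordinal lt))//= lerDl sumr_ge0.
    have h3 : (n %/ m.+1)%:R * a m.+1 <= n%:R * ratio m.+1.
      rewrite /ratio mulrA ler_wpM2r// ler_pdivlMr// -natrM ler_nat.
      exact: leq_divM.
    rewrite /B; lra.
  rewrite /ratio mulrC ler_pdivrMr//.
  apply: le_trans an _.
  have h4 : n%:R * ratio m.+1 <= n%:R * (L + e / 2) by rewrite ler_pM2l// ltW.
  have h5 : B <= n%:R * (e / 2) by rewrite -ler_pdivrMr// divr_gt0.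
  lra.
exists L; split => //.
  by apply: lb_le_inf; [exists (ratio 1), 0%N|].
move=> c sup n n0.
have n0' : 0 < n%:R :> R by rewrite ltr0n.
have h q : q.+1%:R * (a n - c) <= a (q.+1 * n)%N.
  elim: q => [|q IH].
    (* [0 <= c] follows from near-superadditivity at [n = m = 0]. *)
    rewrite mul1n mul1r lerBlDr lerDl.
    by have := sup 0%N 0%N; rewrite addn0; have := a_sub 0%N 0%N; have := a_ge0 0%N; lra.
  by have := sup n (q.+1 * n)%N; rewrite -mulSn; move: IH; rewrite -[q.+2%:R]natr1; lra.
have cv2 : ratio (q.+1 * n)%N @[q --> \oo] --> L.
  apply: (cvg_comp _ _ _ cv); apply/cvgnyPge => A; near=> q.
  rewrite mulSn; apply: leq_trans (_ : q <= _)%N.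
    by near: q; exact: nbhs_infty_ge.
  by rewrite (leq_trans (leq_pmulr q n0))// leq_addl.
rewrite -(cvg_lim _ cv2)//; apply: limr_ge; first by apply/cvg_ex; exists L.
near=> q; rewrite /ratio natrM invfM -mulrA [leRHS]mulrCA ler_pM2l ?invr_gt0//.
by rewrite ler_pdivlMl ?ltr0n.
Unshelve. all: by end_near. Qed.

End fekete.

Section translations.
Variables (X : topologicalGroupType) (t : X).
Implicit Types (x y : X).

Lemma translation_iterS n x : translation_iter t (n + 1) x = (t * translation_iter t n x)%g.
Proof.
case: n => [n|[|n]].
- by have -> : n%:Z + 1 = Posz n.+1 by lia.
- have -> : Negz 0 + 1 = Posz 0 by lia.
  by rewrite /= /translation mulVKg.
- have -> : Negz n.+1 + 1 = Negz n by lia.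
  by rewrite /= /translation mulVKg.
Qed.

Lemma translation_iterD n m x :
  translation_iter t (n + m) x = translation_iter t n (translation_iter t m x).
Proof.
have pos (k : nat) l : translation_iter t (k%:Z + l) x = iter k (translation t) (translation_iter t l x).
  elim: k => [|k IH]; first by rewrite add0r.
  have -> : k.+1%:Z + l = k%:Z + l + 1 by lia.
  by rewrite translation_iterS IH.
case: n => n; first exact: pos.
have := pos n.+1 (Negz n + m).
have -> : n.+1%:Z + (Negz n + m) = m by lia.
move=> ->.
have inv k y : iter k (translation t^-1%g) (iter k (translation t) y) = y.
  by elim: k => // k IH; rewrite iterSr iterS {2 3}/translation mulKg.
by rewrite [RHS]/= -!iterS inv.
Qed.

Lemma mulg_left_continuous (s : X) : continuous (fun x : X => (s * x)%g).
Proof.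
move=> x; apply: (@cvg_comp _ _ _ (fun y => (s, y)) (fun p : X * X => (p.1 * p.2)%g)
  (nbhs x) (nbhs (s, x))); last exact: (@mulg_continuous X (s, x)).
by apply: cvg_pair; [exact: cvg_cst|exact: cvg_id].
Qed.

Lemma translation_iter_continuous n : continuous (translation_iter t n).
Proof.
have h (s : X) k : continuous (iter k (translation s)).
  elim: k => [|k IH] x; first exact: cvg_id.
  by apply: (@continuous_comp _ _ _ (iter k (translation s)) (translation s));
    [exact: IH|exact: mulg_left_continuous].
by case: n => n; exact: h.
Qed.

Lemma pot_shift (R : realType) (v : X -> R) x E (m k : int) :
  pot t v (translation_iter t m x) E k = pot t v x E (m + k).
Proof. by rewrite /pot [m + k]addrC translation_iterD. Qed.

End translations.

Section tm_perturbation.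
Variable R : realType.
Implicit Types (w : int -> R).

Lemma tm_lip w w' K d i n : 0 <= K -> 0 <= d -> (forall k, `|w k| <= K) ->
  (forall k, `|w' k| <= K) -> (forall k, `|w k - w' k| <= d) ->
  nrm (tm w i n - tm w' i n) <= 4 * (n%:R * (K + 2) ^+ n * d).
Proof.
move=> K0 d0 wK w'K ww'.
have P1 m : 1 <= (K + 2) ^+ m by apply: exprn_ege1; lra.
suff h j k : `|(tm w i n - tm w' i n) j k| <= n%:R * (K + 2) ^+ n * d.
  by rewrite /nrm; move: (h ord0 ord0) (h ord0 (Ordinal (isT : (1 < 2)%N)))
    (h (Ordinal (isT : (1 < 2)%N)) ord0)
    (h (Ordinal (isT : (1 < 2)%N)) (Ordinal (isT : (1 < 2)%N))); lra.
elim: n j k => [|n IH] j k.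
  by rewrite /= subrr mxE normr0 !mul0r.
have bd := @tm_bound _ w' K i n (fun k _ => w'K _) K0.
have b0 := IH; have {P1} P := P1 n; have wn := wK (i + n%:Z).
have w'n := w'K (i + n%:Z); have wwn := ww' (i + n%:Z).
have [e1 e2 e3 e4] := Smat_mul (w (i + n%:Z)) (tm w i n).
have [f1 f2 f3 f4] := Smat_mul (w' (i + n%:Z)) (tm w' i n).
rewrite [tm w i n.+1]/= [tm w' i n.+1]/=.
move: (tm w i n) (tm w' i n) (w (i + n%:Z)) (w' (i + n%:Z)) wn w'n wwn bd b0 e1 e2 e3 e4 f1 f2 f3 f4.
move=> A A' a a' aK a'K aa bd IHA e1 e2 e3 e4 f1 f2 f3 f4.
have D0 : 0 <= n%:R * (K + 2) ^+ n * d by rewrite !mulr_ge0//; lra.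
have next : n.+1%:R * (K + 2) ^+ n.+1 * d =
    (K + 2) * (n%:R * (K + 2) ^+ n * d) + (K + 2) * ((K + 2) ^+ n * d).
  by rewrite -natr1 exprS; ring.
have Pd : 0 <= (K + 2) ^+ n * d by rewrite mulr_ge0//; lra.
have small x : `|x| <= n%:R * (K + 2) ^+ n * d -> `|x| <= n.+1%:R * (K + 2) ^+ n.+1 * d.
  by move=> h; rewrite next; nra.
have step p p' q q' : `|p - p'| <= n%:R * (K + 2) ^+ n * d -> `|p'| <= (K + 2) ^+ n ->
    `|q - q'| <= n%:R * (K + 2) ^+ n * d ->
    `|a * p - q - (a' * p' - q')| <= n.+1%:R * (K + 2) ^+ n.+1 * d.
  move=> hp hp' hq.
  have -> : a * p - q - (a' * p' - q') = a * (p - p') + (a - a') * p' - (q - q') by ring.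
  apply: le_trans (ler_normB _ _) _; have := ler_normD (a * (p - p')) ((a - a') * p').
  rewrite !normrM next.
  have h1 : `|a| * `|p - p'| <= K * (n%:R * (K + 2) ^+ n * d) by rewrite ler_pM.
  have h2 : `|a - a'| * `|p'| <= d * (K + 2) ^+ n by rewrite ler_pM.
  have h3 := mulr_ge0 K0 Pd.
  move: h1 h2 h3 hq D0 Pd; set D := n%:R * _ * d; set P' := (K + 2) ^+ n.
  by move=> *; nra.
have IHA' j' k' : `|A j' k' - A' j' k'| <= n%:R * (K + 2) ^+ n * d.
  by have := IHA j' k'; rewrite !mxE.
rewrite [X in `|X|]mxE [(- (_ *m _)) _ _]mxE.
have [->|->] := ord2P j; have [->|->] := ord2P k; rewrite ?e1 ?e2 ?e3 ?e4 ?f1 ?f2 ?f3 ?f4.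
- by apply: step.
- by apply: step.
- exact: small.
- exact: small.
Qed.

Lemma tm_continuous (T : topologicalType) (w : T -> int -> R) i n j k :
  (forall l, continuous (fun p => w p l)) -> continuous (fun p => tm (w p) i n j k).
Proof.
move=> cw; elim: n j k => [|n IH] j k; first by move=> x; exact: cvg_cst.
pose i1 : 'I_2 := Ordinal (isT : (1 < 2)%N).
have S p := Smat_mul (w p (i + n%:Z)) (tm (w p) i n).
have [->|->] := ord2P j; have [->|->] := ord2P k.
- rewrite (_ : (fun p => _) = (fun p => w p (i + n%:Z) * tm (w p) i n ord0 ord0 -
      tm (w p) i n i1 ord0)); last by apply/funext => p; have [? ? ? ?] := S p.
  by move=> p; apply: cvgB; [apply: cvgM; [exact: cw|exact: IH]|exact: IH].
- rewrite (_ : (fun p => _) = (fun p => w p (i + n%:Z) * tm (w p) i n ord0 i1 -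
      tm (w p) i n i1 i1)); last by apply/funext => p; have [? ? ? ?] := S p.
  by move=> p; apply: cvgB; [apply: cvgM; [exact: cw|exact: IH]|exact: IH].
- rewrite (_ : (fun p => _) = (fun p => tm (w p) i n ord0 ord0)); first exact: IH.
  by apply/funext => p; have [? ? ? ?] := S p.
- rewrite (_ : (fun p => _) = (fun p => tm (w p) i n ord0 i1)); first exact: IH.
  by apply/funext => p; have [? ? ? ?] := S p.
Qed.

End tm_perturbation.

Section lyapunov.
Variables (R : realType) (X : topologicalGroupType) (t : X).
Variable mu : probability (borel X) R.
Implicit Types (f g v : X -> R) (E : R).

Lemma continuous_bounded f : compact [set: X] -> continuous f ->
  exists2 M, 0 <= M & forall x, `|f x| <= M.
Proof.
move=> cX cf.
have cI : compact (f @` [set: X]).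
  by apply: continuous_compact => //; exact: continuous_subspaceT.
have [M [_ hM]] := compact_bounded cI.
exists (`|M| + 1); first by rewrite addr_ge0.
move=> x; apply: (hM (`|M| + 1)); last by exists x.
by rewrite (le_lt_trans (ler_norm _))// ltrDl.
Qed.

Lemma continuous_borel f : continuous f -> measurable_fun [set: borel X] (f : borel X -> R).
Proof.
move=> /continuousP cf.
apply: (measurability _ (measurable_realfun.RGenOpens.measurableE R)).
move=> _ [_ [a [b ->] <-]]; rewrite setTI; apply: sub_sigma_algebra.
by apply: cf; exact: interval_open.
Qed.

Lemma continuous_integrable f : compact [set: X] -> continuous f ->
  mu.-integrable [set: borel X] (EFin \o f).
Proof.
move=> cX cf; apply: measurable_bounded_integrable => //; last 2 first.
- exact: continuous_borel.
- have [M M0 hM] := continuous_bounded cX cf.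
  exists M; split; first exact: num_real.
  by move=> y yM x _; apply: le_trans (hM x) _; exact: ltW.
by apply: le_lt_trans (probability_le1 mu measurableT) _; rewrite ltry.
Qed.

Definition integral_of f : R := \int[mu]_(x in [set: borel X]) f x.

Lemma integral_of_shift f (s : X) : haar mu -> compact [set: X] -> continuous f ->
  integral_of (fun x => f (s * x)%g) = integral_of f.
Proof.
move=> hmu cX cf; congr fine.
have mphi : measurable_fun [set: borel X] (fun x : borel X => (s * x : borel X)%g).
  apply: (@measurability _ _ _ (borel X) _ _ (@open (pointed_group X)) erefl).
  move=> _ [A oA <-]; rewrite setTI; apply: sub_sigma_algebra.
  by have /continuousP := @mulg_left_continuous X s; apply.
have cfs : continuous (fun x => f (s * x)%g).
  by move=> x; apply: (@continuous_comp _ _ _ (fun x : X => (s * x)%g) f);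
    [exact: mulg_left_continuous|exact: cf].
have := @integral_pushforward _ _ (borel X) (borel X) R
  (fun x : borel X => (s * x : borel X)%g) mphi mu setT (EFin \o f) _ _ (measurableT).
have /integrableP[mEf _] := continuous_integrable cX cf.
move=> /(_ mEf (continuous_integrable cX cfs)).
rewrite preimage_setT /= => <-.
(* The preimage of [A] under translation by [s] is its image under translation by [s^-1], the form
   in which [haar] is stated. *)
apply: eq_measure_integral => A mA _; rewrite -[RHS](hmu (s^-1)%g)// /pushforward.
congr (mu _); apply/seteqP; split=> [x /= Ax|x [y Ay <-]] /=.
  by exists (s * x)%g => //; rewrite /translation mulKg.
by rewrite /translation mulVKg.
Qed.

Lemma integral_of_cst c : integral_of (fun=> c) = c.
Proof.
rewrite /integral_of Rintegral_cst// (_ : fine _ = 1) ?mulr1//.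
by have /(congr1 fine) := @probability_setT _ _ _ mu.
Qed.

Lemma integral_ofD f g : compact [set: X] -> continuous f -> continuous g ->
  integral_of (fun x => f x + g x) = integral_of f + integral_of g.
Proof. by move=> cX cf cg; apply: RintegralD => //; exact: continuous_integrable. Qed.

Lemma integral_of_le f g : compact [set: X] -> continuous f -> continuous g ->
  (forall x, f x <= g x) -> integral_of f <= integral_of g.
Proof.
move=> cX cf cg fg; apply: le_Rintegral => //; exact: continuous_integrable.
Qed.

Lemma integral_of_ge0 f : (forall x, 0 <= f x) -> 0 <= integral_of f.
Proof. by move=> f0; apply: Rintegral_ge0 => x _; exact: f0. Qed.

Definition growth v E n (x : X) : R := ln (opnorm (transfer t v E n x)).

Lemma transferE v E n x : transfer t v E n x = tm (fun k => - pot t v x E k) 0 n.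
Proof.
elim: n => // n IH; rewrite /= IH; congr (_ *m _).
by rewrite /Smat /pot opprB.
Qed.

Lemma tm_shift v E i n x :
  tm (fun k => - pot t v x E k) i n = transfer t v E n (translation_iter t i x).
Proof.
by rewrite transferE; apply: tm_eq => k _; rewrite pot_shift add0r.
Qed.

Lemma growth_ge0 v E n x : 0 <= growth v E n x.
Proof. by apply: ln_ge0; apply: opnorm_ge1; rewrite transferE det_tm. Qed.

Lemma growthD v E m n x :
  growth v E (m + n) x <= growth v E m x + growth v E n (translation_iter t m x).
Proof.
have d k y : 0 < opnorm (transfer t v E k y).
  by apply: lt_le_trans (ltr01) _; apply: opnorm_ge1; rewrite transferE det_tm.
rewrite /growth -lnM ?posrE// ler_ln ?posrE ?mulr_gt0//.
rewrite transferE tm_add tm_shift add0r -transferE mulrC.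
exact: opnormM.
Qed.

Lemma tm_entry_continuous v E i n j k : continuous v ->
  continuous (fun x => tm (fun k => - pot t v x E k) i n j k).
Proof.
move=> cv; apply: tm_continuous => l x; apply: cvgN; apply: cvgB; last exact: cvg_cst.
by apply: (@continuous_comp _ _ _ (translation_iter t l) v);
  [exact: translation_iter_continuous|exact: cv].
Qed.

Lemma growth_continuous v E n : continuous v -> continuous (growth v E n).
Proof.
move=> cv x; apply/cvgrPdist_le => e e0.
have c j k := @tm_entry_continuous v E 0 n j k cv x.
have e4 : 0 < e / 4 by rewrite divr_gt0.
pose i1 : 'I_2 := Ordinal (isT : (1 < 2)%N).
pose small j k y := `|tm (fun k => - pot t v x E k) 0 n j k -
    tm (fun k => - pot t v y E k) 0 n j k| <= e / 4.
have near j k : \forall y \near x, small j k y by move/cvgrPdist_le : (c j k); apply.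
near=> y.
have [h00 h01 h10 h11] : [/\ small ord0 ord0 y, small ord0 i1 y, small i1 ord0 y & small i1 i1 y].
  by split; near: y; exact: near.
have bd : nrm (transfer t v E n x - transfer t v E n y) <= e.
  by move: h00 h01 h10 h11; rewrite /nrm !mxE !transferE /small; lra.
have dx z : \det (transfer t v E n z) = 1 by rewrite transferE det_tm.
have h1 := ln_opnorm_lip (dx x) (dx y); have h2 := ln_opnorm_lip (dx y) (dx x).
have sym : nrm (transfer t v E n y - transfer t v E n x) =
    nrm (transfer t v E n x - transfer t v E n y).
  by rewrite /nrm !mxE !(distrC (transfer t v E n y _ _)).
rewrite sym in h2; rewrite /growth ler_norml lerNl opprB !lerBlDl.
by rewrite (le_trans h2)// ?(le_trans h1)// lerD2l.
Unshelve. all: by end_near. Qed.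

Definition logint v E n : R := integral_of (growth v E n).

Lemma logint_le v E n c : compact [set: X] -> continuous v ->
  (forall x, growth v E n x <= c) -> logint v E n <= c.
Proof.
move=> cX cv h; rewrite -[c]integral_of_cst; apply: integral_of_le => //.
  exact: growth_continuous.
by move=> x; exact: cvg_cst.
Qed.

Lemma logint_ge0 v E n : 0 <= logint v E n.
Proof. by apply: integral_of_ge0 => x; exact: growth_ge0. Qed.

Lemma growth_shift_continuous v E n (m : nat) : continuous v ->
  continuous (fun x => growth v E n (translation_iter t m x)).
Proof.
move=> cv x; apply: (@continuous_comp _ _ _ (translation_iter t m) (growth v E n)).
  exact: translation_iter_continuous.
exact: growth_continuous.
Qed.

Lemma logint_shift v E n (m : nat) : haar mu -> compact [set: X] -> continuous v ->
  integral_of (fun x => growth v E n (translation_iter t m x)) = logint v E n.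
Proof.
move=> hmu cX cv; elim: m => [|m IH]; first by [].
rewrite -[RHS]IH -[RHS](@integral_of_shift _ t hmu cX (@growth_shift_continuous v E n m cv)).
congr integral_of; apply/funext => x.
by rewrite [translation_iter t m.+1 x]/translation_iter iterSr.
Qed.

Lemma logint_sub v E n m : haar mu -> compact [set: X] -> continuous v ->
  logint v E (n + m) <= logint v E n + logint v E m.
Proof.
move=> hmu cX cv.
have c1 := @growth_continuous v E n cv; have c2 := @growth_shift_continuous v E m n cv.
rewrite -(@logint_shift v E m n hmu cX cv) -(integral_ofD cX c1 c2).
apply: integral_of_le cX (@growth_continuous v E (n + m) cv) _ _; last exact: growthD.
by move=> x; apply: cvgD; [exact: c1|exact: c2].
Qed.

Lemma logint_super v E n m c : haar mu -> compact [set: X] -> continuous v ->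
  (forall x, growth v E n x + growth v E m (translation_iter t n x) <= growth v E (n + m) x + c) ->
  logint v E n + logint v E m - c <= logint v E (n + m).
Proof.
move=> hmu cX cv h.
have c1 := @growth_continuous v E n cv; have c2 := @growth_shift_continuous v E m n cv.
have c3 := @growth_continuous v E (n + m) cv.
have c4 : continuous (fun _ : X => c) by move=> x; exact: cvg_cst.
have e0 := @logint_shift v E m n hmu cX cv.
have e4 : integral_of (fun x => growth v E n x + growth v E m (translation_iter t n x)) <=
    integral_of (fun x => growth v E (n + m) x + c).
  apply: integral_of_le cX _ _ h; first by move=> x; apply: cvgD; [exact: c1|exact: c2].
  by move=> x; apply: cvgD; [exact: c3|exact: c4].
rewrite (integral_ofD cX c1 c2) (integral_ofD cX c3 c4) integral_of_cst e0 in e4.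
by rewrite lerBlDr; exact: e4.
Qed.

Lemma lyapunovP v E : haar mu -> compact [set: X] -> continuous v ->
  [/\ 0 <= lyapunov t mu v E,
    forall n, (0 < n)%N -> lyapunov t mu v E <= n%:R^-1 * logint v E n &
    forall c, (forall n m x, growth v E n x + growth v E m (translation_iter t n x) <=
        growth v E (n + m) x + c) ->
      forall n, (0 < n)%N -> n%:R^-1 * (logint v E n - c) <= lyapunov t mu v E].
Proof.
move=> hmu cX cv.
have [L [cvL L0 Lle Lge]] := fekete (logint_ge0 v E)
  (fun n m => logint_sub E n m hmu cX cv).
have -> : lyapunov t mu v E = L by exact: (cvg_lim (@Rhausdorff R) cvL).
split => // c h; apply: Lge => n m; apply: logint_super => // x; exact: h.
Qed.

Lemma lyapunov_adherent v E e : haar mu -> compact [set: X] -> continuous v -> 0 < e ->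
  exists2 n, (0 < n)%N & n%:R^-1 * logint v E n < lyapunov t mu v E + e.
Proof.
move=> hmu cX cv e0.
have [L [cvL _ _ _]] := fekete (logint_ge0 v E) (fun n m => logint_sub E n m hmu cX cv).
have LE : lyapunov t mu v E = L by exact: (cvg_lim (@Rhausdorff R) cvL).
move/cvgrPdist_lt/(_ _ e0): cvL => -[n _ /(_ n.+1 (leqnSn n)) h]; exists n.+1 => //.
by rewrite LE -ltrBlDl; apply: le_lt_trans h; rewrite distrC ler_norm.
Qed.

Lemma logint_lip v E E' n K : compact [set: X] -> continuous v -> 0 <= K ->
  (forall x, `|v x - E| <= K) -> (forall x, `|v x - E'| <= K) ->
  logint v E n <= logint v E' n + 4 * (n%:R * (K + 2) ^+ n * `|E - E'|).
Proof.
move=> cX cv K0 h h'; set c := 4 * _.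
have c1 := @growth_continuous v E n cv; have c2 := @growth_continuous v E' n cv.
have c4 : continuous (fun _ : X => c) by move=> x; exact: cvg_cst.
rewrite -[X in _ + X]integral_of_cst -(integral_ofD cX c2 c4).
apply: integral_of_le => //.
  by move=> x; apply: cvgD; [exact: c2|exact: c4].
move=> x; apply: le_trans (ln_opnorm_lip (B := transfer t v E' n x) _ _) _.
- by rewrite transferE det_tm.
- by rewrite transferE det_tm.
rewrite lerD2l !transferE; apply: tm_lip => // k.
- by rewrite normrN; exact: h.
- by rewrite normrN; exact: h'.
- by rewrite /pot le_eqVlt; apply/orP; left; apply/eqP; congr (`|_|); ring.
Qed.

End lyapunov.

(** * Clocks on a Cantor group *)

Lemma eucl_div (k : int) (m : nat) : (0 < m)%N ->
  exists (i : nat) (q : int), (i < m)%N /\ k = q * m%:Z + i%:Z.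
Proof.
move=> m0; exists (absz (k %% m%:Z)%Z), (k %/ m%:Z)%Z.
have := ltz_pmod k (_ : 0 < m%:Z); have := modz_ge0 k (_ : m%:Z != 0).
have := divz_eq k m%:Z; lia.
Qed.

Section clocks.
Variables (X : topologicalGroupType) (t : X).
Implicit Types (x y h : X).

Lemma cantor_groupP : cantor_group X ->
  [/\ compact [set: X], hausdorff_space X, zero_dimensional X &
      forall x, ~ open [set x]].
Proof.
move=> [phi [psi [phiK psiK cphi cpsi]]].
have inj : injective phi by exact: can_inj phiK.
split.
- have -> : [set: X] = psi @` [set: cantor_space].
    by apply/seteqP; split => // x _; exists (phi x).
  apply: continuous_compact; first exact: continuous_subspaceT.
  exact: cantor_space_compact.
- rewrite open_hausdorff => x y xy.
  have pxy : phi x != phi y by apply: contra xy => /eqP/inj ->.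
  have := cantor_space_hausdorff; rewrite open_hausdorff => /(_ _ _ pxy).
  move=> [[A B] /= [xA yB] [oA oB /eqP AB]].
  exists (phi @^-1` A, phi @^-1` B) => /=; first by move: xA yB; rewrite !inE.
  split; [exact: (iffLR (continuousP _) cphi)|exact: (iffLR (continuousP _) cphi)|].
  by rewrite -preimage_setI AB preimage_set0.
- move=> x y xy; have /cantor_zero_dimensional[U [[oU cU] Ux Uy]] : phi x != phi y.
    by apply: contra xy => /eqP/inj ->.
  exists (phi @^-1` U); split => //; split.
    exact: (iffLR (continuousP _) cphi).
  by apply: preimage_closed => // z _; exact: cphi.
- move=> x ox; have /perfectTP/(_ (phi x)) := cantor_perfect; apply.
  have -> : [set phi x] = psi @^-1` [set x].
    by apply/seteqP; split => z /= => [->|<-]; rewrite ?phiK ?psiK.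
  exact: (iffLR (continuousP _) cpsi).
Qed.

Lemma near_mulg x (U : set X) : open U -> U x ->
  \forall x' \near x & h \near (1%g : X), U (x' * h)%g.
Proof.
move=> oU Ux; have : nbhs (x * 1 : X)%g U by rewrite mulg1; exact: open_nbhs_nbhs.
move=> /(@mulg_continuous X (x, 1%g)) [[A B] /= [nA nB] AB].
by exists (A, B) => // -[a b] [/= Aa Bb]; exact: (AB (a, b)).
Qed.

Lemma near_right_uniform (R : realType) (v : X -> R) e : compact [set: X] ->
  continuous v -> 0 < e ->
  \forall h \near (1%g : X), forall x, `|v (x * h)%g - v x| < e.
Proof.
move=> /compact_near_coveringP cX cv e0.
have e2 : 0 < e / 2 by rewrite divr_gt0.
have := cX X (nbhs (1%g : X)) (fun h x => `|v (x * h)%g - v x| < e) _.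
move=> H; near=> h => x; have : [set: X] x by [].
move: x; near: h; apply: H => x _.
have oB : open (v @^-1` (ball (v x) (e / 2))).
  by apply: (iffLR (continuousP _) cv); exact: ball_open.
have h1 := near_mulg oB (ballxx _ e2 : (v @^-1` (ball (v x) (e / 2))) x).
have h2 : \forall x' \near x & h \near (1%g : X), (v @^-1` (ball (v x) (e / 2))) x'.
  exists (v @^-1` (ball (v x) (e / 2)), setT) => /=.
    by split; [apply: open_nbhs_nbhs; split => //; exact: ballxx|exact: filterT].
  by move=> [a b] [].
apply: filterS2 h1 h2 => -[x' h] /=; rewrite /ball /= => h1 h2.
have := ler_distD (v x) (v (x' * h)%g) (v x'); rewrite [`|v (x' * h)%g - v x|]distrC.
lra.
Unshelve. all: by end_near. Qed.

(** The source of small open subgroups: it is always a subgroup, lies in [U] when [U] contains 1,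
    and is open for [U] clopen and [X] compact. It acts on the right so that left translation by [t]
    permutes its cosets [x H]. *)
Definition stabilizer (U : set X) : set X := [set h | forall x, U x <-> U (x * h)%g].

Lemma stabilizer1 U : stabilizer U 1%g.
Proof. by move=> x; rewrite mulg1. Qed.

Lemma stabilizerM U x y : stabilizer U x -> stabilizer U y -> stabilizer U (x * y)%g.
Proof. by move=> Hx Hy z; rewrite mulgA; rewrite (Hx z) (Hy (z * x)%g). Qed.

Lemma stabilizerV U x : stabilizer U x -> stabilizer U (x^-1)%g.
Proof. by move=> Hx z; rewrite (Hx (z * x^-1)%g) mulgVK. Qed.

Lemma stabilizer_sub U x : U 1%g -> stabilizer U x -> U x.
Proof. by move=> U1 /(_ 1%g)[/(_ U1)]; rewrite mul1g. Qed.

(** Near a given point, [x] and [x * h] lie on the same side of the clopen set for [h] near 1;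
    compactness makes the neighbourhood of 1 uniform. *)
Lemma stabilizer_nbhs1 U : compact [set: X] -> clopen U -> nbhs (1%g : X) (stabilizer U).
Proof.
move=> /compact_near_coveringP cX [oU cU].
have := cX X (nbhs (1%g : X)) (fun h x => U x <-> U (x * h)%g) _.
move=> H; near=> h => x; have : [set: X] x by [].
move: x; near: h; apply: H => x _.
have near V : open V -> V x ->
    \forall x' \near x & h \near (1%g : X), V x' /\ V (x' * h)%g.
  move=> oV Vx; have h1 := near_mulg oV Vx.
  have h2 : \forall x' \near x & h \near (1%g : X), V x'.
    exists (V, setT) => /=; first by split; [exact: open_nbhs_nbhs|exact: filterT].
    by move=> [a b] [].
  by apply: filterS2 h1 h2 => -[].
have [Ux|nUx] := pselect (U x).
  by apply: filterS (near U oU Ux) => -[x' h] /= [].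
by apply: filterS (near _ (closed_openC cU) nUx) => -[x' h] /= [].
Unshelve. all: by end_near. Qed.

Lemma stabilizer_open U x : compact [set: X] -> clopen U ->
  open [set y | stabilizer U (x * y)%g].
Proof.
move=> cX cU; rewrite openE => y /= Hy.
have n1 := stabilizer_nbhs1 cX cU.
have : nbhs (y^-1 * y : X)%g (stabilizer U) by rewrite mulVg.
move=> /(@mulg_left_continuous X (y^-1)%g y) hn.
apply: (filterS _ (hn : nbhs y [set z | stabilizer U (y^-1 * z)%g])) => z /= Hz.
by rewrite -(mulVKg y z) mulgA; exact: stabilizerM.
Qed.

Definition gpow (n : int) : X := translation_iter t n 1%g.

Lemma translation_iterE n x : translation_iter t n x = (gpow n * x)%g.
Proof.
have h (s : X) k : iter k (translation s) x = (iter k (translation s) 1 * x)%g.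
  by elim: k => [|k IH]; rewrite ?mul1g// !iterS IH /translation mulgA.
by case: n => n; exact: h.
Qed.

Lemma gpowD n m : gpow (n + m) = (gpow n * gpow m)%g.
Proof. by rewrite /gpow translation_iterD translation_iterE. Qed.

Lemma gpow0 : gpow 0 = 1%g. Proof. by []. Qed.

Lemma gpowN n : gpow (- n) = (gpow n)^-1%g.
Proof.
by rewrite -[LHS](mulKg (gpow n)) -gpowD subrr gpow0 mulg1.
Qed.

Lemma gpowS n : gpow (n + 1) = (t * gpow n)%g.
Proof. by rewrite /gpow translation_iterS. Qed.

Lemma gpow_muln (H : set X) (m : nat) (j : int) : H 1%g ->
  (forall x y, H x -> H y -> H (x * y)%g) -> (forall x, H x -> H (x^-1)%g) ->
  H (gpow m%:Z) -> H (gpow (j * m%:Z)).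
Proof.
move=> H1 HM HV Hm; have pos (k : nat) : H (gpow (k%:Z * m%:Z)).
  elim: k => [|k IH]; first by rewrite mul0r.
  have -> : k.+1%:Z * m%:Z = k%:Z * m%:Z + m%:Z by lia.
  by rewrite gpowD; exact: HM.
case: j => k; first exact: pos.
have -> : Negz k * m%:Z = - (k.+1%:Z * m%:Z) by lia.
by rewrite gpowN; exact: HV.
Qed.

(** Otherwise the orbit of 1 is finite, hence closed, hence all of [X] by minimality, and the points
    of a finite Hausdorff space are isolated. *)
Lemma gpow_neq1 (n : nat) : hausdorff_space X -> (forall x, ~ open [set x]) ->
  minimal_translation t -> (0 < n)%N -> gpow n%:Z != 1%g.
Proof.
move=> hX noiso mint n0; apply/eqP => pn.
pose O : set X := [set gpow k%:Z | k in `I_n].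
have finO : finite_set O by apply: finite_image; exact: finite_II.
have fc (A : set X) : finite_set A -> closed A.
  by have /accessible_finite_set_closed h := hausdorff_accessible hX; exact: h.
have inO (k : int) : O (gpow k).
  have [i [q [im ->]]] := eucl_div k n0; exists i => //; rewrite gpowD.
  suff -> : gpow (q * n%:Z) = 1%g by rewrite mul1g.
  apply: (@gpow_muln [set 1%g] n) => //= [x y -> ->|x ->]; rewrite ?mul1g//.
  exact: invg1.
have allO x : O x.
  apply: contrapT => nOx; have [z [nOy [k _ kE]]] := mint 1%g _ (ex_intro _ x nOx)
    (closed_openC (fc _ finO)).
  by apply: nOy; rewrite -kE; exact: inO.
apply: (noiso 1%g); rewrite -[X in open X]setCK; apply: closed_openC; apply: fc.
exact: (sub_finite_set _ finO).
Qed.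

Definition clock (m : nat) (c : X -> nat) := [/\ c 1%g = 0%N,
  forall x, (c x < m)%N, forall x, c (t * x)%g = ((c x).+1 %% m)%N &
  forall k, open [set x | c x = k]].

(* The stabilizer H of a small clopen neighbourhood of 1 is an open subgroup; the
   clock records which of the cosets [t^i H], [i < m], contains the point. *)
Lemma clock_exists (R : realType) (v : X -> R) e (M : nat) : cantor_group X ->
  minimal_translation t -> continuous v -> 0 < e ->
  exists m c, [/\ (M <= m)%N, clock m c & forall x y, c x = c y -> `|v x - v y| < e].
Proof.
move=> /cantor_groupP[cX hX zX noiso] mint cv e0.
have fc (A : set X) : finite_set A -> closed A.
  by have /accessible_finite_set_closed h := hausdorff_accessible hX; exact: h.
(* Keeping [t, ..., t^M] out of the subgroup forces the period of the clock to be at least [M]. *)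
pose F : set X := [set gpow k.+1%:Z | k in `I_M].
have nF : nbhs (1%g : X) (~` F).
  apply: open_nbhs_nbhs; split.
    by apply: closed_openC; apply: fc; apply: finite_image; exact: finite_II.
  by move=> [k _ /eqP]; apply/negP; exact: gpow_neq1.
have [U [U1 cU] UW] := zero_dimensional_cvg hX zX cX (filterI (near_right_uniform cX cv e0) nF).
pose H := stabilizer U.
have H1 : H 1%g := stabilizer1 U.
have HM x y : H x -> H y -> H (x * y)%g by exact: stabilizerM.
have HV x : H x -> H (x^-1)%g by exact: stabilizerV.
have HW x : H x -> (forall z, `|v (z * x)%g - v z| < e) /\ ~ F x.
  by move=> /(stabilizer_sub U1)/UW.
have oH x : open [set y | H (x * y)%g] by exact: stabilizer_open.
(* If no power of [t] other than 1 were in [H], the open set [H] without 1 would miss the dense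
   orbit of 1, hence be empty, and 1 would be isolated. *)
have [n0 n0p Hn0] : exists2 n : nat, (0 < n)%N & H (gpow n%:Z).
  apply: contrapT => nex.
  have only0 k : H (gpow k) -> k = 0.
    case: k => [[|k]|k] Hk //; exfalso; apply: nex; exists k.+1 => //.
    have := HV _ Hk; rewrite -gpowN; congr H; congr gpow; lia.
  apply: (noiso 1%g); have oH1 : open (H `&` ~` [set 1%g]).
    apply: openI; last by apply: closed_openC; apply: fc; exact: finite_set1.
    have := oH 1%g; congr open; apply/seteqP; split => y /=; rewrite mul1g//.
  have -> : [set 1%g] = [set y | H (1 * y)%g].
    apply/seteqP; split => y /= => [->|]; rewrite mul1g// => Hy.
    apply: contrapT => y1; have [z [[Hz z1] [k _ kE]]] := mint 1%g _ (ex_intro _ y (conj Hy y1)) oH1.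
    by apply: z1; rewrite /= -kE (only0 k) // /gpow kE.
  exact: oH.
have exm : exists n, (0 < n)%N && `[< H (gpow n%:Z) >].
  by exists n0; rewrite n0p; apply/asboolP.
have [m /andP[m0 /asboolP Hm] min] := ex_minnP exm.
have minm (k : nat) : (0 < k)%N -> (k < m)%N -> ~ H (gpow k%:Z).
  move=> k0 km Hk; have := min k; rewrite k0 /= => /(_ (introT (asboolP _) Hk)).
  by rewrite leqNgt km.
have Mm : (M <= m)%N.
  rewrite leqNgt; apply/negP => mM; have [_] := HW _ Hm; apply.
  by exists m.-1; [exact: leq_ltn_trans (leq_pred m) mM|rewrite prednK].
have uniqi x (i j : nat) : (i < m)%N -> (j < m)%N -> H ((gpow i%:Z)^-1 * x)%g ->
    H ((gpow j%:Z)^-1 * x)%g -> i = j.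
  wlog ij : i j / (i <= j)%N.
    move=> W im jm Hi Hj; have /orP[ij|ji] := leq_total i j; first exact: W.
    by apply/esym; apply: W.
  move=> im jm Hi Hj; apply/eqP; rewrite eqn_leq ij /= leqNgt; apply/negP => lt.
  apply: (minm (j - i)%N); [by rewrite subn_gt0|by rewrite (leq_ltn_trans (leq_subr _ _))|].
  have := HM _ _ Hi (HV _ Hj); rewrite invgM invgK mulgA mulgK -gpowN -gpowD.
  by congr H; congr gpow; lia.
have exi x : exists i, (i < m)%N /\ H ((gpow i%:Z)^-1 * x)%g.
  have Hx : [set y | H (x^-1 * y)%g] x by rewrite /= mulVg.
  have [z [/= Hy [k _ kE]]] := mint 1%g _ (ex_intro _ x Hx) (oH (x^-1)%g).
  have [i [q [im kq]]] := eucl_div k m0; exists i; split=> //.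
  have := HV _ Hy; rewrite -kE -/(gpow k) invgM invgK => Hk.
  have := HM _ _ (gpow_muln q H1 HM HV Hm) Hk.
  congr H; rewrite -[iter i _ _]/(gpow i%:Z) mulgA -!gpowN -gpowD; congr (gpow _ * x)%g.
  by rewrite kq; ring.
have [c Hc] := choice exi.
have ceq x i : (i < m)%N -> H ((gpow i%:Z)^-1 * x)%g -> c x = i.
  by move=> im Hi; have [cm Hcx] := Hc x; exact: (uniqi x).
exists m, c; split => //.
  split.
  - by apply: ceq => //; rewrite mulg1; apply: HV.
  - by move=> x; have [] := Hc x.
  - move=> x; have [cm Hcx] := Hc x.
    have Hn : H ((gpow (c x).+1%:Z)^-1 * (t * x))%g.
      have -> : (c x).+1%:Z = (c x)%:Z + 1 by lia.
      by rewrite gpowS invgM mulgA mulgVK.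
    move: cm; rewrite leq_eqVlt => /orP[/eqP cm|cm].
      rewrite cm modnn; apply: ceq => //; rewrite cm in Hn.
      by have := HM _ _ Hm Hn; rewrite mulVKg gpow0 invg1 mul1g.
    by rewrite modn_small//; exact: ceq.
  - move=> k; have [km|mk] := ltnP k m.
      rewrite (_ : [set x | _] = [set x | H ((gpow k%:Z)^-1 * x)%g]); first exact: oH.
      apply/seteqP; split => x /= => [<-|/(ceq _ _ km)//].
      by have [] := Hc x.
    rewrite (_ : [set x | _] = set0); first exact: open0.
    apply/seteqP; split => x //= ck; have [] := Hc x; rewrite ck => km _.
    by move: km; rewrite ltnNge mk.
move=> x y cxy; have [_ Hx] := Hc x; have [_ Hy] := Hc y; rewrite -cxy in Hy.
have /HW[/(_ x) + _] := HM _ _ (HV _ Hx) Hy.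
by rewrite invgM invgK -mulgA !mulVKg distrC.
Qed.

End clocks.

(** * The approximating periodic potential *)

Section localization.
Variable R : realType.
Implicit Types (V W u : int -> R) (E : R).

(** For [x := r ^+ Z.+1], cutting leaves [2 * y + 2 * (3 * (2 + K ^+ 2) * (x + x))] with [y <= x],
    by [Hop_bounded] applied to the removed part. *)
Definition loc_const (K : R) : R := 2 + 12 * (2 + K ^+ 2).

Lemma cut_siteE (i0 c : int) (d : nat) :
  i0 + 1 + d%:Z + c * d.+1%:Z - i0 = (1 + c) * d.+1%:Z.
Proof. by lia. Qed.

(* Replacing [u] by 0 at the sites [i0 + c (d + 1)], in the middle of blocks where
   [u] is exponentially small, decouples the operator into copies of [cut_matrix]. *)
Lemma eigenvalue_nearby V K (i0 : int) (d n Z : nat) (e r : R) :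
  (forall k, V (k + d.+1%:Z) = V k) -> 0 <= K -> (0 < n)%N -> 0 < e ->
  0 <= r -> r ^+ Z.+1 < 1 / 8 ->
  exists2 s : seq R, size s = d & forall E W u y,
    (forall k, `|V k - E| <= K) -> (forall k, W (k + n%:Z) = W k) ->
    (forall c k : int, (absz k <= Z.+1 * n)%N -> V (i0 + c * d.+1%:Z + k) - E = W k) ->
    1 <= \tr (tm (fun k => - W k) 0 n) ^+ 2 ->
    4 * (1 + e) <= r * \tr (tm (fun k => - W k) 0 n) ^+ 2 ->
    sum_le (sq u) 1 -> (forall z, sum_le (sq u) z -> 1 <= z) ->
    sum_le (sq (Hop (fun k => V k - E) u)) y -> y <= r ^+ Z.+1 ->
    (1 + e^-1) * (three_term_const K n * ((n + n)%:R * y)) <= (1 - r) * r ^+ Z.+1 ->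
    exists2 c, c \in s & `|c - E| <= Num.sqrt (4 * loc_const K * r ^+ Z.+1).
Proof.
move=> perV K0 n0 e0 r0 r8.
have [s sd cut] := cut_resolvent (i0 + 1) perV.
exists s => // E W u y VK perW VW t1 tr u1 umin Hy yr yD.
set x := r ^+ Z.+1 in r8 yr yD *.
have x0 : 0 <= x by exact: exprn_ge0.
apply: contrapT => nc; set eta := Num.sqrt _ in nc.
have C1 : 0 < loc_const K by rewrite /loc_const; have := sqr_ge0 K; lra.
have eta0 : 0 <= eta by exact: sqrtr_ge0.
have eta2 : eta ^+ 2 = 4 * loc_const K * x.
  by rewrite sqr_sqrtr// mulr_ge0// mulr_ge0// ltW.
have gap c : c \in s -> eta <= `|c - E|.
  by move=> cs; rewrite leNgt; apply/negP => h; apply: nc; exists c => //; exact: ltW.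
have dec := block_decay K0 VK (ltn0Sn d) n0 perW VW e0 r0 t1 tr u1 Hy x0 yD.
rewrite -/x in dec.
pose at_cut k := (d.+1%:Z %| k - i0)%Z.
pose u' k := if at_cut k then 0 else u k.
pose ud k := if at_cut k then u k else 0.
have uE k : u k = u' k + ud k by rewrite /u' /ud; case: (at_cut k); rewrite ?add0r ?addr0.
have hd : sum_le (sq ud) (x + x).
  move=> L uL; rewrite (bigID at_cut) /= [X in _ + X]big1 ?addr0 => [|k]; last first.
    by rewrite /sq /ud => /negPf ->; rewrite expr0n.
  rewrite -big_filter.
  pose cs := [seq ((k - i0) %/ d.+1%:Z)%Z | k <- [seq k <- L | at_cut k]].
  have csE k : k \in [seq k <- L | at_cut k] -> k = i0 + ((k - i0) %/ d.+1%:Z)%Z * d.+1%:Z.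
    by rewrite mem_filter => /andP[/divzK dk _]; rewrite dk addrC subrK.
  have ucs : uniq cs.
    rewrite map_inj_in_uniq ?filter_uniq// => k k' /csE ke /csE ke' eq.
    by rewrite ke ke' eq.
  apply: le_trans (dec cs ucs); rewrite /cs big_map le_eqVlt; apply/orP; left; apply/eqP.
  rewrite big_seq [RHS]big_seq; apply: eq_bigr => k kL; rewrite -csE//.
  by move: kL; rewrite mem_filter /sq /ud => /andP[-> _].
have u'0 (c : int) : u' (i0 + 1 + d%:Z + c * d.+1%:Z) = 0.
  by rewrite /u' /at_cut cut_siteE dvdz_mull ?dvdzz.
have Hu' : sum_le (sq (Hop (fun k => V k - E) u')) (loc_const K * x).
  have h := sum_leD (sum_leZ (ler0n R 2) Hy) (sum_leZ (ler0n R 2) (Hop_bounded VK hd)).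
  apply: (sum_le_mono _ _ h) => [k|].
    have e1 : Hop (fun k => V k - E) u' k = Hop (fun k => V k - E) u k
        + - Hop (fun k => V k - E) ud k by rewrite /Hop !uE; ring.
    by rewrite {1}/sq e1; apply: le_trans (sqrD2 _ _) _; rewrite sqrrN.
  by rewrite /loc_const; have := sqr_ge0 K; nra.
have h' := cut E eta u' _ eta0 gap u'0 Hu'.
move: x0; rewrite le_eqVlt => /predU1P[x00|xp].
  move: tr t1; move: x00; rewrite /x => /esym/eqP; rewrite expf_eq0 /= => /eqP ->.
  rewrite mul0r; lra.
(* Without an eigenvalue within [eta] the cut sequence has squared norm at most [1 / 4], and the
   removed part at most [2 * x < 1 / 4]; this contradicts the norm 1 of [u]. *)
have quarter : sum_le (sq u') (1 / 4).
  have ei : 0 <= (eta ^+ 2)^-1 by rewrite invr_ge0 sqr_ge0.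
  have en : eta ^+ 2 != 0 by rewrite eta2 gt_eqF// mulr_gt0// mulr_gt0.
  apply: (sum_le_mono _ _ (sum_leZ ei h')) => [k|]; first by rewrite mulrA mulVf// mul1r.
  rewrite eta2 le_eqVlt; apply/orP; left; apply/eqP.
  by field; rewrite !gt_eqF.
have := umin _ (sum_le_mono _ (lexx _) (sum_leD (sum_leZ (ler0n R 2) quarter) (sum_leZ (ler0n R 2) hd))).
move=> /(_ (fun k => _)) h1.
have : 1 <= 2 * (1 / 4) + 2 * (x + x).
  by apply: h1 => k; rewrite {1}/sq uE; exact: sqrD2.
lra.
Qed.

(** The quadratic term in the binomial expansion of [(1 + h) ^+ Z.+1], with [s = (1 + h)^-1], beats
    the linear factor. *)
Lemma polynomial_geometric (s c : R) : 0 < s -> s < 1 -> 0 < c ->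
  exists Z0, forall Z, (Z0 <= Z)%N -> (Z%:R + 3) * s ^+ Z.+1 <= c.
Proof.
move=> s0 s1 c0; pose h := s^-1 - 1.
have h0 : 0 < h by rewrite subr_gt0 invf_gt1.
have sE : s = (1 + h)^-1 by rewrite /h addrC subrK invrK.
have bern n : 1 + n%:R * h + n%:R * (n%:R - 1) / 2 * h ^+ 2 <= (1 + h) ^+ n.
  elim: n => [|n IH]; first by rewrite expr0 !mul0r !addr0.
  have h1 : 0 <= 1 + h by lra.
  rewrite [leRHS]exprS; apply: le_trans (ler_wpM2l h1 IH).
  have n0 : 0 <= n%:R * (n%:R - 1) / 2 :> R.
    case: n {IH} => [|n]; first by rewrite !mul0r.
    by rewrite -natr1 addrK divr_ge0// mulr_ge0.
  have h3 : 0 <= n%:R * (n%:R - 1) / 2 * h ^+ 3 by rewrite mulr_ge0// exprn_ge0// ltW.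
  rewrite -natr1 -subr_ge0; apply: le_trans h3 _.
  by rewrite le_eqVlt; apply/orP; left; apply/eqP; field.
pose Z0 := (Num.truncn (8 / (c * h ^+ 2))).+1.
exists Z0 => Z ZZ.
have Zbig : 8 / (c * h ^+ 2) < Z%:R.
  by apply: lt_le_trans (truncnS_gt _) _; rewrite ler_nat.
have ch0 : 0 < c * h ^+ 2 by rewrite mulr_gt0// exprn_gt0.
have Zp : 1 <= Z%:R :> R by rewrite ler1n (leq_trans _ ZZ).
have h1 : 0 < 1 + h by lra.
rewrite sE exprVn ler_pdivrMr ?(exprn_gt0 _ h1)//.
have b := bern Z.+1; rewrite -natr1 addrK in b.
have k1 : (Z%:R + 1) * Z%:R / 2 * h ^+ 2 <= (1 + h) ^+ Z.+1.
  by apply: le_trans b; rewrite lerDr addr_ge0// mulr_ge0// ?ltW// addr_ge0.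
apply: le_trans (ler_wpM2l (ltW c0) k1).
move: Zbig; rewrite ltr_pdivrMr//; set a := Z%:R in Zp *; set g := h ^+ 2 => Zbig.
have -> : c * ((a + 1) * a / 2 * g) = (a + 1) / 2 * (a * (c * g)) by field.
have : (a + 1) / 2 * 8 <= (a + 1) / 2 * (a * (c * g)) by rewrite ler_wpM2l ?ltW//; lra.
lra.
Qed.

End localization.

(** * Finitely many gaps for all relevant energies and couplings *)

Section gap_family.
Variable R : realType.

Lemma positive_lower_bound (T : eqType) (g : T -> R) (s : seq T) :
  (forall x, 0 < g x) -> exists2 k, 0 < k & forall x, x \in s -> k <= g x.
Proof.
move=> g0; elim: s => [|a s [k k0 IH]]; first by exists 1.
exists (Num.min (g a) k); first by rewrite lt_min g0 k0.
by move=> x; rewrite inE ge_min => /orP[/eqP->|/IH ->]; rewrite ?lexx ?orbT.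
Qed.

(** A gap for [E - lam * b] is opened within [e * |lam|]; dividing by [lam] gives a perturbation of
    [b] within [e]. Half of the excess of the squared trace over 4 is kept as a margin, and [kap]
    bounds the margins of a finite subcover from below. *)
Lemma gap_family (b : int -> R) m e (K N : R) : (1 < m)%N ->
  (forall k, b (k + m%:Z) = b k) -> 0 < e -> 1 <= N ->
  exists (k : nat) (n : nat -> nat) (Q : nat -> int -> R) (kap : R), [/\ 0 < kap,
    forall j, (0 < n j)%N, forall j i, Q j (i + (n j)%:Z) = Q j i,
    forall j i, `|Q j i - b i| <= e &
    forall E lam : R, `|E| <= K -> N^-1 <= `|lam| <= N -> exists2 j, (j < k)%N &
      4 + kap <= \tr (tm (fun i => E - lam * Q j i) 0 (n j)) ^+ 2].
Proof.
move=> m1 per e0 N1.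
have N0 : 0 < N by apply: lt_le_trans N1.
have ex (p : R * R) : exists d : nat * (int -> R) * R, [/\ (0 < d.1.1)%N,
    forall i, d.1.2 (i + d.1.1%:Z) = d.1.2 i, forall i, `|d.1.2 i - b i| <= e, 0 < d.2 &
    p.2 != 0 -> 4 + d.2 < \tr (tm (fun i => p.1 - p.2 * d.1.2 i) 0 d.1.1) ^+ 2].
  have [p0|p0] := eqVneq p.2 0.
    (* Coupling 0 lies outside the compact set [A] below; the value here is a default. *)
    exists (m, b, 1); split => //=; first exact: ltnW.
    by move=> i; rewrite subrr normr0 ltW.
  have pp : 0 < e * `|p.2| by rewrite mulr_gt0// normr_gt0.
  have perw i : p.1 - p.2 * b (i + m%:Z) = p.1 - p.2 * b i by rewrite per.
  have [l [w [l0 wper wc wt]]] := single_gap m1 perw pp.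
  exists ((l * m)%N, fun i => (p.1 - w i) / p.2,
    (\tr (tm w 0 (l * m)) ^+ 2 - 4) / 2); split => /=.
  - by rewrite muln_gt0 l0 ltnW.
  - by move=> i; rewrite wper.
  - move=> i; have -> : (p.1 - w i) / p.2 - b i = - (w i - (p.1 - p.2 * b i)) / p.2.
      by field.
    by rewrite normf_div ler_pdivrMr ?normr_gt0// normrN.
  - by rewrite divr_gt0// subr_gt0.
  - move=> _; rewrite (_ : (fun i => _) = w); first by lra.
    by apply/funext => i; rewrite mulrC divfK// opprB addrC subrK.
have [F HF] := choice ex.
pose U (p : R * R) : set (R * R) := [set z | 4 + (F p).2 <
  \tr (tm (fun i => z.1 - z.2 * (F p).1.2 i) 0 (F p).1.1) ^+ 2].
have oU p : open (U p).
  apply: (@open_comp _ _ (fun z : R * R => \tr (tm (fun i => z.1 - z.2 * (F p).1.2 i) 0 (F p).1.1) ^+ 2)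
    [set y | 4 + (F p).2 < y]); last exact: open_gt.
  move=> z _.
  have ct j k : continuous (fun z : R * R => tm (fun i => z.1 - z.2 * (F p).1.2 i) 0 (F p).1.1 j k).
    apply: tm_continuous => l z'; apply: cvgB; first exact: cvg_fst.
    by apply: cvgM; [exact: cvg_snd|exact: cvg_cst].
  rewrite (_ : (fun z : R * R => _) = (fun z : R * R =>
    (tm (fun i => z.1 - z.2 * (F p).1.2 i) 0 (F p).1.1 ord0 ord0 +
     tm (fun i => z.1 - z.2 * (F p).1.2 i) 0 (F p).1.1 (Ordinal (isT : (1 < 2)%N)) (Ordinal (isT : (1 < 2)%N))) *
    (tm (fun i => z.1 - z.2 * (F p).1.2 i) 0 (F p).1.1 ord0 ord0 +
     tm (fun i => z.1 - z.2 * (F p).1.2 i) 0 (F p).1.1 (Ordinal (isT : (1 < 2)%N)) (Ordinal (isT : (1 < 2)%N))))); last first.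
    by apply/funext => z'; rewrite trace2E expr2.
  by apply: cvgM; apply: cvgD; exact: ct.
pose A : set (R * R) := `[- K, K]%classic `*` (`[- N, - N^-1]%classic `|` `[N^-1, N]%classic).
have cA : compact A.
  by apply: compact_setX; [exact: segment_compact|apply: compactU; exact: segment_compact].
have AU p : A p -> U p p.
  move=> [_ pN]; rewrite /U /=; have [_ _ _ _] := HF p; apply.
  have Ni : 0 < N^-1 by rewrite invr_gt0.
  apply/eqP => p0; move: pN; rewrite /= !in_itv /= p0 => -[|] /andP[h1 h2]; lra.
(* The filter of finite lists ordered by inclusion turns the near-covering form of compactness into
   a finite subcover. *)
pose FF : set_system (seq (R * R)) :=
  [set S | exists s0 : seq (R * R), forall s : seq (R * R), {subset s0 <= s} -> S s].
have FFF : Filter FF.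
  constructor.
  - by exists [::].
  - move=> S S' [s hs] [s' hs']; exists (s ++ s') => r hr; split.
      by apply: hs => p ps; apply: hr; rewrite mem_cat ps.
    by apply: hs' => p ps; apply: hr; rewrite mem_cat ps orbT.
  - by move=> S S' SS [s hs]; exists s => r hr; apply: SS; exact: hs.
have [s hs] : FF (fun s : seq (R * R) => A `<=` (fun z => exists2 p, p \in s & U p z)).
  move: cA => /compact_near_coveringP /(_ _ FF (fun (s : seq (R * R)) z => exists2 p, p \in s & U p z) FFF).
  apply => z Az; exists (U z, [set s : seq (R * R) | z \in s]) => /=.
    split; first by apply: open_nbhs_nbhs; split; [exact: oU|exact: AU].
    by exists [:: z] => s; apply; rewrite inE.
  by move=> [z' s] /= [Uz zs]; exists z.
have {}hs := hs s (fun _ => id).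
have [kap kap0 hk] := @positive_lower_bound _ (fun p => (F p).2) s
  (fun p => let: And5 _ _ _ h _ := HF p in h).
exists (size s), (fun j => (F (nth (0, 0) s j)).1.1), (fun j => (F (nth (0, 0) s j)).1.2), kap.
split => //.
- by move=> j; have [] := HF (nth (0, 0) s j).
- by move=> j; have [] := HF (nth (0, 0) s j).
- by move=> j; have [] := HF (nth (0, 0) s j).
move=> E lam EK lamN; have [|p ps Up] := hs (E, lam).
  split; first by rewrite /= in_itv /= -ler_norml.
  move: lamN; rewrite /= !in_itv /=; have [l0|l0] := leP 0 lam.
    by rewrite ger0_norm// => ->; right.
  by rewrite ltr0_norm// => /andP[h1 h2]; left; apply/andP; split; lra.
exists (index p s); first by rewrite index_mem.
rewrite nth_index//; apply: le_trans (ltW Up); rewrite lerD2l; exact: hk.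
Qed.

End gap_family.

Section clock_functions.
Variables (X : topologicalGroupType) (t : X) (m : nat) (c : X -> nat).
Hypothesis cc : clock t m c.

Lemma clock_iter n x : (c (translation_iter t n x))%:Z = (((c x)%:Z + n) %% m%:Z)%Z.
Proof.
have [c1 cm cS _] := cc.
have m0 : (0 < m)%N by apply: leq_ltn_trans (cm 1%g).
have base y : (c y)%:Z = ((c y)%:Z %% m%:Z)%Z by rewrite modz_nat modn_small.
have pos (k : nat) y : (c (translation_iter t k y))%:Z = (((c y)%:Z + k%:Z) %% m%:Z)%Z.
  elim: k => [|k IH]; first by rewrite addr0 -base.
  have -> : k.+1%:Z = k%:Z + 1 by lia.
  by rewrite translation_iterS cS -modz_nat -addn1 PoszD IH modzDml addrA.
case: n => n; first exact: pos.
have := pos n.+1 (translation_iter t (Negz n) x).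
rewrite -translation_iterD; have -> : n.+1%:Z + Negz n = 0 by lia.
move=> e; rewrite [LHS]base [(c x)%:Z]e modzDml; congr (_ %% _)%Z; lia.
Qed.

Lemma clock_continuous (R : realType) (P : nat -> R) : continuous (P \o c).
Proof.
move=> x; apply: (near_cst_continuous (P (c x))).
have [_ _ _ oc] := cc.
have : nbhs x [set y | c y = c x] by apply: open_nbhs_nbhs; split; [exact: oc|].
by apply: filterS => y /= ->.
Qed.

End clock_functions.

Section block_potential.
Variable R : realType.

Definition periodize (q : nat) (P : nat -> R) : int -> R := fun i => P (absz (i %% q%:Z)%Z).

Lemma periodize_periodic q P (l : int) i : periodize q P (i + l * q%:Z) = periodize q P i.
Proof. by rewrite /periodize addrC modzMDl. Qed.

Lemma periodize_small q P (i : nat) : (i < q)%N -> periodize q P i%:Z = P i.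
Proof. by move=> iq; rewrite /periodize modz_nat modn_small. Qed.

(** The blocks need not fill the period imposed by the clock; the sites left over carry the base
    potential [b]. *)
Definition block_seq (k W : nat) (Q : nat -> int -> R) (b : int -> R) : nat -> R :=
  fun i => if (i %/ W < k)%N then Q (i %/ W)%N i%:Z else b i%:Z.

Lemma periodize_block k W Q b q (j : nat) (i : int) : (j < k)%N -> (k * W <= q)%N ->
  (j * W)%:Z <= i < (j * W + W)%:Z ->
  periodize q (block_seq k W Q b) i = Q j i.
Proof.
move=> jk kW; case: i => // i /andP[h1 h2].
have iq : (i < q)%N.
  by apply: leq_trans h2 _; apply: leq_trans kW; rewrite -mulSnr leq_mul2r jk orbT.
have ij : (i %/ W = j)%N.
  have W0 : (0 < W)%N by lia.
  have -> : i = (j * W + (i - j * W))%N by rewrite subnKC.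
  by rewrite divnMDl// divn_small ?addn0//; lia.
by rewrite periodize_small// /block_seq ij jk.
Qed.

Lemma block_bounds (j Z nb n : nat) (l : int) : (0 < nb)%N -> (n <= nb)%N ->
  (absz l <= Z.+1 * n)%N ->
  (j * (2 * (Z.+2 * nb)))%:Z <= (j * (2 * (Z.+2 * nb)) + Z.+2 * nb)%N%:Z + l <
    (j * (2 * (Z.+2 * nb)) + 2 * (Z.+2 * nb))%:Z.
Proof.
move=> nb0 nnb hl; have hl' : (absz l <= Z.+1 * nb)%N.
  by apply: leq_trans hl _; rewrite leq_mul2l nnb orbT.
have : (Z.+1 * nb < Z.+2 * nb)%N by rewrite ltn_mul2r nb0 /=.
by move: (Z.+2 * nb)%N (Z.+1 * nb)%N hl' => A B; move: (j * _)%N => C; lia.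
Qed.

(** As [nb] is a multiple of every [n j], so is the centre of block [j], where [Q j] is thus in
    phase 0. The half-length [Z.+2 * nb] strictly exceeds the [Z.+1] periods explored on either
    side. The [k] lists of [q.-1] eigenvalues come from cuts at the centres of the different
    blocks. *)
Lemma family_localization (k q Z : nat) (n : nat -> nat) (Q : nat -> int -> R)
    (b : int -> R) (KV rho e : R) (a : int) (lam : R) :
  let nb := (\prod_(j < k) n j)%N in
  let Pz := periodize q (block_seq k (2 * (Z.+2 * nb)) Q b) in
  (0 < q)%N -> (k * (2 * (Z.+2 * nb)) <= q)%N -> (forall j, 0 < n j)%N ->
  (forall j i, Q j (i + (n j)%:Z) = Q j i) -> 0 <= KV -> 0 < e -> 0 <= rho ->
  rho ^+ Z.+1 < 1 / 8 ->
  exists2 s : seq R, size s = (k * q.-1)%N & forall E u y,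
    (forall i, `|lam * Pz i - E| <= KV) ->
    (exists2 j, (j < k)%N &
      1 <= \tr (tm (fun i => E - lam * Q j i) 0 (n j)) ^+ 2 /\
      4 * (1 + e) <= rho * \tr (tm (fun i => E - lam * Q j i) 0 (n j)) ^+ 2) ->
    sum_le (sq u) 1 -> (forall z, sum_le (sq u) z -> 1 <= z) ->
    sum_le (sq (Hop (fun i => lam * Pz (a + i) - E) u)) y -> y <= rho ^+ Z.+1 ->
    (forall j, (j < k)%N -> (1 + e^-1) * (three_term_const KV (n j) * ((n j + n j)%:R * y)) <=
      (1 - rho) * rho ^+ Z.+1) ->
    exists2 c, c \in s & `|c - E| <= Num.sqrt (4 * loc_const KV * rho ^+ Z.+1).
Proof.
move=> nb Pz q0 kq n0 perQ KV0 e0 rho0 rho8.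
have nb0 : (0 < nb)%N by rewrite prodn_gt0.
have perV (l : int) i : lam * Pz (a + (i + l * q%:Z)) = lam * Pz (a + i).
  by rewrite addrA /Pz periodize_periodic.
have per1 i : lam * Pz (a + (i + q.-1.+1%:Z)) = lam * Pz (a + i).
  by rewrite prednK// -{1}[q%:Z]mul1r perV.
pose i0 j := (j * (2 * (Z.+2 * nb)) + Z.+2 * nb)%N%:Z - a.
have ex j := @eigenvalue_nearby R (fun i => lam * Pz (a + i)) KV (i0 j) q.-1 (n j) Z e rho
  per1 KV0 (n0 j) e0 rho0 rho8.
pose S j := s2val (cid2 (ex j)).
have sS j : size (S j) = q.-1 := s2valP (cid2 (ex j)).
have hS j := s2valP' (cid2 (ex j)).
exists (flatten [seq S j | j <- iota 0 k]).
  rewrite size_flatten /shape -map_comp (eq_map (_ : _ =1 fun=> q.-1)); last first.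
    by move=> j /=; rewrite sS.
  by elim: k {kq nb Pz nb0 perV per1 i0 ex S sS hS} 0%N => // k IH i; rewrite /= IH mulSn.
move=> E u y bd [j jk [t1 tr]] u1 umin Hy yr yD.
have W1 i : lam * Q j (i + (n j)%:Z) - E = lam * Q j i - E by rewrite perQ.
have We : (fun i => - (lam * Q j i - E)) = (fun i => E - lam * Q j i).
  by apply/funext => i; rewrite opprB.
have bd' i : `|lam * Pz (a + i) - E| <= KV by exact: bd.
have njnb : (n j <= nb)%N.
  apply: dvdn_leq => //; rewrite /nb (bigD1 (Ordinal jk))//=; exact: dvdn_mulr.
have perQm (l : nat) i : Q j (i + (l * n j)%N%:Z) = Q j i.
  elim: l i => [|l IH] i; first by rewrite mul0n addr0.
  by rewrite mulSn PoszD addrA IH perQ.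
have blk (c i : int) : (absz i <= Z.+1 * n j)%N ->
    lam * Pz (a + (i0 j + c * q.-1.+1%:Z + i)) - E = lam * Q j i - E.
  move=> hi; congr (_ * _ - _); rewrite prednK//.
  have -> : a + (i0 j + c * q%:Z + i) =
    (j * (2 * (Z.+2 * nb)) + Z.+2 * nb)%N%:Z + i + c * q%:Z by rewrite /i0; ring.
  rewrite /Pz periodize_periodic (periodize_block _ _ jk kq); last first.
    exact: block_bounds nb0 njnb hi.
  have dv : (n j %| j * (2 * (Z.+2 * nb)) + Z.+2 * nb)%N.
    have dnb : (n j %| nb)%N by rewrite /nb (bigD1 (Ordinal jk))//=; exact: dvdn_mulr.
    by rewrite dvdn_add// ?dvdn_mull// dvdn_mull// dvdn_mull.
  by rewrite -(divnK dv) addrC perQm.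
have [c cS hc] := hS j E _ u y bd' W1 blk (etrans (congr1 (fun f => 1 <= \tr (tm f 0 (n j)) ^+ 2) We) t1)
  (etrans (congr1 (fun f => 4 * (1 + e) <= rho * \tr (tm f 0 (n j)) ^+ 2) We) tr) u1 umin Hy yr (yD j jk).
exists c => //; apply/flattenP; exists (S j) => //.
by apply/mapP; exists j => //; rewrite mem_iota.
Qed.

End block_potential.

Section periodic_model.
Variables (R : realType) (X : topologicalGroupType) (t : X).
Hypotheses (cX : cantor_group X) (mint : minimal_translation t).

Lemma clock_gpow m c (n : int) : clock t m c -> (c (gpow t n))%:Z = (n %% m%:Z)%Z.
Proof. by move=> cc; rewrite /gpow (clock_iter cc); have [-> _ _ _] := cc; rewrite add0r. Qed.

(** The clock [c0] is itself a continuous function, and natural numbers closer than [1 / 2]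
    coincide. The long period needs a new clock, from which the phase of [b] can still be read. *)
Lemma refining_clock m0 c0 M : clock t m0 c0 -> exists q c, [/\ (M <= q)%N, clock t q c &
  forall x y, c x = c y -> c0 x = c0 y].
Proof.
move=> cc0; have ccont := clock_continuous (P := fun i : nat => i%:R : R) cc0.
have half : 0 < 1 / 2 :> R by rewrite divr_gt0.
have [q [c [Mq cc h]]] := clock_exists M cX mint ccont half.
exists q, c; split => // x y /h /=.
have [le|le] := leqP (c0 x) (c0 y).
  rewrite distrC -natrB// ger0_norm// => l2; apply/eqP; rewrite eqn_leq le /= -subn_eq0.
  rewrite -leqn0 -ltnS -(ltr_nat R); lra.
rewrite -natrB ?(ltnW le)// ger0_norm// => l2; apply/eqP; rewrite eqn_leq (ltnW le) andbT -subn_eq0.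
rewrite -leqn0 -ltnS -(ltr_nat R); lra.
Qed.

(** [Z] is fitted to the given [q]; the upper bound on [q] makes the number of eigenvalues linear in
    [Z], against an exponentially small error. *)
Lemma block_length (q D Z0 : nat) : (0 < D)%N -> (D * (Z0 + 3) <= q)%N ->
  exists2 Z, (Z0 <= Z)%N & (D * Z.+2 <= q < D * (Z + 3))%N.
Proof.
move=> D0 hq; have h1 : (Z0 + 3 <= q %/ D)%N by rewrite leq_divRL// mulnC.
exists (q %/ D - 2)%N; first by lia.
have -> : (q %/ D - 2).+2 = (q %/ D)%N by lia.
have -> : (q %/ D - 2 + 3)%N = (q %/ D).+1 by lia.
by rewrite mulnC leq_divM /= mulnC ltn_ceil.
Qed.

Lemma decay_rate (kap : R) : 0 < kap ->
  [/\ 0 < (4 + kap / 2) / (4 + kap), (4 + kap / 2) / (4 + kap) < 1 &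
    4 * (1 + kap / 8) = (4 + kap / 2) / (4 + kap) * (4 + kap)].
Proof.
move=> k0; split; first by rewrite divr_gt0//; lra.
  by rewrite ltr_pdivrMr; lra.
by rewrite divfK ?gt_eqF//; [field|lra].
Qed.

Lemma third_of_quarter (x : R) : 3 * x <= 1 / 4 -> x <= 1 / 12.
Proof. move=> *; lra. Qed.

Lemma square_lt_eighth (x : R) : 0 < x -> x <= 1 / 12 -> x ^+ 2 < 1 / 8.
Proof. by rewrite expr2 => *; nra. Qed.

(** The phase [a] is arbitrary because a base point enters only through its clock reading; [z] is
    uniform in the phase, the energy and the coupling, which later leaves room for a ball of
    potentials. *)
Lemma periodic_model (v0 : X -> R) (eps N B : R) : continuous v0 -> 0 < eps -> 1 <= N ->
  (forall x, `|v0 x| <= B) ->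
  exists (q : nat) (c : X -> nat) (P : nat -> R) (z : R),
  [/\ clock t q c, forall x, `|P (c x) - v0 x| < eps, forall i, `|P i| <= B + 1, 0 < z &
    forall (lam : R) (a : int), N^-1 <= `|lam| <= N ->
    exists (s : seq R) (eta : R), [/\ 0 <= eta, (size s)%:R * (2 * eta) <= N^-1 &
      forall E u, `|E| <= 3 + N * (B + 2) ->
        sum_le (sq u) 1 -> (forall y, sum_le (sq u) y -> 1 <= y) ->
        sum_le (sq (Hop (fun i => lam * periodize q P (a + i) - E) u)) z ->
        exists2 l, l \in s & `|l - E| <= eta]].
Proof.
move=> cv0 eps0 N1 v0B.
have N0 : 0 < N by apply: lt_le_trans N1.
have B0 : 0 <= B by apply: le_trans (v0B 1%g).
(* One half is for replacing [v0] by its orbit samples [b], one half for replacing [b] by the [Q j];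
   the cap 1 gives [|P i| <= B + 1]. *)
pose eps1 := Num.min (eps / 2) 1.
have eps1p : 0 < eps1 by rewrite lt_min divr_gt0//=.
have eps1e : eps1 + eps1 <= eps.
  have h1 : eps1 <= eps / 2 by rewrite ge_min lexx.
  by rewrite [eps]splitr lerD.
have eps1_1 : eps1 <= 1 by rewrite ge_min lexx orbT.
(* Period at least 2, as [single_gap] demands. *)
have [m0 [c0 [m2 cc0 c0v0]]] := clock_exists 2 cX mint cv0 eps1p.
pose b (i : int) := v0 (gpow t (i %% m0%:Z)%Z).
have perb i : b (i + m0%:Z) = b i by rewrite /b modzDr.
have bB i : `|b i| <= B by exact: v0B.
set K := 3 + N * (B + 2); pose KV := K + N * (B + 1).
have K0 : 0 <= K by rewrite addr_ge0// mulr_ge0// ?ltW//; lra.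
have NB0 : 0 <= N * (B + 1) by rewrite mulr_ge0 ?ltW//; lra.
have KV0 : 0 <= KV by rewrite addr_ge0.
have [k [n [Q [kap [kap0 n0 perQ Qb gap]]]]] := gap_family K m2 perb eps1p N1.
have QB j i : `|Q j i| <= B + 1.
  rewrite -[Q j i](subrK (b i)); apply: le_trans (ler_normD _ _) _.
  by have := Qb j i; have := bB i; lra.
have k0 : (0 < k)%N.
  have c1 : N^-1 <= `|1 : R| <= N by rewrite normr1 invf_le1// N1.
  have c2 : `|0 : R| <= K by rewrite normr0.
  by have [j jk _] := gap 0 1 c2 c1; exact: leq_ltn_trans jk.
pose nb := (\prod_(j < k) n j)%N.
have nb0 : (0 < nb)%N by rewrite prodn_gt0.
pose e := kap / 8; pose rho := (4 + kap / 2) / (4 + kap).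
have e0 : 0 < e by rewrite divr_gt0.
have [rho0 rho1 rhoE] := decay_rate kap0.
rewrite -/rho -/e in rho0 rho1 rhoE; clearbody rho e.
pose sig := Num.sqrt rho.
have sig0 : 0 < sig by rewrite sqrtr_gt0.
have sig1 : sig < 1 by rewrite -sqrtr1 ltr_sqrt.
have sig2 : sig ^+ 2 = rho by rewrite sqr_sqrtr// ltW.
have L0 : 0 < loc_const KV by rewrite /loc_const ltr_wpDr// mulr_ge0// addr_ge0// sqr_ge0.
pose C4 := Num.sqrt (4 * loc_const KV).
have C40 : 0 < C4 by rewrite sqrtr_gt0 mulr_gt0.
pose D := (2 * nb * k)%N.
have D0 : (0 < D)%N by rewrite !muln_gt0 nb0 k0.
have den : 0 < N * (2 * k%:R * D%:R * C4).
  by rewrite !mulr_gt0// ltr0n.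
(* The first bound gives [sig ^+ Z.+1 <= 1 / 12], hence [rho ^+ Z.+1 < 1 / 8]; the second bounds the
   total length of the cover by [N^-1]. The rate is [sig], the root of [rho], because [eta] is a
   square root. *)
pose c5 := Num.min (1 / 4) (N * (2 * k%:R * D%:R * C4))^-1.
have c50 : 0 < c5 by rewrite lt_min divr_gt0//= invr_gt0.
have [Z0 hZ0] := polynomial_geometric sig0 sig1 c50.
have [q [c [qbig cc ref]]] := refining_clock (D * (Z0 + 3)) cc0.
have [Z ZZ0 /andP[Zq qZ]] := block_length D0 qbig.
have hZ := hZ0 Z ZZ0.
have q0 : (0 < q)%N by apply: leq_trans Zq; rewrite muln_gt0 D0.
pose P := block_seq k (2 * (Z.+2 * nb)) Q b.
have Pb i : `|P i - b i%:Z| <= eps1.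
  by rewrite /P /block_seq; case: ifP => _; rewrite ?Qb// subrr normr0 ltW.
have PB i : `|P i| <= B + 1.
  rewrite /P /block_seq; case: ifP => _; first exact: QB.
  by apply: le_trans (bB _) _; rewrite lerDl.
have sigZ : sig ^+ Z.+1 <= 1 / 12.
  have h1 : 3 * sig ^+ Z.+1 <= (Z%:R + 3) * sig ^+ Z.+1.
    by rewrite ler_wpM2r ?exprn_ge0 ?(ltW sig0)// lerDr.
  have h2 : c5 <= 1 / 4 by rewrite ge_min lexx.
  by apply: third_of_quarter; apply: le_trans h1 (le_trans hZ h2).
have sigZ0 : 0 < sig ^+ Z.+1 by exact: exprn_gt0.
have rhoZ : rho ^+ Z.+1 = (sig ^+ Z.+1) ^+ 2 by rewrite -sig2 exprAC.
have rho8 : rho ^+ Z.+1 < 1 / 8 by rewrite rhoZ; exact: square_lt_eighth.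
have x0 : 0 < rho ^+ Z.+1 by exact: exprn_gt0.
pose cj (j : nat) := (1 + e^-1) * (three_term_const KV (n j) * (n j + n j)%:R).
have cj0 j : 0 <= cj j.
  apply: mulr_ge0; first by rewrite addr_ge0// invr_ge0 ltW.
  by apply: mulr_ge0 => //; exact: three_term_const_ge0.
pose Cm := 1 + \sum_(j < k) cj j.
have Cm0 : 0 < Cm by rewrite ltr_wpDr// sumr_ge0.
pose z := Num.min (rho ^+ Z.+1) ((1 - rho) * rho ^+ Z.+1 / Cm).
have z0 : 0 < z by rewrite lt_min x0 divr_gt0// mulr_gt0// subr_gt0.
exists q, c, P, z; split => //.
  move=> x; rewrite -(subrK (b (c x)%:Z) (P (c x))) -addrA.
  apply: le_lt_trans (ler_normD _ _) _; apply: lt_le_trans eps1e.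
  apply: ler_ltD; first exact: Pb.
  rewrite /b distrC; apply: c0v0.
  have cx : c x = c (gpow t (c x)%:Z).
    apply/eqP; rewrite -eqz_nat (clock_gpow _ cc) modz_nat modn_small//.
    by have [_ cm _ _] := cc.
  rewrite (ref _ _ cx); apply/eqP; rewrite -eqz_nat !(clock_gpow _ cc0) modz_mod.
  by [].
move=> lam a lamN.
have kW : (k * (2 * (Z.+2 * nb)) <= q)%N.
  by apply: leq_trans Zq; rewrite /D leq_eqVlt; apply/orP; left; apply/eqP; ring.
have [s ss hs] := family_localization b a lam q0 kW n0 perQ KV0 e0 (ltW rho0) rho8.
exists s, (Num.sqrt (4 * loc_const KV * rho ^+ Z.+1)).
have etaE : Num.sqrt (4 * loc_const KV * rho ^+ Z.+1) = C4 * sig ^+ Z.+1.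
  by rewrite sqrtrM ?mulr_ge0 ?(ltW L0)// rhoZ sqrtr_sqr gtr0_norm.
split; first exact: sqrtr_ge0.
- rewrite ss etaE.
  have h1 : (k * q.-1)%:R <= k%:R * (D%:R * (Z%:R + 3)) :> R.
    rewrite natrM ler_wpM2l// -[3]/(3%:R) -natrD -natrM ler_nat.
    by rewrite (leq_trans (leq_pred q))// ltnW.
  have C4s : 0 <= C4 * sig ^+ Z.+1 by rewrite mulr_ge0// ltW.
  apply: (@le_trans _ _ (k%:R * (D%:R * (Z%:R + 3)) * (2 * (C4 * sig ^+ Z.+1)))).
    by rewrite ler_wpM2r// mulr_ge0.
  have -> : k%:R * (D%:R * (Z%:R + 3)) * (2 * (C4 * sig ^+ Z.+1)) =
    (2 * k%:R * D%:R * C4) * ((Z%:R + 3) * sig ^+ Z.+1) by ring.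
  have g0 : 0 < 2 * k%:R * D%:R * C4 by rewrite !mulr_gt0// ltr0n.
  apply: (@le_trans _ _ ((2 * k%:R * D%:R * C4) * (N * (2 * k%:R * D%:R * C4))^-1)).
    by rewrite ler_pM2l//; apply: le_trans hZ _; rewrite ge_min lexx orbT.
  by rewrite invfM mulrCA mulfV ?gt_eqF// mulr1.
move=> E u EK u1 umin Hz; apply: (hs E u z) => //.
- move=> i; apply: le_trans (ler_normB _ _) _; rewrite addrC; apply: lerD => //.
  rewrite normrM; case/andP: lamN => _ lN; apply: ler_pM => //; exact: PB.
- have [j jk hj] := gap E lam EK lamN; exists j => //; split.
    apply: le_trans hj; apply: (@le_trans _ _ 4); first by rewrite ler1n.
    by rewrite lerDl ltW.
  by rewrite rhoE ler_pM2l.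
- by rewrite ge_min lexx.
move=> j jk; have -> : (1 + e^-1) * (three_term_const KV (n j) * ((n j + n j)%:R * z)) = cj j * z.
  by rewrite /cj; ring.
have hc : cj j <= Cm.
  by rewrite /Cm (bigD1 (Ordinal jk))//= addrCA lerDl addr_ge0// sumr_ge0.
apply: (@le_trans _ _ (Cm * z)); first by rewrite ler_wpM2r// ltW.
by rewrite mulrC -ler_pdivlMr// ge_min lexx orbT.
Qed.

End periodic_model.

(** * Potentials with small spectrum and Lyapunov exponent *)

Section spectral_estimates.
Variables (R : realType) (X : topologicalGroupType) (t : X).
Variable mu : probability (borel X) R.
Implicit Types (v p : X -> R) (E : R).

Lemma Sigma_approx v x E K : (forall y, `|v y - E| <= K) -> Sigma t v x E ->
  approx_kernel (pot t v x E).
Proof.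
move=> vK SE; apply: contrapT => /not_approx_kernel[C C1 lC].
exact: notin_Sigma (fun n => vK _) C1 lC SE.
Qed.

Lemma Sigma_bounded v x E K : (forall y, `|v y| <= K) -> Sigma t v x E ->
  `|E| <= 3 + K.
Proof.
move=> vK SE; have vEK y : `|v y - E| <= K + `|E|.
  by apply: le_trans (ler_normB _ _) _; rewrite lerD2r.
have [n] := approx_kernel_bounded (Sigma_approx vEK SE).
rewrite /pot => h; rewrite -[E](subKr (v (translation_iter t n x))).
apply: le_trans (ler_normB _ _) _; rewrite addrC; apply: lerD; last exact: vK.
exact: ltW.
Qed.

Lemma linear_le_exp (b : R) n : 0 < b -> b <= 1 ->
  n.+1%:R <= 2 / b * (1 + b) ^+ n.
Proof.
move=> b0 b1; have h : 1 + n.+1%:R * b <= (1 + b) ^+ n.+1.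
  elim: n => [|n IH]; first by rewrite mul1r expr1.
  rewrite exprS; apply: (@le_trans _ _ ((1 + b) * (1 + n.+1%:R * b))).
    by rewrite -(natr1 n.+1); have := ler0n R n.+1; nra.
  by rewrite ler_pM2l// addr_gt0.
have e0 : 0 <= (1 + b) ^+ n by rewrite exprn_ge0// addr_ge0// ltW.
rewrite mulrAC ler_pdivlMr//; rewrite exprS in h; nra.
Qed.

Lemma ln_mxpow_bound (A : 'M[R]_2) M b n : \det A = 1 -> (forall j k, `|A j k| <= M) ->
  0 < b -> b <= 1 -> `|\tr A| <= 2 + b ^+ 2 / 8 ->
  ln (nrm (mxpow A n)) <= ln (8 * (M + 1) / b) + 2 * n%:R * b.
Proof.
move=> dA AM b0 b1 trA.
have h j k := mxpow_bound n dA AM b0 b1 trA j k.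
have M0 : 0 <= M by apply: le_trans (AM ord0 ord0).
have dP : \det (mxpow A n) = 1.
  rewrite /mxpow; elim: n {h} => [|n IH]; first by rewrite det1.
  by rewrite iterS det_mulmx dA IH mulr1.
have s0 : 0 < 1 + b by rewrite addr_gt0.
have c0 : 0 < 8 * (M + 1) / b by rewrite divr_gt0// mulr_gt0// ltr_wpDl.
have hh : nrm (mxpow A n) <= 8 * (M + 1) / b * ((1 + b) ^+ n * (1 + b) ^+ n).
  apply: (@le_trans _ _ (4 * ((M + 1) * (n.+1%:R * (1 + b) ^+ n)))).
    rewrite /nrm; have := (h ord0 ord0, h ord0 (Ordinal (isT : 1 < 2)%N),
      h (Ordinal (isT : 1 < 2)%N) ord0, h (Ordinal (isT : 1 < 2)%N) (Ordinal (isT : 1 < 2)%N)).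
    by move=> [[[h1 h2] h3] h4]; lra.
  have -> : 8 * (M + 1) / b * ((1 + b) ^+ n * (1 + b) ^+ n) =
    4 * ((M + 1) * (2 / b * (1 + b) ^+ n * (1 + b) ^+ n)) by ring.
  rewrite ler_pM2l// ler_wpM2l ?addr_ge0// ler_wpM2r ?exprn_ge0 ?(ltW s0)//.
  exact: linear_le_exp.
have n1 := nrm_ge1 dP.
apply: (@le_trans _ _ (ln (8 * (M + 1) / b * ((1 + b) ^+ n * (1 + b) ^+ n)))).
  by rewrite ler_ln// posrE; [exact: lt_le_trans n1|rewrite !mulr_gt0// ?exprn_gt0// ?invr_gt0// ltr_wpDl].
rewrite lnM ?posrE// ?mulr_gt0 ?exprn_gt0//.
rewrite -exprD lnXn// lerD2l -[X in X <= _]mulr_natl.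
have l1 : ln (1 + b) <= b by apply: le_ln1Dx; lra.
have -> : (n + n)%:R = 2 * n%:R :> R by rewrite natrD; ring.
by rewrite ler_wpM2l// mulr_ge0.
Qed.

(** The infimum is tested at [n = l * q], where the transfer matrix of [v] is compared with the
    [l]-th power of the monodromy of [p]. The terms are made small in the order [b], [l], [d]: [l]
    depends on [b], and [d] on [l * q]. *)
Lemma lyapunov_small v p E (K d b : R) (q l : nat) :
  haar mu -> compact [set: X] ->
  continuous v -> (0 < q)%N -> (0 < l)%N -> 0 <= K -> 0 <= d -> 0 < b -> b <= 1 ->
  (forall x, `|v x - E| <= K) -> (forall x, `|p x - E| <= K) ->
  (forall x, `|v x - p x| <= d) ->
  (forall x k, p (translation_iter t (k + q%:Z) x) = p (translation_iter t k x)) ->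
  (forall x, `|\tr (transfer t p E q x)| <= 2 + b ^+ 2 / 8) ->
  lyapunov t mu v E <=
    (l%:R)^-1 * ln (8 * ((K + 2) ^+ q + 1) / b) + 2 * b + 4 * ((K + 2) ^+ (l * q) * d).
Proof.
move=> hmu cX cv q0 l0 K0 d0 b0 b1 vK pK vp pper trp.
have [_ up _] := lyapunovP t E hmu cX cv.
have lq0 : (0 < l * q)%N by rewrite muln_gt0 l0.
apply: le_trans (up _ lq0) _.
set c := ln _.
have c0 : 0 <= c.
  apply: ln_ge0; have h : 0 <= (K + 2) ^+ q by rewrite exprn_ge0// addr_ge0.
  rewrite ler_pdivlMr// mul1r; lra.
have KN y (f : X -> R) (fK : forall x, `|f x - E| <= K) k : `|- pot t f y E k| <= K.
  by rewrite normrN; exact: fK.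
have hlog x : growth t v E (l * q) x <= c + 2 * l%:R * b + 4 * ((l * q)%:R * (K + 2) ^+ (l * q) * d).
  have dp : \det (transfer t p E (l * q) x) = 1 by rewrite transferE det_tm.
  have dv : \det (transfer t v E (l * q) x) = 1 by rewrite transferE det_tm.
  apply: le_trans (ln_opnorm_lip dv dp) _; apply: lerD; last first.
    rewrite !transferE; apply: tm_lip => // k; try by apply: KN.
    rewrite /pot; set y := translation_iter t k x.
    have -> : - (v y - E) - - (p y - E) = - (v y - p y) by ring.
    by rewrite normrN.
  apply: (@le_trans _ _ (ln (nrm (transfer t p E (l * q) x)))).
    rewrite ler_ln ?posrE ?opnorm_le_nrm//.
      by apply: lt_le_trans (opnorm_ge1 dp).
    by apply: lt_le_trans (nrm_ge1 dp).
  rewrite transferE tm_period; last first.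
    by move=> k; rewrite /pot pper.
  apply: ln_mxpow_bound => //; first exact: det_tm.
    by move=> j k; apply: tm_bound => // i _; exact: KN.
  by rewrite -transferE.
apply: (@le_trans _ _ ((l * q)%:R^-1 * (c + 2 * l%:R * b + 4 * ((l * q)%:R * (K + 2) ^+ (l * q) * d)))).
  by rewrite ler_pM2l ?invr_gt0 ?ltr0n//; exact: logint_le.
have l0' : 0 < l%:R :> R by rewrite ltr0n.
have q1 : 1 <= q%:R :> R by rewrite ler1n.
have -> : (l * q)%:R^-1 * (c + 2 * l%:R * b + 4 * ((l * q)%:R * (K + 2) ^+ (l * q) * d)) =
  q%:R^-1 * (l%:R^-1 * c + 2 * b) + 4 * ((K + 2) ^+ (l * q) * d).
  rewrite natrM; field; rewrite !gt_eqF//; lra.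
rewrite lerD2r ler_piMl//; first by rewrite addr_ge0// ?mulr_ge0// ?invr_ge0 ?(ltW l0') ?(ltW b0).
by rewrite invf_le1//; lra.
Qed.

End spectral_estimates.

Section good_potentials.
Variables (R : realType) (X : topologicalGroupType) (t : X).
Variable mu : probability (borel X) R.
Implicit Types (v p : X -> R) (E : R).

(** Half of the excess [s] of the right-hand side over 4 is spent on [4 * d], half on the error
    term. *)
Lemma trace_slack (b C1 C2 : R) : 0 < b -> 0 <= C1 -> 0 <= C2 ->
  exists d z, [/\ 0 < d, 0 < z & forall y, y <= z ->
    4 * (1 + d) + (1 + d^-1) * (C1 * (C2 * y)) <= (2 + b ^+ 2 / 8) ^+ 2].
Proof.
move=> b0 C10 C20; pose s := (2 + b ^+ 2 / 8) ^+ 2 - 4.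
have s0 : 0 < s.
  have h : 0 < b ^+ 2 by exact: exprn_gt0.
  by rewrite /s; nra.
have d0 : 0 < s / 8 by rewrite divr_gt0.
have c0 : 0 <= (1 + (s / 8)^-1) * (C1 * C2).
  by rewrite !mulr_ge0// addr_ge0// invr_ge0 ltW.
set c := (1 + (s / 8)^-1) * (C1 * C2) in c0.
exists (s / 8), (s / 2 / (c + 1)); split => //.
  by rewrite !divr_gt0// ltr_wpDl.
move=> y yz.
have -> : (1 + (s / 8)^-1) * (C1 * (C2 * y)) = c * y by rewrite /c; ring.
have h : c * y <= s / 2.
  apply: le_trans (ler_wpM2l c0 yz) _.
  rewrite mulrCA ler_piMr//; first by rewrite ltW// divr_gt0.
  by rewrite ler_pdivrMr ?ltr_wpDl// mul1r lerDl.
have e : (2 + b ^+ 2 / 8) ^+ 2 = s + 4 by rewrite /s subrK.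
rewrite e; lra.
Qed.

Lemma eighth_product (n r s y : R) : r * (4 * n) <= y -> n * s <= n * r ->
  2 * (n * s) <= y / 2.
Proof. move=> *; lra. Qed.

Lemma half_plus (y c : R) : c <= y / 2 -> 2 * (y / 4) + c <= y.
Proof. move=> *; lra. Qed.

Lemma quarter_sum (x y z n : R) : x <= n / 4 -> y = n / 4 -> z <= n / 2 -> x + y + z <= n.
Proof. move=> *; lra. Qed.

Lemma half_inv (N k w : R) : 0 < N -> w * (8 * N * k) <= 1 -> 4 * (k * w) <= N^-1 / 2.
Proof.
move=> N0 h; rewrite -div1r mulrAC ler_pdivlMr// ler_pdivlMr//.
by rewrite [X in X <= _](_ : _ = w * (8 * N * k))//; ring.
Qed.

(** The cover may depend on [x], as the phase of the periodic potential does; only its total length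
    is uniform. *)
Definition good (N : R) v := forall lam : R, N^-1 <= `|lam| <= N ->
  (forall x, exists (s : seq R) (eta : R),
    [/\ 0 <= eta, (size s)%:R * (2 * eta) <= N^-1 &
      forall E, Sigma t (fun y => lam * v y) x E -> exists2 l, l \in s & `|l - E| <= eta]) /\
  (forall x E, Sigma t (fun y => lam * v y) x E ->
    lyapunov t mu (fun y => lam * v y) E <= N^-1).

Lemma exists_good v0 (eps N : R) : cantor_group X -> minimal_translation t -> haar mu ->
  continuous v0 -> 0 < eps -> 1 <= N ->
  exists p r, [/\ continuous p, forall x, `|p x - v0 x| < eps, 0 < r &
    forall v, continuous v -> (forall x, `|v x - p x| <= r) -> good N v].
Proof.
move=> cX mint hmu cv0 eps0 N1; have [cptX _ _ _] := cantor_groupP cX.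
have N0 : 0 < N by apply: lt_le_trans N1.
have [B B0 v0B] := continuous_bounded cptX cv0.
have [q [c [P [z [cc Pv0 PB z0 loc]]]]] := periodic_model cX mint cv0 eps0 N1 v0B.
pose p x := P (c x).
have q0 : (0 < q)%N by have [_ cq _ _] := cc; apply: leq_ltn_trans (cq 1%g).
have piter x k : p (translation_iter t k x) = periodize q P ((c x)%:Z + k).
  by rewrite /p /periodize -(clock_iter cc).
pose K0 := 3 + N * (B + 2); pose K := K0 + N * (B + 2).
have NB0 : 0 <= N * (B + 2) by rewrite mulr_ge0 ?(ltW N0)// addr_ge0.
have K00 : 0 <= K0 by rewrite addr_ge0.
have Kge0 : 0 <= K by rewrite addr_ge0.
pose b := (8 * N)^-1.
have b0 : 0 < b by rewrite invr_gt0 mulr_gt0.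
have b1 : b <= 1 by rewrite invf_le1 ?mulr_gt0//; lra.
have [d [z1 [d0 z10 hz1]]] := trace_slack b0 (three_term_const_ge0 q Kge0) (ler0n R (q + q)).
pose y := Num.min z z1.
have y0 : 0 < y by rewrite lt_min z0.
pose A := ln (8 * ((K + 2) ^+ q + 1) / b).
pose l := (Num.bound `|4 * N * A|).+1.
have lA : 4 * N * A <= l%:R.
  apply: le_trans (ler_norm _) _; apply/ltW.
  by apply: lt_le_trans (archi_boundP (normr_ge0 _)) _; rewrite ler_nat.
pose D := 8 * N * (K + 2) ^+ (l * q).
have D0 : 0 < D by rewrite !mulr_gt0// exprn_gt0// ltr_wpDl.
(* The three bounds keep [|v| <= B + 2], let approximate eigenvectors pass from [lam * v] to
   [lam * p], and make the perturbation term of [lyapunov_small] at most [N^-1 / 2]. *)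
pose r := Num.min 1 (Num.min (y / (4 * N ^+ 2)) (N * D)^-1).
have N20 : 0 < 4 * N ^+ 2 by rewrite mulr_gt0// exprn_gt0.
have r0 : 0 < r by rewrite !lt_min ltr01 divr_gt0// invr_gt0 mulr_gt0.
have r1 : r <= 1 by rewrite ge_min lexx.
have ry : 2 * (N * r) ^+ 2 <= y / 2.
  have h : r <= y / (4 * N ^+ 2) by rewrite !ge_min lexx orbT.
  rewrite ler_pdivlMr// in h.
  have h2 : r ^+ 2 <= r by rewrite expr2 ler_piMl// ltW.
  have h3 : N ^+ 2 * r ^+ 2 <= N ^+ 2 * r by rewrite ler_wpM2l// exprn_ge0// ltW.
  by rewrite exprMn; apply: eighth_product h h3.
have rD : N * r * D <= 1.
  have h : r <= (N * D)^-1 by rewrite !ge_min lexx !orbT.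
  have ND : 0 < N * D by rewrite mulr_gt0.
  by rewrite -div1r ler_pdivlMr// in h; rewrite mulrAC mulrC.
exists p, r; split => //.
  exact: (clock_continuous (P := P) cc).
move=> v cv vp.
have pB x : `|p x| <= B + 1 by exact: PB.
have vB x : `|v x| <= B + 2.
  rewrite -[v x](subrK (p x)); apply: le_trans (ler_normD _ _) _.
  apply: le_trans (lerD (le_trans (vp x) r1) (pB x)) _.
  by rewrite addrCA -natr1 natr1.
move=> lam lamN; have lN : `|lam| <= N by case/andP: lamN.
have lvB x : `|lam * v x| <= N * (B + 2).
  by rewrite normrM; apply: ler_pM.
have lpB x : `|lam * p x| <= N * (B + 2).
  rewrite normrM; apply: ler_pM => //; apply: le_trans (pB x) _.
  by rewrite lerD2l ler1n.
have lvp x : `|lam * v x - lam * p x| <= N * r.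
  by rewrite -mulrBr normrM; apply: ler_pM.
have clv : continuous (fun x => lam * v x).
  by move=> x; apply: cvgM; [exact: cvg_cst|exact: cv].
have EK x E : Sigma t (fun y => lam * v y) x E -> `|E| <= K0.
  by move=> SE; apply: Sigma_bounded lvB SE.
have fK (f : X -> R) E : (forall x, `|f x| <= N * (B + 2)) -> `|E| <= K0 ->
    forall x, `|f x - E| <= K.
  move=> fB Eb x; apply: le_trans (ler_normB _ _) _.
  by rewrite addrC; apply: lerD.
have near x E : Sigma t (fun y => lam * v y) x E -> exists u,
    [/\ sum_le (sq u) 1, forall w, sum_le (sq u) w -> 1 <= w &
     sum_le (sq (Hop (fun i => lam * periodize q P ((c x)%:Z + i) - E) u)) y].
  move=> SE; have y4 : 0 < y / 4 by rewrite divr_gt0.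
  have [u [u1 um Hu]] := Sigma_approx (fK _ _ lvB (EK _ _ SE)) SE y4.
  exists u; split => //.
  have hd n : `|pot t (fun y => lam * v y) x E n -
      (lam * periodize q P ((c x)%:Z + n) - E)| <= N * r.
    rewrite /pot -piter; apply: le_trans (lvp (translation_iter t n x)).
    by rewrite le_eqVlt; apply/orP; left; apply/eqP; congr (`|_|); ring.
  apply: sum_le_mono (Hop_perturb hd u1 Hu); first by [].
  by rewrite mulr1; exact: half_plus.
(* The approximate eigenvector lives over [x0], but the exponent integrates over all [x]: another
   base point only shifts the phase, which leaves the trace unchanged. *)
have tr_small x0 E : Sigma t (fun y => lam * v y) x0 E ->
    forall x, `|\tr (transfer t (fun y => lam * p y) E q x)| <= 2 + b ^+ 2 / 8.
  move=> SE; have [u [u1 um Hu]] := near _ _ SE.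
  pose V k := lam * periodize q P ((c x0)%:Z + k) - E.
  have VK k : `|V k| <= K by rewrite /V -piter; exact: (fK (fun x => lam * p x) _ lpB (EK _ _ SE)).
  have Vper k : V (k + q%:Z) = V k.
    by rewrite /V addrA -[q%:Z]mul1r periodize_periodic.
  have trV := approx_trace Kge0 VK Vper d0 u1 um Hu.
  have tr2 : `|\tr (tm (fun k => - V k) 0 q)| <= 2 + b ^+ 2 / 8.
    have b20 : 0 <= 2 + b ^+ 2 / 8 by rewrite addr_ge0// divr_ge0// sqr_ge0.
    rewrite -(@ler_pXn2r _ 2)// ?nnegrE//.
    rewrite real_normK ?num_real//; apply: le_trans trV _; apply: hz1.
    by rewrite ge_min lexx orbT.
  move=> x; rewrite transferE.
  have -> : tm (fun k => - pot t (fun y => lam * p y) x E k) 0 q =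
      tm (fun k => - V k) ((c x)%:Z - (c x0)%:Z) q.
    apply: tm_eq => k _; rewrite /pot piter /V; congr (- (_ * periodize _ _ _ - _)).
    by rewrite add0r addrA addrCA subrr addr0.
  by rewrite (trace_tm _ 0)// => k; rewrite Vper.
split=> [x|x E SE].
  have [s [eta [eta0 ss hs]]] := loc lam (c x) lamN.
  exists s, eta; split => // E SE.
  have [u [u1 um Hu]] := near _ _ SE.
  apply: (hs E u) => //; first exact: EK SE.
  by apply: sum_le_mono Hu => //; rewrite ge_min lexx.
have Nr0 : 0 <= N * r by rewrite mulr_ge0// ltW.
have pper w (k : int) : lam * p (translation_iter t (k + q%:Z) w) = lam * p (translation_iter t k w).
  by rewrite !piter addrA -[q%:Z]mul1r periodize_periodic.
have l0 : (0 < l)%N by [].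
have := lyapunov_small hmu cptX clv q0 l0 Kge0 Nr0 b0 b1
  (fK _ _ lvB (EK _ _ SE)) (fK _ _ lpB (EK _ _ SE)) lvp pper (tr_small _ _ SE).
move/le_trans; apply; rewrite -/A.
have h1 : l%:R^-1 * A <= N^-1 / 4.
  rewrite mulrC ler_pdivrMr ?ltr0n// mulrAC ler_pdivlMr// mulrC.
  by rewrite ler_pdivlMl// mulrA [N * 4]mulrC.
have h2 : 2 * b = N^-1 / 4 by rewrite /b; field; rewrite gt_eqF.
by apply: quarter_sum h1 h2 _; apply: half_inv.
Qed.

End good_potentials.

(** * Continuity of the Lyapunov exponent *)

Section lyapunov_continuity.
Variables (R : realType) (X : topologicalGroupType) (t : X).
Variable mu : probability (borel X) R.
Hypotheses (cX : compact [set: X]) (mint : minimal_translation t) (hmu : haar mu).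
Implicit Types (v : X -> R) (E : R).

Lemma dense_closed (T : topologicalType) (A B : set T) : dense A -> closed B ->
  A `<=` B -> B = [set: T].
Proof.
move=> dA cB AB; apply/seteqP; split=> // x _; apply: contrapT => nBx.
have [y [yB /AB]] : (~` B) `&` A !=set0.
  by apply: dA; [exists x|exact: closed_openC].
by [].
Qed.

(** The lower bound is known over the base point 1 only, but there [tm_supermul] applies at every
    site, that is, along the orbit of 1. Both sides are continuous and the orbit is dense. *)
Lemma growth_super v E K C : continuous v -> 0 <= K -> (forall x, `|v x - E| <= K) ->
  1 <= C -> lower (pot t v 1%g E) C -> forall n m x,
  growth t v E n x + growth t v E m (translation_iter t n x) <=
    growth t v E (n + m) x + ln (4 * super_const K C).
Proof.
move=> cv K0 vK C1 lC n m.
have c1 : 1 <= super_const K C.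
  by have := match_const_ge1 K0 C1; rewrite /super_const; nra.
have o0 k x : 0 < opnorm (transfer t v E k x).
  by apply: lt_le_trans (opnorm_ge1 _) => //; rewrite transferE det_tm.
pose h x := growth t v E (n + m) x + ln (4 * super_const K C) -
  (growth t v E n x + growth t v E m (translation_iter t n x)).
have ch : continuous h.
  move=> x; apply: cvgB.
    by apply: cvgD; [exact: growth_continuous|exact: cvg_cst].
  by apply: cvgD; [exact: growth_continuous|exact: growth_shift_continuous].
have closed_h : closed (h @^-1` [set y | 0 <= y]).
  by apply: preimage_closed; [move=> x _; exact: ch|exact: closed_ge].
suff orbit : [set translation_iter t i 1%g | i in [set: int]] `<=` h @^-1` [set y | 0 <= y].
  move=> x; rewrite -subr_ge0.
  by have /seteqP[_ /(_ x I)] := dense_closed (@mint 1%g) closed_h orbit.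
move=> _ [i _ <-] /=; rewrite /h subr_ge0 -translation_iterD /growth.
have V0 k : `|pot t v 1%g E k| <= K by exact: vK.
have := tm_supermul i n m K0 V0 C1 lC.
rewrite !tm_shift => sup.
have c0 : 0 < 4 * super_const K C by rewrite mulr_gt0// (lt_le_trans _ c1).
have c0' : 0 < super_const K C by rewrite (lt_le_trans _ c1).
rewrite -!lnM ?posrE// ler_ln ?posrE; [|exact: mulr_gt0..].
rewrite [n%:Z + i]addrC; apply: le_trans (ler_pM _ _ (opnorm_le_nrm _) (opnorm_le_nrm _)) _.
- exact: ltW.
- exact: ltW.
apply: le_trans sup _; rewrite mulrCA [opnorm _ * _]mulrC mulrCA ler_pM2l//.
exact: nrm_le_opnorm.
Qed.

Lemma norm_sub_near (a B E F : R) : `|a| <= B -> `|F - E| <= 1 ->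
  `|a - F| <= B + `|E| + 1.
Proof.
move=> aB FE; have -> : a - F = a - E - (F - E) by ring.
have h := ler_normB (a - E) (F - E); have h' := ler_normB a E; lra.
Qed.

Lemma lip_term_small (n : nat) (w x e : R) : (0 < n)%N -> 0 < w -> x < e / (8 * w) ->
  n%:R^-1 * (4 * (n%:R * w * x)) < e / 2.
Proof.
move=> n0 w0; rewrite ltr_pdivlMr ?mulr_gt0// => h.
have -> : n%:R^-1 * (4 * (n%:R * w * x)) = x * (8 * w) / 2.
  by field; rewrite pnatr_eq0 -lt0n.
by rewrite ltr_pM2r// invr_gt0.
Qed.

Lemma sum_halves (a b h k e : R) : a <= b + h -> h < e / 2 -> k < e / 2 -> a - e < b - k.
Proof. move=> *; lra. Qed.

Lemma lyapunov_usc v E0 e : continuous v -> 0 < e -> exists2 d, 0 < d &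
  forall E, `|E - E0| < d -> lyapunov t mu v E < lyapunov t mu v E0 + e.
Proof.
move=> cv e0; have e20 : 0 < e / 2 by rewrite divr_gt0.
have [n n0 hn] := lyapunov_adherent t E0 hmu cX cv e20.
have [B B0 vB] := continuous_bounded cX cv.
pose K := B + `|E0| + 1.
have K0 : 0 <= K by rewrite !addr_ge0.
have w0 : 0 < (K + 2) ^+ n by rewrite exprn_gt0// ltr_wpDl.
exists (Num.min 1 (e / (8 * (K + 2) ^+ n))); first by rewrite lt_min ltr01 divr_gt0// mulr_gt0.
move=> E; rewrite lt_min => /andP[E1 Ee].
have vE F : `|F - E0| <= 1 -> forall x, `|v x - F| <= K.
  by move=> FE x; exact: norm_sub_near.
have [_ up _] := lyapunovP t E hmu cX cv.
apply: le_lt_trans (up _ n0) _.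
have n0' : 0 < n%:R :> R by rewrite ltr0n.
have := logint_lip t mu n cX cv K0 (vE E (ltW E1)) (vE E0 _).
rewrite subrr normr0 => /(_ ler01).
rewrite -(@ler_pM2l _ n%:R^-1) ?invr_gt0// => /le_lt_trans; apply.
have h := lip_term_small n0 w0 Ee.
rewrite mulrDr; apply: lt_le_trans (ltrD hn h) _.
by rewrite -addrA -splitr.
Qed.

(** By [lower_perturb] one defect [c] serves for all [E] near [E0], so a single [n] with
    [c / n < e / 2] reduces the claim to the Lipschitz bound on [logint] at that [n]. *)
Lemma lyapunov_lsc v E0 e : continuous v -> ~ Sigma t v 1%g E0 -> 0 < e ->
  exists2 d, 0 < d &
  forall E, `|E - E0| < d -> lyapunov t mu v E0 - e < lyapunov t mu v E.
Proof.
move=> cv /Sigma_lower[C C1 lC] e0; have e20 : 0 < e / 2 by rewrite divr_gt0.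
have C0 : 0 < C by apply: lt_le_trans C1.
have C41 : 1 <= 4 * C by lra.
have C4 : (4 * C)^-1 <= 1 by rewrite invf_le1// mulr_gt0.
have [B B0 vB] := continuous_bounded cX cv.
pose K := B + `|E0| + 1.
have K0 : 0 <= K by rewrite !addr_ge0.
pose c := ln (4 * super_const K (4 * C)).
pose n := (Num.bound `|2 * c / e|).+1.
have n0 : (0 < n)%N by [].
have n0' : 0 < n%:R :> R by rewrite ltr0n.
have nc : n%:R^-1 * c < e / 2.
  rewrite ltr_pdivrMl// -ltr_pdivrMr// invf_div mulrA [c * 2]mulrC.
  apply: le_lt_trans (ler_norm _) _; apply: lt_trans (archi_boundP (normr_ge0 _)) _.
  by rewrite ltr_nat.
have w0 : 0 < (K + 2) ^+ n by rewrite exprn_gt0// ltr_wpDl.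
exists (Num.min (4 * C)^-1 (e / (8 * (K + 2) ^+ n))).
  by rewrite lt_min invr_gt0 mulr_gt0//= divr_gt0// mulr_gt0.
move=> E; rewrite lt_min => /andP[E1 Ee].
have EE1 : `|E - E0| <= 1 by exact: le_trans (ltW E1) C4.
have vE F : `|F - E0| <= 1 -> forall x, `|v x - F| <= K.
  by move=> FE x; exact: norm_sub_near.
have lC' : lower (pot t v 1%g E) (4 * C).
  apply: (lower_perturb (r := (4 * C)^-1) _ (ltW C0) _ lC).
    move=> k; rewrite /pot; set a := v _.
    by rewrite [X in `|X|](_ : _ = E - E0) ?ltW//; ring.
  by rewrite expr2 mulrA mulfV ?mul1r// gt_eqF// mulr_gt0.
have [_ _ low] := lyapunovP t E hmu cX cv.
apply: lt_le_trans (low _ (growth_super cv K0 (vE E EE1) C41 lC') _ n0).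
have [_ up _] := lyapunovP t E0 hmu cX cv.
apply: le_lt_trans (lerD (up _ n0) (lexx _)) _.
have := logint_lip t mu n cX cv K0 (vE E0 _) (vE E EE1).
rewrite subrr normr0 distrC => /(_ ler01).
rewrite -(@ler_pM2l _ n%:R^-1) ?invr_gt0// mulrDr.
rewrite mulrBr => h; exact: sum_halves h (lip_term_small n0 w0 Ee) nc.
Qed.

Lemma lyapunov_continuous v : continuous v ->
  (forall E, Sigma t v 1%g E -> lyapunov t mu v E = 0) -> continuous (lyapunov t mu v).
Proof.
move=> cv S0 E0; apply/cvgrPdist_lt => e e0.
have [d1 d10 usc] := lyapunov_usc E0 cv e0.
have [d2 d20 lsc] : exists2 d, 0 < d &
    forall E, `|E - E0| < d -> lyapunov t mu v E0 - e < lyapunov t mu v E.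
  (* On the spectrum the exponent is 0, its least possible value, so lower semicontinuity is
     immediate. *)
  have [/S0 ->|nS] := pselect (Sigma t v 1%g E0); last exact: lyapunov_lsc.
  exists 1 => // E _; have [L0 _ _] := lyapunovP t E hmu cX cv.
  by apply: lt_le_trans L0; rewrite sub0r oppr_lt0.
near=> E.
have Ed1 : `|E - E0| < d1 by rewrite distrC; near: E; exact: (nbhsx_ballx E0 d1 d10).
have Ed2 : `|E - E0| < d2 by rewrite distrC; near: E; exact: (nbhsx_ballx E0 d2 d20).
rewrite distrC ltr_distl; have := usc _ Ed1; have := lsc _ Ed2 => -> ->.
by [].
Unshelve. all: by end_near.
Qed.

End lyapunov_continuity.

(** * Conclusion *)

Section null_sets.
Variable R : realType.

Lemma lebesgue_measure_mono (A B : set R) : A `<=` B ->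
  (lebesgue_measure A <= lebesgue_measure B)%E.
Proof. by move=> AB; exact: le_mu_ext. Qed.

Lemma lebesgue_measure_segments (s : seq R) (eta : R) : 0 <= eta ->
  measurable (\big[setU/set0]_(l <- s) `[l - eta, l + eta]%classic) /\
  (lebesgue_measure (\big[setU/set0]_(l <- s) `[(l - eta)%R, (l + eta)%R]%classic) <=
    ((size s)%:R * (2 * eta))%:E)%E.
Proof.
move=> eta0; elim: s => [|l s [ms IH]].
  by rewrite big_nil mul0r measure0; split.
rewrite big_cons; split; first by apply: measurableU.
have seg : (lebesgue_measure (`[(l - eta)%R, (l + eta)%R]%classic : set R) <= (2 * eta)%:E)%E.
  rewrite lebesgue_measure_itv /= lte_fin.
  case: ifP => _; last by rewrite lee_fin mulr_ge0.
  by rewrite -EFinB lee_fin; lra.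
apply: le_trans (measureU2 _ _ _) _ => //.
have -> : ((size (l :: s))%:R * (2 * eta))%:E =
    ((2 * eta)%:E + ((size s)%:R * (2 * eta))%:E)%E.
  by rewrite -EFinD /= -natr1; congr (_%:E); ring.
exact: leeD.
Qed.

(** On arbitrary sets [lebesgue_measure] is an outer measure, so small covers suffice. *)
Lemma null_of_covers (S : set R) :
  (forall e : R, 0 < e -> exists (s : seq R) (eta : R),
    [/\ 0 <= eta, (size s)%:R * (2 * eta) <= e &
      forall E, S E -> exists2 l, l \in s & `|l - E| <= eta]) ->
  lebesgue_measure S = 0%E.
Proof.
move=> cov; apply/eqP; rewrite eq_le; apply/andP; split; last exact: outer_measure_ge0.
apply/lee_addgt0Pr => e /cov[s [eta [eta0 ss hs]]]; rewrite add0e.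
have [_ h] := lebesgue_measure_segments s eta0.
apply: (@le_trans _ _ ((size s)%:R * (2 * eta))%:E); last by rewrite lee_fin.
apply: le_trans h; apply: lebesgue_measure_mono => E /hs[l ls lE].
rewrite -bigcup_seq; exists l => //=.
by rewrite in_itv /= -ler_distlC.
Qed.

End null_sets.

Section continuous_functions.
Variables (X : topologicalType) (R : realType).

Lemma C0_nbhsP (f : continuousType X R) (P : set (C0 X R)) :
  nbhs (f : C0 X R) P <-> exists2 e : R, 0 < e &
    forall g : continuousType X R, (forall x, `|g x - f x| < e) -> P g.
Proof.
split; [case=> O [] [B oB <-] Bf BP | case=> e e0 h].
  have : nbhs (f : {uniform X -> R}) B by apply: open_nbhs_nbhs.
  move=> /uniform_nbhs[E [entE EB]].
  move: entE; rewrite -entourage_ballE => -[e /= e0 eE].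
  exists e => // g fg; apply: BP; apply: EB => y _; apply: eE => /=.
  by rewrite /ball /= distrC.
have W : nbhs (f : {uniform X -> R}) [set g | forall x, [set: X] x -> `|g x - f x| < e].
  apply/uniform_nbhs; exists [set xy | ball xy.1 e xy.2]; split.
    by rewrite -entourage_ballE; exists e.
  by move=> g fg x _; rewrite distrC; exact: fg.
have := @initial_continuous _ {uniform X -> R} (id : continuousType X R -> {uniform X -> R}) f _ W.
rewrite nbhs_simpl /= => nW; apply: (filterS _ nW) => g hg.
by apply: h => x; exact: hg.
Qed.

End continuous_functions.

Lemma exists_scale (R : realType) (lam e : R) : lam != 0 -> 0 < e ->
  exists n : nat, n.+1%:R^-1 <= `|lam| <= n.+1%:R /\ n.+1%:R^-1 <= e.
Proof.
move=> l0 e0; have L0 : 0 < `|lam| by rewrite normr_gt0.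
have i0 : 0 < `|lam|^-1 by rewrite invr_gt0.
have j0 : 0 < e^-1 by rewrite invr_gt0.
pose n := Num.bound (`|lam| + `|lam|^-1 + e^-1).
have hn : `|lam| + `|lam|^-1 + e^-1 < n.+1%:R.
  apply: lt_le_trans (archi_boundP _) _; last by rewrite ler_nat.
  by rewrite !addr_ge0// ltW.
exists n; split; last by rewrite -[leRHS]invrK lef_pV2 ?posrE ?ltr0n//; lra.
apply/andP; split; last lra.
by rewrite -[leRHS]invrK lef_pV2 ?posrE ?ltr0n//; lra.
Qed.

Theorem corollary1p2 (R : realType) (X : topologicalGroupType) (t : X)
    (mu : probability (borel X) R) :
  cantor_group X -> minimal_translation t -> haar mu ->
  exists2 G : set (C0 X R), residual G &
    forall v : continuousType X R, G v ->
    forall lambda : R, lambda != 0 ->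
      [/\ forall x : X,
            lebesgue_measure (Sigma t (fun y => lambda * v y) x) = 0%E,
          continuous (lyapunov t mu (fun y => lambda * v y)) &
          forall (x : X) (E : R), Sigma t (fun y => lambda * v y) x E ->
            lyapunov t mu (fun y => lambda * v y) E = 0].
Proof.
move=> cX mint hmu; have [cptX _ _ _] := cantor_groupP cX.
(* Taking the interior makes the set open; it is dense because [exists_good] puts a whole ball of
   good potentials around some [p] near any given function. *)
pose U n : set (C0 X R) := [set v : C0 X R | good t mu n.+1%:R (v : continuousType X R)]°.
exists (\bigcap_n U n).
  exists U; split=> // n; split; first exact: open_interior.
  move=> O [v0 Ov0] oO.
  have /C0_nbhsP[e e0 eO] : nbhs (v0 : C0 X R) O by apply: open_nbhs_nbhs.
  have N1 : 1 <= n.+1%:R :> R by rewrite ler1n.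
  have cv0 : continuous (v0 : continuousType X R) by exact: cts_fun.
  have [p [r [cp pv0 r0 hp]]] := exists_good cX mint hmu cv0 e0 N1.
  exists (mkcts cp : continuousType X R); split; first exact: eO.
  apply/C0_nbhsP; exists r => // g gp; apply: hp; first exact: cts_fun.
  by move=> x; exact/ltW/gp.
move=> v vU lam lam0.
have vgood n : good t mu n.+1%:R v by exact: (interior_subset (vU n I)).
have clv : continuous (fun x => lam * v x).
  by move=> x; apply: cvgM; [exact: cvg_cst|exact: cts_fun].
have L0 x E : Sigma t (fun y => lam * v y) x E ->
    lyapunov t mu (fun y => lam * v y) E = 0.
  move=> SE; apply/eqP; rewrite eq_le; apply/andP; split; last first.
    by have [] := lyapunovP t E hmu cptX clv.
  apply/ler_addgt0Pr => e e0; rewrite add0r.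
  have [n [nlam ne]] := exists_scale lam0 e0.
  have [_ /(_ _ _ SE) h] := vgood n lam nlam.
  exact: le_trans h ne.
split=> //; last by apply: lyapunov_continuous => // E; exact: L0.
move=> x; apply: null_of_covers => e e0.
have [n [nlam ne]] := exists_scale lam0 e0.
have [/(_ x)[s [eta [eta0 ss hs]]] _] := vgood n lam nlam.
by exists s, eta; split => //; exact: le_trans ss ne.
Qed.
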